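(* Let $\mathbb{G}$ be a stratified Lie group with homogeneous dimension $Q$, let $b$ be a locally integrable function on $\mathbb{G}$ and let $0<\beta<1$. Then the following statements are equivalent: (1) $b\in \dot{\Lambda}_{\beta}(\mathbb{G})$. (2) $M_{b}$ is bounded from $L^{p}(\mathbb{G})$ to $L^{q}(\mathbb{G})$ for all $p,q$ with $1<p<Q/\beta$ and $1/q=1/p-\beta/Q$. (3) $M_{b}$ is bounded from $L^{p}(\mathbb{G})$ to $L^{q}(\mathbb{G})$ for some $p,q$ with $1<p<Q/\beta$ and $1/q=1/p-\beta/Q$. (4) $M_{b}$ satisfies the weak-type $(1,Q/(Q-\beta))$ estimate, namely, there exists a positive constant $C$ such that $$\big|\{x\in\mathbb{G}: M_{b}(f)(x)>\lambda\}\big|\le C\left(\lambda^{-1}\|f\|_{L^{1}(\mathbb{G})}\right)^{Q/(Q-\beta)}$$ holds for all $\lambda>0$ and all $f\in L^{1}(\mathbb{G})$.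
   Context: A stratified Lie group $\mathbb{G}$ is a connected, simply connected Lie group whose (nonzero, finite-dimensional, real) Lie algebra $\mathcal{G}$ has a vector space decomposition $\mathcal{G}=V_{1}\oplus\cdots\oplus V_{m}$ with $[V_{1},V_{j}]=V_{j+1}$ for $1\le j\le m-1$ and $[V_{1},V_{m}]=0$ (nilpotent of step $m$). The homogeneous dimension is $Q=\sum_{j=1}^{m} j\dim V_{j}$. The dilations $\delta_{r}$, $r>0$, act on $\mathcal{G}$ by $\delta_{r}(\sum_{k}X_{k})=\sum_{k}r^{k}X_{k}$ ($X_{k}\in V_{k}$) and on $\mathbb{G}$ through the exponential map, which is a diffeomorphism. Fix a homogeneous norm $\rho$ on $\mathbb{G}$: a continuous function $\rho:\mathbb{G}\to[0,\infty)$, $C^{\infty}$ away from the identity $e$, with $\rho(x^{-1})=\rho(x)$, $\rho(\delta_{t}x)=t\rho(x)$ for $t>0$, and $\rho(x)=0$ if and only if $x=e$; there is a constant $c_{0}\ge1$ with $\rho(xy)\le c_{0}(\rho(x)+\rho(y))$ for all $x,y$. Balls are $B(x,r)=\{y\in\mathbb{G}:\rho(y^{-1}x)<r\}$, $x\in\mathbb{G}$, $r>0$. Integrals, $L^p$ spaces and $|E|$ are with respect to the (bi-invariant) Haar measure, which is the image of Lebesgue measure on $\mathcal{G}$ under $\exp$; $|B(x,r)|=c_{1}r^{Q}$. Functions are real-valued and identified when equal almost everywhere. Lipschitz space: for $0<\beta<1$, $b\in\dot{\Lambda}_{\beta}(\mathbb{G})$ means there is $C>0$ such that $|b(x)-b(y)|\le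 C\,\rho(y^{-1}x)^{\beta}$ for all $x,y\in\mathbb{G}$ (after modification of $b$ on a null set). Maximal commutator: for locally integrable $b$, $$M_{b}(f)(x)=\sup_{B\ni x}\frac{1}{|B|}\int_{B}|b(x)-b(y)|\,|f(y)|\,dy,$$ the supremum being over all balls $B\subset\mathbb{G}$ containing $x$. An operator $T$ is bounded from $X$ to $Y$ if there is $C>0$ with $\|Tf\|_{Y}\le C\|f\|_{X}$ for all $f\in X$. *)

(* Defs.v *)
From HB Require Import structures.
From mathcomp Require Import all_boot all_order all_algebra.
From mathcomp Require Import all_classical all_reals all_analysis.

Set Implicit Arguments.
Unset Strict Implicit.
Unset Printing Implicit Defensive.
Import Order.TTheory GRing.Theory Num.Theory.
Import numFieldNormedType.Exports.

Local Open Scope classical_set_scope.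
Local Open Scope ring_scope.

#[short(type="ptopGroupType")]
HB.structure Definition PTopGroup := {G of Group G & PointedTopological G}.

Section LieAlgebra.
Context {R : realType} {n : nat}.
Local Notation V := 'rV[R]_n.
Implicit Types (br : {bilinear V -> V -> V}) (U W : {vspace V}).

Definition is_lie_bracket br : Prop :=
  (forall x, br x x = 0) /\
  (forall x y z, br x (br y z) + br y (br z x) + br z (br x y) = 0).

(* The span of all [u, w] with u in U and w in W; by bilinearity it is spanned
   by the brackets of basis vectors. *)
Definition bracketv br U W : {vspace V} :=
  <<[seq br u w | u <- vbasis U, w <- vbasis W]>>%VS.

(* Only the values S 1, ..., S m are meaningful. *)
Definition is_stratification br (m : nat) (S : nat -> {vspace V}) : Prop :=
  [/\ directv (\sum_(j < m) S j.+1)%VS,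
      (\sum_(j < m) S j.+1)%VS = fullv,
      (forall j, (1 <= j < m)%N -> bracketv br (S 1%N) (S j) = S j.+1)
    & bracketv br (S 1%N) (S m) = 0%VS].

Definition dilation (m : nat) (S : nat -> {vspace V}) (r : R) (x : V) : V :=
  \sum_(j < m) r ^+ j.+1 *: sumv_pi (\sum_(j < m) S j.+1)%VS j x.

Fixpoint rnested_bracket br (w : seq V) : V :=
  match w with
  | [::] => 0
  | [:: x] => x
  | x :: w' => br x (rnested_bracket br w')
  end.

(* Dynkin's form of the Baker-Campbell-Hausdorff series log (e^x e^y) =
     \sum_(k >= 1) (-1)^(k-1)/k \sum_(r_i + s_i > 0)
       [x^r_1 y^s_1 ... x^r_k y^s_k] / (\sum_i (r_i + s_i) \prod_i r_i! s_i!),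
   with [_] the right-nested bracket of a word. When br is nilpotent of step at
   most m, words longer than m contribute 0, so k, r_i and s_i may be bounded by
   m; below, k starts at 0 and there are k + 1 blocks. *)
Definition bch br (m : nat) (x y : V) : V :=
  \sum_(k < m)
    \sum_(d : {ffun 'I_k.+1 -> 'I_m.+1 * 'I_m.+1}
          | [forall i, (0 < (d i).1 + (d i).2)%N])
      ((-1) ^+ k / k.+1%:R
        / (\sum_i ((d i).1 + (d i).2))%N%:R
        / (\prod_i ((d i).1`! * (d i).2`!))%N%:R) *:
      rnested_bracket br
        (flatten [seq nseq (d i).1 x ++ nseq (d i).2 y | i <- enum 'I_k.+1]).

End LieAlgebra.

(* A connected, simply connected nilpotent Lie group is carried by its Lie
   algebra through exp: the manifold structure of G is the one making the
   homeomorphism exp a diffeomorphism, and the product of G is the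
   Baker-Campbell-Hausdorff product, a polynomial map in the coordinates log. *)
Record stratifiedLieGroup (R : realType) := StratifiedLieGroup {
  slg_sort :> ptopGroupType ;
  slg_dim : nat ;
  slg_dim_gt0 : (0 < slg_dim)%N ;
  slg_bracket : {bilinear 'rV[R]_slg_dim -> 'rV[R]_slg_dim -> 'rV[R]_slg_dim} ;
  slg_bracketP : is_lie_bracket slg_bracket ;
  slg_step : nat ;
  slg_stratum : nat -> {vspace 'rV[R]_slg_dim} ;
  slg_stratumP : is_stratification slg_bracket slg_step slg_stratum ;
  slg_exp : 'rV[R]_slg_dim -> slg_sort ;
  slg_log : slg_sort -> 'rV[R]_slg_dim ;
  slg_expK : cancel slg_exp slg_log ;
  slg_logK : cancel slg_log slg_exp ;
  slg_exp_continuous : continuous slg_exp ;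
  slg_log_continuous : continuous slg_log ;
  slg_expM : forall x y,
    (slg_exp x * slg_exp y)%g = slg_exp (bch slg_bracket slg_step x y)
}.

Section Calculus.
Context {R : realType} {n : nat}.
Local Notation V := 'rV[R]_n.

Definition iter_derive (s : seq V) (f : V -> R) : V -> R :=
  foldr (fun v g => fun x => 'D_v g x) f s.

(* C^oo on an open set D. *)
Definition smooth_on (D : set V) (f : V -> R) : Prop :=
  forall (s : seq V) (x : V), D x ->
    {for x, continuous (iter_derive s f)} /\
    (forall v, derivable (iter_derive s f) x v).

End Calculus.

Notation borel T := (g_sigma_algebraType (@open T)).

Section StratifiedGroup.
Context {R : realType} (G : stratifiedLieGroup R).

Definition hom_dim : nat :=
  (\sum_(j < slg_step G) j.+1 * \dim (slg_stratum G j.+1))%N.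

Definition gdilation (r : R) (x : G) : G :=
  slg_exp (dilation (slg_step G) (slg_stratum G) r (slg_log x)).

Record is_homogeneous_norm (rho : G -> R) : Prop := {
  hnorm_ge0 : forall x, 0 <= rho x ;
  hnorm_continuous : continuous rho ;
  hnorm_smooth : smooth_on [set x | slg_exp x <> 1%g :> G]
                   (fun x => rho (slg_exp x)) ;
  hnormV : forall x, rho x^-1%g = rho x ;
  hnorm_dilation : forall t x, 0 < t -> rho (gdilation t x) = t * rho x ;
  hnorm_eq0 : forall x, rho x = 0 <-> x = 1%g
}.

Definition gball (rho : G -> R) (x : G) (r : R) : set G :=
  [set y | rho (y^-1 * x)%g < r].

Record is_haar (mu : {measure set (borel G) -> \bar R}) : Prop := {
  haar_left_invariant : forall (x : G) (A : set (borel G)), measurable A ->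
    mu [set (x * y)%g | y in A] = mu A ;
  haar_right_invariant : forall (x : G) (A : set (borel G)), measurable A ->
    mu [set (y * x)%g | y in A] = mu A ;
  (* mu is the image under exp of Lebesgue measure, determined by its values on
     boxes *)
  haar_lebesgue : forall a b : 'rV[R]_(slg_dim G),
    (forall i, a 0 i <= b 0 i) ->
    mu [set slg_exp x | x in [set x : 'rV[R]_(slg_dim G) |
                              forall i, a 0 i <= x 0 i <= b 0 i]] =
    (\prod_i (b 0 i - a 0 i))%:E
}.

Section Operators.
Variables (rho : G -> R) (mu : {measure set (borel G) -> \bar R}).
Local Open Scope ereal_scope.

Definition loc_integrable (b : borel G -> R) : Prop :=
  measurable_fun [set: borel G] b /\
  forall K : set G, compact K -> mu.-integrable K (EFin \o b).

Definition lipschitz_space (beta : R) (b : borel G -> R) : Prop :=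
  exists2 b' : G -> R, {ae mu, forall x, b x = b' x} &
    exists2 C : R, (0 < C)%R &
      forall x y : G, (`|b' x - b' y| <= C * rho (y^-1 * x)%g `^ beta)%R.

Definition maximal_commutator (b f : borel G -> R) (x : borel G) : \bar R :=
  ereal_sup [set (mu B)^-1 * \int[mu]_(y in B) (`|b x - b y| * `|f y|)%:E
            | B in [set B : set (borel G) |
                    (exists z r, (0 < r)%R /\ B = gball rho z r) /\ B x]].

Definition bounded_Lp_Lq (p q : R) (T : (borel G -> R) -> borel G -> \bar R) :=
  exists2 C : R, (0 < C)%R &
    forall f : borel G -> R, f \in Lfun mu p%:E ->
      'N[mu]_q%:E[T f] <= C%:E * 'N[mu]_p%:E[EFin \o f].

Definition weak_type_1 (s : R) (T : (borel G -> R) -> borel G -> \bar R) :=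
  exists2 C : R, (0 < C)%R &
    forall (lambda : R) (f : borel G -> R), (0 < lambda)%R ->
      f \in Lfun mu 1 ->
      mu [set x | T f x > lambda%:E] <=
        C%:E * ((lambda^-1)%:E * 'N[mu]_1[EFin \o f]) `^ s.

End Operators.
End StratifiedGroup.

(* Main.v *)
Require Import Defs.
From HB Require Import structures.
From mathcomp Require Import all_boot all_order all_algebra.
From mathcomp Require Import all_classical all_reals all_analysis.
From mathcomp Require Import measurable_realfun.
From mathcomp Require Import ring lra.

(* The distance d(x, y) = rho (x^-1 y) and the Haar measure make the group an
   Ahlfors regular quasi-metric space of dimension Q: up to constants, the
   volume of a ball of radius r is r^Q. Everything else takes place in such a
   space.

   If b is Lipschitz of order beta, the commutator average over a ball of radius
   r is at most C r^beta times the average of |f|, and Hedberg's inequality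
   bounds this by (Mf)^(p/q) |f|_p^(1 - p/q), where M is the Hardy-Littlewood
   maximal operator. The strong (p, p) and weak (1, 1) bounds of M (Vitali
   covering, dyadic layer cake) give the bounds of the commutator.

   Conversely, either bound applied to the indicator function of a ball B forces
   the average over B of |b - b(x)| to be at most C r^beta for some x in B, since
   otherwise M_b(1_B) would be too large on all of B. Hence b has a Lipschitz
   version, the limit of the constants b(x) as the balls shrink.

   The volume estimate only needs the effect of the dilation by 2: in coordinates
   adapted to the stratification, doubling one side of a parallelepiped doubles
   its volume by translation invariance, so that the dilation by 2 multiplies
   volumes by 2^Q. *)

Set Implicit Arguments.
Unset Strict Implicit.
Unset Printing Implicit Defensive.
Import Order.TTheory GRing.Theory Num.Theory.
Import numFieldNormedType.Exports.

Local Open Scope classical_set_scope.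
Local Open Scope ring_scope.

(** * Maximal operators on Ahlfors regular quasi-metric spaces *)

(** The abstract space asks only for what the group can supply. Exact scaling of Haar measure is
    established at powers of 2 alone, so [vol] is subject to two-sided power bounds and the lost
    factors go into constants. The kernel of the commutator depends on [b x] with [b] merely
    measurable, so a superlevel set need not be a union of balls; the countable family [zs] of
    centres serves to prove it measurable. The Lipschitz version is compared with [b] without a
    differentiation theorem: the integral of their difference over a ball of radius r is at most
    r^beta times its volume, up to a constant, and summing over a packing by balls of radius r and
    letting r tend to 0 leaves nothing. *)

Definition qball {R : realType} {T : Type} (dist : T -> T -> R) (x : T) (r : R)
  : set T := [set y | dist y x < r].

(** In a quasi-metric space [dist y] need not be continuous, so density of [zs] is required in the
    form in which it is used: the distances from every point [y] converge. *)
Record ahlfors_regular d (T : measurableType d) (R : realType)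
    (mu : {measure set T -> \bar R}) (dist : T -> T -> R) (Q K c1 c2 : R)
    (vol : R -> R) (zs : nat -> T) : Prop := {
  quasi_dist_ge0 : forall x y, 0 <= dist x y ;
  quasi_dist_eq0 : forall x y, dist x y = 0 <-> x = y ;
  quasi_dist_sym : forall x y, dist x y = dist y x ;
  quasi_const_ge1 : 1 <= K ;
  quasi_dist_triangle : forall x y z, dist x z <= K * (dist x y + dist y z) ;
  measurable_qball : forall x r, measurable (qball dist x r) ;
  qball_measure : forall x r, mu (qball dist x r) = (vol r)%:E ;
  hdim_gt0 : 0 < Q ;
  vol_const_gt0 : 0 < c1 ;
  vol_lb : forall r, 0 < r -> c1 * r `^ Q <= vol r ;
  vol_ub : forall r, 0 < r -> vol r <= c2 * r `^ Q ;
  quasi_dist_separable : forall z, exists phi : nat -> nat,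
    forall y, dist y (zs (phi n)) @[n --> \oo] --> dist y z
}.

Section measure_lemmas.
Context d (T : measurableType d) (R : realType).
Variable mu : {measure set T -> \bar R}.
Local Open Scope ereal_scope.

Lemma integral_bigcup_gt (F : (set T)^nat) (f : T -> \bar R) (t : \bar R) :
  {homo F : n m / (n <= m)%N >-> (n <= m)%O} ->
  (forall i, measurable (F i)) -> measurable_fun [set: T] f ->
  (forall x, 0 <= f x) ->
  t < \int[mu]_(x in \bigcup_i F i) f x ->
  exists n, t < \int[mu]_(x in F n) f x.
Proof.
move=> ndF mF mf f0 tlt.
have mfF n : measurable_fun (F n) f by exact: measurable_funTS.
have cF := @ge0_nondecreasing_set_cvg_integral _ _ _ F f mu ndF mF mfF
  (fun i x _ => f0 x).
apply: contrapT => /forallNP H.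
move: tlt; rewrite ltNge; apply/negP; rewrite negbK.
rewrite -(cvg_lim _ cF)//; apply: lime_le; first by apply/cvg_ex; eexists; exact: cF.
by apply: nearW => n; rewrite leNgt; exact/negP.
Qed.

Lemma measure_bigcup_le (F : (set T)^nat) (M : \bar R) :
  (forall i, measurable (F i)) ->
  (forall n, mu (\big[setU/set0]_(i < n) F i) <= M) ->
  mu (\bigcup_i F i) <= M.
Proof.
move=> mF FM.
rewrite -(bigcup_bigsetU_bigcup F).
have mG n : measurable (\big[setU/set0]_(i < n.+1) F i).
  by apply: bigsetU_measurable.
have cF : mu (\big[setU/set0]_(i < n.+1) F i) @[n --> \oo] -->
    mu (\bigcup_n \big[setU/set0]_(i < n.+1) F i).
  apply: nondecreasing_cvg_mu => //; first by exact: bigcupT_measurable.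
  move=> n m nm; apply/subsetPset; exact: subset_bigsetU.
rewrite -(cvg_lim _ cF)//; apply: lime_le; first by apply/cvg_ex; eexists; exact: cF.
by apply: nearW => n; exact: FM.
Qed.

End measure_lemmas.

Section maximal_operator.
Context d (T : measurableType d) (R : realType).
Variables (mu : {measure set T -> \bar R}) (dist : T -> T -> R).
Local Open Scope ereal_scope.

(** A kernel of two variables covers both the Hardy-Littlewood function, where it does not depend on
    [x], and the maximal commutator. *)
Definition max_op (k : T -> T -> \bar R) (x : T) : \bar R :=
  ereal_sup [set (mu B)^-1 * \int[mu]_(y in B) k x y
            | B in [set B : set T |
                    (exists z r, (0 < r)%R /\ B = qball dist z r) /\ B x]].

End maximal_operator.

Section maximal_operators.
Context d (T : measurableType d) (R : realType).
Context (mu : {measure set T -> \bar R}) (dist : T -> T -> R) (Q K c1 c2 : R).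
Context (vol : R -> R) (zs : nat -> T).
Hypothesis hR : ahlfors_regular mu dist Q K c1 c2 vol zs.
Local Notation ball := (qball dist).
Local Notation mball := (measurable_qball hR).

Lemma vol_gt0 r : 0 < r -> 0 < vol r.
Proof.
move=> r0; apply: lt_le_trans (vol_lb hR r0).
by rewrite mulr_gt0 ?powR_gt0// (vol_const_gt0 hR).
Qed.

Lemma vol_const2_gt0 : 0 < c2.
Proof.
have := lt_le_trans (vol_gt0 ltr01) (vol_ub hR ltr01).
by rewrite powR1 mulr1.
Qed.

Lemma subset_qball x r s : r <= s -> ball x r `<=` ball x s.
Proof. by move=> rs y /lt_le_trans; apply. Qed.

Lemma vol_le r s : r <= s -> vol r <= vol s.
Proof.
move=> rs; rewrite -lee_fin -!(qball_measure hR point).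
by apply: le_measure; rewrite ?inE; [exact: mball|exact: mball|exact: subset_qball].
Qed.

Lemma qball_center x r : 0 < r -> ball x r x.
Proof. by move=> r0; rewrite /qball/= (quasi_dist_eq0 hR x x).2. Qed.

Lemma inve_qball x r : 0 < r -> ((mu (ball x r))^-1)%E = ((vol r)^-1)%:E.
Proof. by move=> r0; rewrite (qball_measure hR) inver gt_eqF// vol_gt0. Qed.

Local Open Scope ereal_scope.

Lemma inve_qball_mul_gt x r (a : \bar R) t : (0 < r)%R ->
  (t%:E < (mu (ball x r))^-1 * a) = ((vol r * t)%:E < a).
Proof. by move=> r0; rewrite inve_qball// lte_pdivlMl ?vol_gt0. Qed.

(** The ball is the increasing union of the balls of radius r - 1/(n+1); by monotone convergence a
    strict lower bound on the integral survives at some n, and a rational radius fits between that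
    one and [r]. *)
Lemma qball_shrink z r x (g : T -> \bar R) (t : \bar R) : (0 < r)%R -> measurable_fun setT g ->
  (forall y, 0 <= g y) -> ball z r x -> t < \int[mu]_(y in ball z r) g y ->
  exists q : rat, [/\ (0 < ratr q :> R)%R, (ratr q <= r)%R, ball z (ratr q) x
    & t < \int[mu]_(y in ball z (ratr q)) g y].
Proof.
move=> r0 mg g0 zx tlt.
pose F n := ball z (r - n.+1%:R^-1).
have FU : ball z r = \bigcup_n F n.
  apply/seteqP; split => [y|y [n _]]; last first.
    by rewrite /F/qball/= => /lt_le_trans; apply; rewrite gerBl.
  rewrite /qball/= -subr_gt0 => /ltr_add_invr[n]; rewrite add0r => yn.
  by exists n => //; rewrite /F /qball/= ltrBrDr -ltrBrDl.
have ndF : {homo F : n m / (n <= m)%N >-> (n <= m)%O}.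
  move=> n m nm; apply/subsetPset; apply: subset_qball; rewrite lerB//.
  by rewrite lef_pV2 ?posrE// ler_nat.
have [n nt] : exists n, t < \int[mu]_(y in F n) g y.
  by apply: integral_bigcup_gt => //; [move=> i; exact: mball|rewrite -FU].
have [m _ Fmx] : (\bigcup_n F n) x by rewrite -FU.
pose N := maxn n m.
have nN : F n `<=` F N by apply/subsetPset/ndF; rewrite leq_maxl.
have mN : F m `<=` F N by apply/subsetPset/ndF; rewrite leq_maxr.
have [q /[!in_itv]/=/andP[q1 q2]] : exists q : rat, (ratr q : R) \in `](r - N.+1%:R^-1)%R, r[%R.
  by apply: rat_in_itvoo; rewrite ltrBlDr ltrDl.
have sq : F N `<=` ball z (ratr q) by apply: subset_qball; exact: ltW.
have qx : ball z (ratr q) x by exact/sq/mN.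
exists q; split => //.
- by apply: le_lt_trans qx; exact: (quasi_dist_ge0 hR).
- exact: ltW.
apply: lt_le_trans nt _; apply: ge0_subset_integral => //.
- exact: mball.
- exact: mball.
- exact: measurable_funTS.
- by apply: subset_trans sq.
Qed.

(** The points lying in all balls of radius [r] centred at [zs (phi n)], n >= N, form sets that
    increase with N and cover [ball z r], because the distances to these centres converge to the
    distance to [z]. *)
Lemma qball_recenter z r x (g : T -> \bar R) (t : \bar R) : measurable_fun setT g ->
  (forall y, 0 <= g y) -> ball z r x -> t < \int[mu]_(y in ball z r) g y ->
  exists n, ball (zs n) r x /\ t < \int[mu]_(y in ball (zs n) r) g y.
Proof.
move=> mg g0 zx tlt.
have [phi phiP] := quasi_dist_separable hR z.
pose F N := \bigcap_(n in [set n | (N <= n)%N]) ball (zs (phi n)) r.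
have mF N : measurable (F N).
  by apply: bigcap_measurable; [exists N => /=|move=> n _; exact: mball].
have FU : ball z r `<=` \bigcup_n F n.
  move=> y yz; have [N _ HN] := cvgr_lt _ (phiP y) _ yz.
  by exists N => // n /HN.
have ndF : {homo F : n m / (n <= m)%N >-> (n <= m)%O}.
  by move=> n m nm; apply/subsetPset => y Fy k /= mk; apply: Fy; exact: leq_trans mk.
have [n nt] : exists n, t < \int[mu]_(y in F n) g y.
  apply: integral_bigcup_gt => //; apply: lt_le_trans tlt _.
  by apply: ge0_subset_integral => //; [exact: mball|exact: bigcupT_measurable|exact: measurable_funTS].
have [m _ Fmx] := FU _ zx.
pose N := maxn n m.
exists (phi N); split; first by apply: Fmx; rewrite /= leq_maxr.
apply: lt_le_trans nt _; apply: ge0_subset_integral => //.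
- exact: mball.
- exact: measurable_funTS.
- by move=> y; apply => /=; rewrite leq_maxl.
Qed.

Definition rat_qball (i : nat * rat) := ball (zs i.1) (ratr i.2).

(* Shrinking the radius to a rational and moving the centre to a point of zs
   loses an arbitrarily small part of the integral and does not increase the
   measure, so countably many balls suffice. *)
Lemma max_op_gtP (k : T -> T -> \bar R) x t :
  measurable_fun setT (k x) -> (forall y, 0 <= k x y) ->
  t%:E < max_op mu dist k x <->
  exists i : nat * rat, [/\ (0 < ratr i.2 :> R)%R, rat_qball i x
    & (vol (ratr i.2) * t)%:E < \int[mu]_(y in rat_qball i) k x y].
Proof.
move=> mk k0; split; last first.
  move=> [i [i0 ix it]]; rewrite -(inve_qball_mul_gt (zs i.1)) // in it.
  apply: lt_le_trans it _; apply: ereal_sup_ubound; exists (rat_qball i) => //.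
  by split=> //; exists (zs i.1), (ratr i.2).
move=> /ereal_sup_gt[_ [_ [[z [r [r0 ->]]] zx] <-]].
rewrite inve_qball_mul_gt// => tlt.
(* For negative [t] a smaller measure makes the left-hand side larger, but it stays below the
   nonnegative integral; the threshold [-oo] keeps only the membership of [x]. *)
have [t0|t0] := leP 0%R t; last first.
  have [q [q0 qr qx _]] := qball_shrink r0 mk k0 zx tlt.
  have tlt' : -oo < \int[mu]_(y in ball z (ratr q)) k x y.
    by apply: lt_le_trans (integral_ge0 _ _).
  have [n [nx _]] := qball_recenter mk k0 qx tlt'.
  exists (n, q); split => //=; apply: lt_le_trans (integral_ge0 _ _) => //.
  by rewrite lte_fin pmulr_rlt0// vol_gt0.
have [q [q0 qr qx tlt']] := qball_shrink r0 mk k0 zx tlt.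
have [n [nx tlt'']] := qball_recenter mk k0 qx tlt'.
exists (n, q); split => //=; apply: le_lt_trans tlt''.
by rewrite lee_fin ler_wpM2r// vol_le.
Qed.

Lemma ahlfors_sigma_finite : sigma_finite setT mu.
Proof.
exists (fun n => ball point n%:R).
  apply/seteqP; split => // y _; exists (Num.truncn (dist y point)).+1 => //.
  by rewrite /qball/= truncnS_gt.
by move=> n; split; [exact: mball|rewrite (qball_measure hR) ltry].
Qed.

Lemma measurable_max_op (k : T -> T -> \bar R) :
  measurable_fun setT (fun xy : T * T => k xy.1 xy.2) ->
  (forall x y, 0 <= k x y) -> measurable_fun setT (max_op mu dist k).
Proof.
move=> mk k0.
have mkx x : measurable_fun setT (k x).
  apply: (@measurableT_comp _ _ _ _ _ _ _ _ (fun y => (x, y)) mk).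
  exact: measurable_fun_pair.
apply: (measurability _ (ErealGenOInfty.measurableE R)) => // _ [_ [t ->] <-].
rewrite setTI.
rewrite [X in measurable X](_ : _ = \bigcup_i
   ((fun x => \int[mu]_(y in rat_qball i) k x y) @^-1` `](vol (ratr i.2) * t)%:E, +oo[%classic
    `&` [set x | (0 < ratr i.2 :> R)%R /\ rat_qball i x])); last first.
  apply/seteqP; split => x /=.
    rewrite in_itv/= andbT => /(max_op_gtP t (mkx x) (k0 x))[i [i0 ix it]].
    by exists i => //=; rewrite in_itv/= andbT.
  move=> [i _ [/=]]; rewrite !in_itv/= !andbT => it [i0 ix].
  by apply/(max_op_gtP t (mkx x) (k0 x)); exists i.
apply: countable_bigcupT_measurable; first exact: countableP.
move=> i; apply: measurableI; last first.
  have [i0|i0] := boolP (0 < ratr i.2 :> R)%R; last first.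
    by rewrite [X in measurable X](_ : _ = set0)//; apply/seteqP; split => // x [].
  rewrite [X in measurable X](_ : _ = rat_qball i)//; first exact: mball.
  by apply/seteqP; split => // x [].
rewrite -[X in measurable X]setTI.
suff : measurable_fun setT (fun x => \int[mu]_(y in rat_qball i) k x y).
  by apply => //; exact: emeasurable_itv.
(* Tonelli's theorem is stated for sigma-finite measure structures, so [mu] is repackaged as one. *)
pose H1 := isSFinite.Build _ _ _ (Measure.sort mu)
  (sfinite_measure_sigma_finite ahlfors_sigma_finite).
pose H2 := isSigmaFinite.Build _ _ _ (Measure.sort mu) ahlfors_sigma_finite.
pose mu' := HB.pack_for (SigmaFiniteMeasure.type T R) (Measure.sort mu) H1 H2.
rewrite (_ : (fun x => _) = fubini_F mu'
  ((fun xy : T * T => k xy.1 xy.2) \_ (setT `*` rat_qball i))); last first.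
  apply/funext => x; rewrite /fubini_F integral_mkcond; apply: eq_integral => y _.
  by rewrite /patch in_setX/= in_setT.
apply: measurable_fun_fubini_tonelli_F; last first.
  by move=> xy; rewrite /patch; case: ifP.
apply: (measurable_restrictT _ _).1; last exact: measurable_funTS.
by apply: measurableX => //; exact: mball.
Qed.

End maximal_operators.

(** * Vitali covering and the weak (1, 1) bound *)

Section vitali_covering.
Context d (T : measurableType d) (R : realType).
Context (mu : {measure set T -> \bar R}) (dist : T -> T -> R) (Q K c1 c2 : R).
Context (vol : R -> R) (zs : nat -> T).
Hypothesis hR : ahlfors_regular mu dist Q K c1 c2 vol zs.
Local Notation ball := (qball dist).
Local Notation mball := (measurable_qball hR).
Lemma exists_max_radius (s : seq (T * R)) : s != [::] ->
  exists2 p, p \in s & forall q, q \in s -> q.2 <= p.2.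
Proof.
elim: s => // p [|q s] IH _.
  by exists p; rewrite ?mem_head// => q; rewrite inE => /eqP ->.
have [//|m ms mmax] := IH.
have [pm|mp] := leP p.2 m.2.
  exists m; first by rewrite inE ms orbT.
  by move=> u; rewrite inE => /predU1P[->//|/mmax].
exists p; rewrite ?mem_head// => u; rewrite inE => /predU1P[->//|/mmax um].
exact: le_trans um (ltW mp).
Qed.

(** If two balls meet and the second, of radius r, is the larger, a point of the first is within
    [K * 2] times r of a common point, hence within this multiple of r of the second centre. For
    [K = 1] it is the usual 3. *)
Definition vitali_const : R := K * (K * 2 + 1).

Lemma vitali_const_gt0 : 0 < vitali_const.
Proof. by have K1 := quasi_const_ge1 hR; rewrite /vitali_const mulr_gt0//; lra. Qed.

Lemma qball_engulf (p q : T * R) : p.2 <= q.2 ->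
  ball p.1 p.2 `&` ball q.1 q.2 !=set0 ->
  ball p.1 p.2 `<=` ball q.1 (vitali_const * q.2).
Proof.
have K1 := quasi_const_ge1 hR.
move=> pq [y [yp yq]] u up; rewrite /qball /= in yp yq up *.
have h1 := quasi_dist_triangle hR u y q.1.
have h2 := quasi_dist_triangle hR u p.1 y.
rewrite (quasi_dist_sym hR p.1) in h2.
apply: (le_lt_trans h1); rewrite /vitali_const -mulrA ltr_pM2l; last by lra.
rewrite mulrDl mul1r; apply: ler_ltD => //; apply: (le_trans h2).
rewrite -mulrA ler_pM2l; last by lra.
lra.
Qed.

Local Open Scope ereal_scope.

(** Greedy choice: keep a ball of largest radius, discard the balls meeting it, which its dilate
    covers, and recurse. Disjointness is recorded only through its effect on integrals; [g] will be
    the averaged function in the weak bound and the constant 1 in a packing argument. *)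
Lemma vitali_select (g : T -> \bar R) : measurable_fun setT g ->
  (forall x, 0 <= g x) -> forall s : seq (T * R),
  (forall p, p \in s -> 0 < p.2)%R ->
  exists s' : seq (T * R), [/\ {subset s' <= s},
    forall p, p \in s -> exists2 q, q \in s' &
       ball p.1 p.2 `<=` ball q.1 (vitali_const * q.2)
    & \sum_(p <- s') \int[mu]_(y in ball p.1 p.2) g y <=
      \int[mu]_(y in \big[setU/set0]_(p <- s) ball p.1 p.2) g y].
Proof.
move=> mg g0 s; have [n] := ubnP (size s); elim: n s => // n IH s ssz s0.
have [->|sn0] := eqVneq s [::].
  by exists [::]; split => //; rewrite !big_nil integral_set0.
have [p ps pmax] := exists_max_radius sn0.
pose P (q : T * R) := `[< ball q.1 q.2 `&` ball p.1 p.2 = set0 >].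
pose s1 := [seq q <- s | P q].
have p0 := s0 _ ps.
have pP : ~~ P p.
  apply/asboolPn; rewrite setIid => /seteqP[+ _] => /(_ p.1); apply.
  exact: (qball_center hR).
have s1sz : (size s1 < n)%N.
  rewrite /s1 size_filter -ltnS; apply: leq_trans ssz.
  rewrite ltnS -(count_predC P s) -[X in (X < _)%N]addn0 ltn_add2l -has_count.
  by apply/hasP; exists p.
have s10 q : q \in s1 -> (0 < q.2)%R by rewrite mem_filter => /andP[_ /s0].
have [s2 [s21 cov le2]] := IH _ s1sz s10.
have ms1 : measurable (\big[setU/set0]_(q <- s1) ball q.1 q.2).
  by apply: bigsetU_measurable => i _; exact: mball.
exists (p :: s2); split.
- move=> q; rewrite inE => /predU1P[->//|/s21].
  by rewrite mem_filter => /andP[].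
- move=> q qs; have [Pq|nPq] := boolP (P q).
    have [|u us2 qu] := cov q; first by rewrite mem_filter Pq.
    by exists u => //; rewrite inE us2 orbT.
  exists p; rewrite ?mem_head//; apply: qball_engulf; first exact: pmax.
  by apply/set0P/eqP; exact/asboolPn.
- rewrite big_cons; apply: (le_trans (leeD2l _ le2)).
  rewrite -ge0_integral_setU//.
  + apply: ge0_subset_integral => //.
    * by apply: measurableU => //; exact: mball.
    * by apply: bigsetU_measurable => i _; exact: mball.
    * exact: measurable_funTS.
    * move=> y [yp|].
        by rewrite -bigcup_seq; exists p.
      rewrite -!bigcup_seq => -[q /=]; rewrite mem_filter => /andP[_ qs] yq.
      by exists q.
  + exact: mball.
  + exact: measurable_funTS.
  + apply/disj_setPS => y [yp]; rewrite -bigcup_seq => -[q /=].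
    rewrite mem_filter => /andP[/asboolP qp qs] yq.
    have : (ball q.1 q.2 `&` ball p.1 p.2) y by split.
    by rewrite qp.
Qed.

Lemma measure_dilated_qball x r L : (0 < r)%R -> (0 < L)%R ->
  mu (ball x (L * r)) <= (c2 / c1 * L `^ Q)%:E * mu (ball x r).
Proof.
move=> r0 L0; rewrite !(qball_measure hR) -EFinM lee_fin.
apply: (le_trans (vol_ub hR (mulr_gt0 L0 r0))).
rewrite powRM ?(ltW r0) ?(ltW L0)// mulrA.
have -> : (c2 / c1 * L `^ Q * vol r = c2 * L `^ Q * (vol r / c1))%R by ring.
rewrite ler_pM2l ?mulr_gt0 ?powR_gt0 ?(vol_const2_gt0 hR)//.
rewrite ler_pdivlMr ?(vol_const_gt0 hR)// mulrC.
exact: (vol_lb hR).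
Qed.

Definition doubling_const := (c2 / c1 * vitali_const `^ Q)%R.

Lemma doubling_const_gt0 : (0 < doubling_const)%R.
Proof.
rewrite /doubling_const mulr_gt0 ?powR_gt0 ?vitali_const_gt0// divr_gt0//.
  exact: (vol_const2_gt0 hR).
exact: (vol_const_gt0 hR).
Qed.

Lemma le_measure_bigsetU (I : Type) (s : seq I) (F : I -> set T) :
  (forall i, measurable (F i)) ->
  mu (\big[setU/set0]_(i <- s) F i) <= \sum_(i <- s) mu (F i).
Proof.
move=> mF; elim: s => [|i s IH]; first by rewrite !big_nil measure0.
rewrite !big_cons; apply: (le_trans (measureU2 _ _ _)) => //.
  exact: bigsetU_measurable.
exact: leeD2l.
Qed.

(** A ball with average above [t] has measure at most 1/t times its integral. Over the selected
    balls these integrals add up to at most the total, and passing to the dilates costs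
    [doubling_const]. *)
Lemma measure_bad_balls (g : T -> \bar R) (t : R) (s : seq (T * R)) :
  measurable_fun setT g -> (forall x, 0 <= g x) -> (0 < t)%R ->
  (forall p, p \in s ->
    (0 < p.2)%R /\ (vol p.2 * t)%:E < \int[mu]_(y in ball p.1 p.2) g y) ->
  mu (\big[setU/set0]_(p <- s) ball p.1 p.2) <=
  (doubling_const / t)%:E * \int[mu]_y g y.
Proof.
move=> mg g0 t0 sP.
have [|s' [s's cov le_s']] := vitali_select mg g0 (s := s).
  by move=> p /sP[].
have mbig (f : T * R -> R) (u : seq (T * R)) :
    measurable (\big[setU/set0]_(p <- u) ball p.1 (f p)).
  by apply: bigsetU_measurable => i _; exact: mball.
apply: (@le_trans _ _ (mu (\big[setU/set0]_(p <- s') ball p.1 (vitali_const * p.2)))).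
  apply: le_measure; rewrite ?inE; [exact: mbig|exact: mbig|].
  rewrite -!bigcup_seq => y [p /= ps] yp; have [q qs' pq] := cov _ ps.
  by exists q => //; exact: pq.
apply: (le_trans (le_measure_bigsetU _ _)); first by move=> i; exact: mball.
apply: (@le_trans _ _ ((doubling_const / t)%:E *
    \sum_(p <- s') \int[mu]_(y in ball p.1 p.2) g y)).
  rewrite ge0_sume_distrr; last by move=> i _; exact: integral_ge0.
  rewrite big_seq [leRHS]big_seq; apply: lee_sum => p ps'.
  have [p0 /ltW pt] := sP _ (s's _ ps').
  apply: (le_trans (measure_dilated_qball _ p0 vitali_const_gt0)).
  rewrite -/doubling_const (EFinM doubling_const) -muleA; apply: lee_wpmul2l.
    by rewrite lee_fin ltW// doubling_const_gt0.
  by rewrite lee_pdivlMl// (qball_measure hR) -EFinM mulrC.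
apply: lee_wpmul2l; first by rewrite lee_fin ltW// divr_gt0// doubling_const_gt0.
apply: (le_trans le_s'); apply: ge0_subset_integral => //; exact: mbig.
Qed.

Definition hl_max (g : T -> \bar R) := max_op mu dist (fun _ => g).

Lemma measurable_hl_max g : measurable_fun setT g -> (forall x, 0 <= g x) ->
  measurable_fun setT (hl_max g).
Proof.
move=> mg g0; apply: (measurable_max_op hR) => //.
exact: (@measurableT_comp _ _ _ _ _ _ _ _ snd mg).
Qed.

Lemma hl_max_ge0 g x : (forall x, 0 <= g x) -> 0 <= hl_max g x.
Proof.
move=> g0; apply: (@le_trans _ _ ((mu (ball x 1))^-1 * \int[mu]_(y in ball x 1) g y)).
  by rewrite mule_ge0 ?inve_ge0 ?integral_ge0.
apply: ereal_sup_ubound; exists (ball x 1) => //; split; first by exists x, 1%R.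
exact: (qball_center hR).
Qed.

Lemma hl_max_weak11 (g : T -> \bar R) (t : R) :
  measurable_fun setT g -> (forall x, 0 <= g x) -> (0 < t)%R ->
  mu [set x | t%:E < hl_max g x] <= (doubling_const / t)%:E * \int[mu]_y g y.
Proof.
move=> mg g0 t0.
pose bad (i : nat * rat) := (0 < ratr i.2 :> R)%R /\
  (vol (ratr i.2) * t)%:E < \int[mu]_(y in rat_qball dist zs i) g y.
pose F n := if (unpickle n : option (nat * rat)) is Some i then
  if `[< bad i >] then rat_qball dist zs i else set0 else set0.
(* Integers that do not code a ball of large average contribute the empty set to [F]. *)
have mF n : measurable (F n).
  rewrite /F; case: unpickle => // i; case: ifP => // _; exact: mball.
rewrite [X in mu X](_ : _ = \bigcup_n F n); last first.
  apply/seteqP; split => x /=.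
    move=> /(max_op_gtP hR (k := fun _ => g) t mg g0)[i [i0 ix it]].
    by exists (pickle i) => //; rewrite /F pickleK; case: asboolP => // -[].
  move=> [n _]; rewrite /F; case: unpickle => // i; case: asboolP => // -[i0 it] ix.
  by apply/(max_op_gtP hR (k := fun _ => g) t mg g0); exists i.
apply: measure_bigcup_le => // n.
pose s : seq (T * R) := [seq (zs i.1, ratr i.2) | i <-
  pmap (fun k => if (unpickle k : option (nat * rat)) is Some i then
     if `[< bad i >] then Some i else None else None) (iota 0 n)].
apply: le_trans (measure_bad_balls mg g0 t0 (s := s) _).
  apply: le_measure; rewrite ?inE.
  - exact: bigsetU_measurable.
  - by apply: bigsetU_measurable => i _; exact: mball.
  - rewrite -bigcup_mkord -bigcup_seq => x [k /= kn]; rewrite /F.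
    case E: unpickle => [i|//]; case: asboolP => // bi ix.
    exists (zs i.1, ratr i.2) => //=; apply: (map_f (fun i : nat * rat => (zs i.1, ratr i.2 : R))).
    rewrite mem_pmap; apply/mapP; exists k; first by rewrite mem_iota.
    by rewrite E; case: asboolP.
move=> p /mapP[i]; rewrite mem_pmap => /mapP[k _].
by case: unpickle => // j; case: asboolP => // bj [->] ->.
Qed.

End vitali_covering.

(** * Dyadic layer cake *)

Section layer_cake.
Context d (T : measurableType d) (R : realType).
Context (mu : {measure set T -> \bar R}) (dist : T -> T -> R) (Q K c1 c2 : R).
Context (vol : R -> R) (zs : nat -> T).
Hypothesis hR : ahlfors_regular mu dist Q K c1 c2 vol zs.
Local Notation mball := (measurable_qball hR).
Local Open Scope ereal_scope.
Local Notation D := (doubling_const Q K c1 c2).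
Local Notation hlmax := (hl_max mu dist).

(** Values of [g] up to [t / 2] contribute at most [t / 2] to any average, so an average above [t]
    leaves more than [t / 2] to the larger values, to which the weak bound applies at level
    [t / 2]. *)
Lemma hl_max_weak_restricted (g : T -> R) (t : R) :
  measurable_fun setT g -> (forall x, 0 <= g x)%R -> (0 < t)%R ->
  mu [set x | t%:E < hlmax (EFin \o g) x] <=
  (2 * D / t)%:E * \int[mu]_(y in [set y | (t / 2 < g y)%R]) (g y)%:E.
Proof.
move=> mg g0 t0.
have t20 : (0 < t / 2)%R by rewrite divr_gt0.
pose A : set T := [set y | (t / 2 < g y)%R].
have mA : measurable A.
  rewrite (_ : A = g @^-1` [set` `](t / 2)%R, +oo[%R]); last first.
    by apply/seteqP; split => y /=; rewrite in_itv/= andbT.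
  by rewrite -[X in measurable X]setTI; exact: mg.
pose g1 := (EFin \o g) \_ A.
have mEg : measurable_fun setT (EFin \o g) by exact/measurable_EFinP.
have Eg0 y : 0 <= (EFin \o g) y by rewrite /= lee_fin.
have mg1 : measurable_fun setT g1.
  by apply: (measurable_restrictT _ _).1 => //; exact: measurable_funTS.
have g10 y : 0 <= g1 y by rewrite /g1 /patch; case: ifP.
rewrite (_ : (2 * D / t = D / (t / 2))%R); last by rewrite invf_div; ring.
have -> : \int[mu]_(y in A) (g y)%:E = \int[mu]_y g1 y by rewrite integral_mkcond.
apply: le_trans (hl_max_weak11 hR mg1 g10 t20).
have mlt h s : measurable_fun setT h -> (forall y, 0 <= h y) ->
    measurable [set x | s%:E < hlmax h x].
  move=> mh h0; rewrite (_ : [set x | _] = hlmax h @^-1` `]s%:E, +oo[%classic); last first.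
    by apply/seteqP; split => y /=; rewrite in_itv/= andbT.
  rewrite -[X in measurable X]setTI.
  by apply: (measurable_hl_max hR mh h0) => //; exact: emeasurable_itv.
apply: le_measure; rewrite ?inE; [exact: mlt|exact: mlt|].
move=> x /(max_op_gtP hR (k := fun _ => _) t mEg Eg0)[i [i0 ix it]].
apply/(max_op_gtP hR (k := fun _ => _) (t/2) mg1 g10); exists i; split => //.
have mB : measurable (rat_qball dist zs i) by exact: mball.
have v0 : (0 < vol (ratr i.2))%R by exact: (vol_gt0 hR).
have mB1 : measurable_fun (rat_qball dist zs i) g1 by exact: measurable_funTS.
have mBc : measurable_fun (rat_qball dist zs i) (cst (t / 2)%:E : T -> \bar R).
  exact: measurable_cst.
have le1 : \int[mu]_(y in rat_qball dist zs i) (EFin \o g) y <=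
    \int[mu]_(y in rat_qball dist zs i) g1 y + (t / 2 * vol (ratr i.2))%:E.
  rewrite EFinM -(qball_measure hR (zs i.1)) -[X in _ + X]integral_cst//.
  rewrite -ge0_integralD//; last by move=> y _; rewrite lee_fin ltW.
  apply: ge0_le_integral => //.
  - exact: measurable_funTS.
  - exact: emeasurable_funD.
  - move=> y _; rewrite /g1 /patch; case: ifPn => [_|].
      by rewrite leeDl// lee_fin ltW.
    by rewrite notin_setE/= => /negP; rewrite -leNgt add0e lee_fin.
have := lt_le_trans it le1.
rewrite (_ : (vol (ratr i.2) * t = vol (ratr i.2) * (t / 2) + t / 2 * vol (ratr i.2))%R); last by field.
by rewrite EFinD lteD2rE.
Qed.

Section geometric.
Local Open Scope ring_scope.

Definition geom_const (a : R) := (1 - 2 `^ (- a))^-1.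

Lemma geom_ratio_gt0 (a : R) : 0 < a -> 0 < 1 - 2 `^ (- a) :> R.
Proof.
move=> a0; rewrite subr_gt0 powRN invf_lt1 ?powR_gt0//.
have := @gt0_ltr_powR _ _ a0 1 2; rewrite powR1; apply => //.
- by rewrite nnegrE.
- by rewrite nnegrE.
- by rewrite ltr1n.
Qed.

Lemma geom_sum_le (a e : R) n : 0 < a -> 0 < e ->
  \sum_(k < n.+1) (e * 2 ^+ k) `^ a <= geom_const a * (e * 2 ^+ n) `^ a.
Proof.
move=> a0 e0.
have h := geom_ratio_gt0 a0.
have G0 : 0 < geom_const a by rewrite invr_gt0.
have G1 : geom_const a * 2 `^ (- a) = geom_const a - 1.
  rewrite /geom_const; field; exact: lt0r_neq0.
(* With the constant [geom_const a - 1] the induction closes exactly: multiplied by 2 to the power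
   [a], it becomes [geom_const a]. *)
suff H m : \sum_(k < m) (e * 2 ^+ k) `^ a <= (geom_const a - 1) * (e * 2 ^+ m) `^ a.
  by rewrite big_ord_recr/=; have := H n; lra.
elim: m => [|m IH].
  rewrite big_ord0 -G1 mulr_ge0 ?powR_ge0// mulr_ge0 ?powR_ge0//; exact: ltW.
rewrite big_ord_recr/= (le_trans (lerD IH (lexx _)))//.
have G2 : (geom_const a - 1) * 2 `^ a = geom_const a.
  by rewrite -G1 powRN divfK// powR_eq0 pnatr_eq0.
have em0 : 0 <= e * 2 ^+ m by rewrite mulr_ge0 ?exprn_ge0// ltW.
rewrite exprS mulrCA (powRM _ (ler0n _ 2) em0).
by rewrite mulrA G2; lra.
Qed.

(** The levels below [y] form an initial segment, and a geometric sum is dominated by its last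
    term. *)
Lemma geom_sum_lt_le (a e y : R) n : 0 < a -> 0 < e -> 0 <= y ->
  \sum_(k < n) (if e * 2 ^+ k < y then (e * 2 ^+ k) `^ a else 0)
  <= geom_const a * y `^ a.
Proof.
move=> a0 e0 y0.
have G0 : 0 < geom_const a by rewrite invr_gt0 geom_ratio_gt0.
elim: n => [|n IH]; first by rewrite big_ord0 mulr_ge0 ?powR_ge0// ltW.
have [ny|ny] := ltP (e * 2 ^+ n) y; last first.
  by rewrite big_ord_recr/= ltNge ny/= addr0.
apply: (@le_trans _ _ (\sum_(k < n.+1) (e * 2 ^+ k) `^ a)).
  by apply: ler_sum => k _; case: ifP => // _; exact: powR_ge0.
apply: (le_trans (geom_sum_le _ a0 e0)).
rewrite ler_pM2l// ge0_ler_powR ?nnegrE ?(ltW a0) ?(ltW ny)//.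
by rewrite mulr_ge0 ?exprn_ge0// ltW.
Qed.

End geometric.

(** One term is enough: for the largest [k <= n] with [e * 2 ^+ k] below [y], the truncated value is
    at most twice that level. *)
Lemma layer_sum_ge (p e : R) (y : \bar R) n : (0 < p)%R -> (0 < e)%R -> e%:E < y ->
  (mine y (e * 2 ^+ n.+1)%:E) `^ p <=
  \sum_(k < n.+1) (if (e * 2 ^+ k)%:E < y then ((2 * (e * 2 ^+ k)) `^ p)%:E else 0).
Proof.
move=> p0 e0 ey.
have y0 : 0 <= y by apply: ltW; apply: lt_trans ey; rewrite lte_fin.
have ge0 m : (0 <= e * 2 ^+ m)%R by rewrite mulr_ge0 ?exprn_ge0// ltW.
have mono u : 0 <= u -> forall v, u <= v -> u `^ p <= v `^ p.
  move=> u0 v uv; apply: gt0_ler_poweR => //; rewrite ?ltW ?in_itv//= ?leey ?andbT//.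
  exact: le_trans uv.
have min0 m : 0 <= mine y (e * 2 ^+ m)%:E by rewrite le_min y0 lee_fin ge0.
elim: n => [|n IH].
  rewrite big_ord1 expr0 mulr1 ey -poweR_EFin; apply: mono => //.
  by rewrite ge_min expr1 mulrC lexx orbT.
rewrite big_ord_recr/=; case: ifPn => [ny|].
  rewrite -[leLHS]add0e; apply: leeD.
    by apply: sume_ge0 => k _; case: ifP => // _; rewrite lee_fin powR_ge0.
  rewrite -poweR_EFin; apply: mono => //.
  by rewrite ge_min [in X in _ || X]exprS mulrCA lexx orbT.
rewrite -leNgt adde0 => yn; apply: le_trans IH; apply: mono => //.
by rewrite le_min ge_min lexx/= ge_min yn.
Qed.

(** Truncation from below by [e] and from above leaves finitely many dyadic levels, so the layer
    cake formula becomes a finite sum instead of an integral over the level. *)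
Lemma powR_layer_integral (h : T -> \bar R) (p e : R) n :
  measurable_fun setT h -> (0 < p)%R -> (0 < e)%R ->
  \int[mu]_(x in [set x | e%:E < h x]) (mine (h x) (e * 2 ^+ n.+1)%:E) `^ p
  <= \sum_(k < n.+1) ((2 * (e * 2 ^+ k)) `^ p)%:E * mu [set x | (e * 2 ^+ k)%:E < h x].
Proof.
move=> mh p0 e0.
have mlt s : measurable [set x | s%:E < h x].
  rewrite (_ : [set x | _] = h @^-1` `]s%:E, +oo[%classic); last first.
    by apply/seteqP; split => y /=; rewrite in_itv/= andbT.
  by rewrite -[X in measurable X]setTI; apply: mh => //; exact: emeasurable_itv.
have mmin : measurable_fun setT (fun x => (mine (h x) (e * 2 ^+ n.+1)%:E) `^ p).
  apply: (measurableT_comp (measurable_poweR p)).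
  by apply: measurable_mine => //; exact: measurable_cst.
pose A (k : nat) : set T := [set x | (e * 2 ^+ k)%:E < h x].
pose F (k : nat) (x : T) : \bar R := ((2 * (e * 2 ^+ k)) `^ p)%:E * (\1_(A k) x)%:E.
have mF k : measurable_fun setT (F k).
  apply: measurable_funeM; apply/measurable_EFinP; apply: measurable_indic; exact: mlt.
have F0 k x : 0 <= F k x by rewrite /F mule_ge0// lee_fin powR_ge0.
apply: (@le_trans _ _ (\int[mu]_x (\sum_(k < n.+1) F k x))).
  rewrite integral_mkcond; apply: ge0_le_integral => //.
  - by move=> x _; rewrite /patch; case: ifP => // _; exact: poweR_ge0.
  - by apply: (measurable_restrictT _ _).1 => //; exact: measurable_funTS.
  - by apply: emeasurable_sum => k; exact: mF.
  - move=> x _; rewrite /patch; case: ifPn => [|_]; last by apply: sume_ge0.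
    rewrite inE/= => ex; apply: (le_trans (layer_sum_ge n p0 e0 ex)).
    apply: lee_sum => k _; case: ifPn => // kx.
    by rewrite /F indicE mem_set// mule1.
rewrite ge0_integral_sum//; apply: lee_sum => k _.
rewrite /F ge0_integralZl_EFin ?powR_ge0//.
  rewrite integral_indic//; last exact: mlt.
  by rewrite setIT.
by apply/measurable_EFinP; apply: measurable_indic; exact: mlt.
Qed.

End layer_cake.

(** * Strong (p, p) bound of the maximal operator *)

Section strong_type.
Context d (T : measurableType d) (R : realType).
Context (mu : {measure set T -> \bar R}) (dist : T -> T -> R) (Q K c1 c2 : R).
Context (vol : R -> R) (zs : nat -> T).
Hypothesis hR : ahlfors_regular mu dist Q K c1 c2 vol zs.
Local Open Scope ereal_scope.
Local Notation D := (doubling_const Q K c1 c2).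
Local Notation hlmax := (hl_max mu dist).

(** The factors come, in this order, from the dyadic step, the restricted weak bound, the sum of the
    powers [p - 1] of the levels, and the threshold t/2 < g(x), which admits levels up to 2 g(x). *)
Definition strong_const (p : R) := (2 `^ p * (2 * D) * geom_const (p - 1) * 2 `^ (p - 1))%R.

Lemma strong_const_gt0 p : (1 < p)%R -> (0 < strong_const p)%R.
Proof.
move=> p1; have D0 := doubling_const_gt0 hR.
have G0 : (0 < geom_const (p - 1))%R.
  by rewrite invr_gt0 geom_ratio_gt0// subr_gt0.
have P0 a : (0 < 2 `^ a :> R)%R by exact: powR_gt0.
by rewrite /strong_const (mulr_gt0 (mulr_gt0 (mulr_gt0 _ (mulr_gt0 _ D0)) G0)).
Qed.

(** After exchanging sum and integral, the weight t^p of a level and the 1/t of the weak bound leave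
    t^(p-1), summed over the levels below 2 g(x); [1 < p] makes this sum geometric. The bound is
    independent of [e] and [n], which permits the passage to the limit. *)
Lemma hl_max_strong_truncated (g : T -> R) (p e : R) n :
  measurable_fun setT g -> (forall x, 0 <= g x)%R -> (1 < p)%R -> (0 < e)%R ->
  \int[mu]_(x in [set x | e%:E < hlmax (EFin \o g) x])
     (mine (hlmax (EFin \o g) x) (e * 2 ^+ n.+1)%:E) `^ p
  <= (strong_const p)%:E * \int[mu]_x (g x `^ p)%:E.
Proof.
move=> mg g0 p1 e0.
have p0 : (0 < p)%R by apply: lt_trans p1.
have pm0 : (0 < p - 1)%R by rewrite subr_gt0.
have D0 := doubling_const_gt0 hR.
have mEg : measurable_fun setT (EFin \o g) by exact/measurable_EFinP.
have Eg0 y : 0 <= (EFin \o g) y by rewrite /= lee_fin.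
apply: (le_trans (powR_layer_integral _ _ (measurable_hl_max hR mEg Eg0) p0 e0)).
pose t k := (e * 2 ^+ k)%R.
have t0 k : (0 < t k)%R by rewrite mulr_gt0 ?exprn_gt0.
pose a k := ((2 * t k) `^ p * (2 * D / t k))%R.
have a0 k : (0 <= a k)%R.
  by apply: mulr_ge0; [exact: powR_ge0|apply: divr_ge0; [apply: mulr_ge0 => //|]; exact: ltW].
pose A k : set T := [set y | (t k / 2 < g y)%R].
have mA k : measurable (A k).
  rewrite (_ : A k = g @^-1` [set` `](t k / 2)%R, +oo[%R]); last first.
    by apply/seteqP; split => y /=; rewrite in_itv/= andbT.
  by rewrite -[X in measurable X]setTI; exact: mg.
pose F k := (fun x => (a k)%:E * (g x)%:E) \_ (A k).
have F0 k x : 0 <= F k x by rewrite /F /patch; case: ifP => // _; rewrite mule_ge0 ?lee_fin.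
have mF k : measurable_fun setT (F k).
  apply: (measurable_restrictT _ _).1 => //; apply: measurable_funTS.
  exact: measurable_funeM.
apply: (@le_trans _ _ (\int[mu]_x (\sum_(k < n.+1) F k x))).
  rewrite ge0_integral_sum//; apply: lee_sum => k _.
  rewrite -integral_mkcond ge0_integralZl_EFin//; [|by move=> x _; rewrite lee_fin|exact: measurable_funTS].
  rewrite /a (EFinM ((2 * t k) `^ p)) -muleA; apply: lee_wpmul2l; first by rewrite lee_fin powR_ge0.
  exact: (hl_max_weak_restricted hR mg g0 (t0 k)).
rewrite -ge0_integralZl_EFin//; last 3 first.
- by move=> x _; rewrite lee_fin powR_ge0.
- apply/measurable_EFinP; exact: (measurableT_comp (measurable_powR p)).
- by apply/ltW/strong_const_gt0.
apply: ge0_le_integral => //.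
- by move=> x _; apply: sume_ge0.
- by apply: emeasurable_sum => k; exact: mF.
- apply: measurable_funeM; apply/measurable_EFinP.
  exact: (measurableT_comp (measurable_powR p)).
move=> x _.
have -> : \sum_(k < n.+1) F k x =
   (2 `^ p * (2 * D) * g x * \sum_(k < n.+1)
      (if t k < 2 * g x then t k `^ (p - 1) else 0))%:E.
  rewrite mulr_sumr -sumEFin; apply: eq_bigr => k _.
  have AE : (x \in A k) = (t k < 2 * g x)%R.
    by apply/idP/idP; rewrite inE /A/= ltr_pdivrMr// (mulrC (g x)).
  rewrite /F /patch AE.
  case: ifPn => tg; last by rewrite mulr0.
  have -> : (a k = 2 `^ p * (2 * D) * t k `^ (p - 1))%R.
    rewrite /a powRM ?(ltW (t0 k))// powRB; last by rewrite (gt_eqF (t0 k)) implybT.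
    by rewrite powRr1 ?(ltW (t0 k))//; ring.
  by rewrite -EFinM; congr EFin; ring.
rewrite -EFinM lee_fin; have g2 : (0 <= 2 * g x)%R by rewrite mulr_ge0.
have := geom_sum_lt_le n.+1 pm0 e0 g2.
rewrite powRM// -(mulr_powRB1 (g0 x) p0) => h.
have c0 : (0 <= 2 `^ p * (2 * D) * g x)%R.
  by apply: mulr_ge0 => //; apply: mulr_ge0; rewrite ?powR_ge0// mulr_ge0// ltW.
apply: (le_trans (ler_wpM2l c0 h)).
by rewrite /strong_const le_eqVlt; apply/orP; left; apply/eqP; ring.
Qed.

Lemma hl_max_strong (g : T -> R) (p : R) :
  measurable_fun setT g -> (forall x, 0 <= g x)%R -> (1 < p)%R ->
  \int[mu]_x (hlmax (EFin \o g) x `^ p)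
  <= (strong_const p)%:E * \int[mu]_x (g x `^ p)%:E.
Proof.
move=> mg g0 p1.
have p0 : (0 < p)%R by apply: lt_trans p1.
have mEg : measurable_fun setT (EFin \o g) by exact/measurable_EFinP.
have Eg0 y : 0 <= (EFin \o g) y by rewrite /= lee_fin.
set h := hlmax (EFin \o g).
have h0 x : 0 <= h x by exact: (hl_max_ge0 hR).
have mh : measurable_fun setT h by exact: (measurable_hl_max hR).
pose e n : R := (2 ^- n)%R.
have e0 n : (0 < e n)%R by rewrite invr_gt0 exprn_gt0.
pose S n : set T := [set x | (e n)%:E < h x].
have mS n : measurable (S n).
  rewrite (_ : S n = h @^-1` `](e n)%:E, +oo[%classic); last first.
    by apply/seteqP; split => y /=; rewrite in_itv/= andbT.
  by rewrite -[X in measurable X]setTI; apply: mh => //; exact: emeasurable_itv.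
(* The index [n + n] puts the upper truncation at [2 ^+ n.+1] while the lower one is at [2 ^- n], so
   both disappear in the limit. *)
pose u n x := mine (h x) (e n * 2 ^+ (n + n).+1)%:E.
have uE n : (e n * 2 ^+ (n + n).+1 = 2 ^+ n.+1)%R.
  by rewrite /e -addSn exprD mulrCA mulVf ?mulr1// expf_neq0.
have u0 n x : 0 <= u n x by rewrite le_min h0 lee_fin uE exprn_ge0.
pose f n := (fun x => u n x `^ p) \_ (S n).
have f0 n x : 0 <= f n x by rewrite /f /patch; case: ifP => // _; exact: poweR_ge0.
have mf n : measurable_fun setT (f n).
  apply: (measurable_restrictT _ _).1 => //; apply: measurable_funTS.
  apply: (measurableT_comp (measurable_poweR p)).
  by apply: measurable_mine => //; exact: measurable_cst.
have ndf x : {homo f^~ x : n m / (n <= m)%N >-> n <= m}.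
  move=> n m nm; rewrite /f /patch; case: ifPn => [|_]; last first.
    by case: ifPn => // _; exact: poweR_ge0.
  rewrite inE /S/= => nx; rewrite mem_set; last first.
    rewrite /S/=; apply: le_lt_trans nx.
    by rewrite lee_fin lef_pV2 ?posrE ?exprn_gt0// ler_eXn2l// ltr1n.
  apply: gt0_ler_poweR; rewrite ?in_itv/= ?u0 ?leey//; first exact: ltW.
  rewrite /u !uE le_min !ge_min lexx/= lee_fin; apply/orP; right.
  by rewrite ler_eXn2l// ltr1n.
have limE := monotone_convergence mu measurableT mf (fun n x _ => f0 n x) (fun x _ => ndf x).
have two_gt (r : R) : exists n, (r < 2 ^+ n)%R.
  exists (Num.truncn `|r|).+1; apply: le_lt_trans (ler_norm r) _.
  apply: (lt_le_trans (truncnS_gt _)).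
  by rewrite -natrX ler_nat ltnW// ltn_expl.
have fle n x : f n x <= h x `^ p.
  rewrite /f /patch; case: ifPn => _; last exact: poweR_ge0.
  by apply: gt0_ler_poweR; rewrite ?in_itv/= ?u0 ?h0 ?leey ?(ltW p0)// ge_min lexx.
have fE n x : (e n)%:E < h x -> f n x = (mine (h x) (2 ^+ n.+1)%:E) `^ p.
  by move=> nx; rewrite /f /patch mem_set// /u uE.
have limf x : limn (f^~ x) = h x `^ p.
  have -> : limn (f^~ x) = ereal_sup (range (f^~ x)).
    by apply/cvg_lim => //; apply: ereal_nondecreasing_cvgn; exact: ndf.
  apply/eqP; rewrite eq_le; apply/andP; split.
    by apply: ge_ereal_sup => _ [n _ <-]; exact: fle.
  have [x0|hx0] := eqVneq (h x) 0.
    rewrite x0 poweR0r ?gt_eqF//; apply: (@le_trans _ _ (f 0%N x)) => //.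
    by apply: ereal_sup_ubound; exists 0%N.
  have {hx0}hx0 : 0 < h x by rewrite lt0e hx0 h0.
  case E : (h x) hx0 => [r| |]// hx0.
    (* A power of 2 above [r + r^-1] puts [r] between the two truncations. *)
    have [n nr] := two_gt (r + r^-1)%R.
    have r0 : (0 < r)%R by rewrite lte_fin in hx0.
    have ri0 : (0 < r^-1)%R by rewrite invr_gt0.
    have en : (e n < r)%R.
      by rewrite /e invf_plt ?posrE ?exprn_gt0//; lra.
    apply: (@le_trans _ _ (f n x)); last by apply: ereal_sup_ubound; exists n.
    rewrite fE E ?lte_fin// /mine.
    by rewrite ifT// lte_fin exprS; have : (0 < 2 ^+ n :> R)%R by []; lra.
  rewrite poweRyr ?gt_eqF// leye_eq; apply/eqP/eq_infty => A.
  have [n nA] := two_gt `|A|%R.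
  apply: (@le_trans _ _ (f n x)); last by apply: ereal_sup_ubound; exists n.
  rewrite fE E ?ltry// /mine ltNge leey/= lee_fin.
  have n1 : (1 <= 2 ^+ n.+1 :> R)%R by rewrite exprn_ege1// ler1n.
  apply: le_trans (le1r_powR n1 (ltW p1)); rewrite exprS.
  by have := ler_norm A; have := normr_ge0 A; lra.
under eq_integral do rewrite -limf.
rewrite limE; apply: lime_le.
  apply: ereal_nondecreasing_is_cvgn => n m nm.
  by apply: ge0_le_integral => // x _; exact: ndf.
apply: nearW => n; rewrite -integral_mkcond.
exact: hl_max_strong_truncated.
Qed.

End strong_type.

(** * The maximal commutator *)

Section hedberg.
Context d (T : measurableType d) (R : realType).
Context (mu : {measure set T -> \bar R}) (dist : T -> T -> R) (Q K c1 c2 : R).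
Context (vol : R -> R) (zs : nat -> T).
Hypothesis hR : ahlfors_regular mu dist Q K c1 c2 vol zs.
Local Notation ball := (qball dist).
Local Notation mball := (measurable_qball hR).
Local Open Scope ereal_scope.
Local Notation hlmax := (hl_max mu dist).

Lemma Lnorm_indic (A : set T) (p : R) : measurable A -> (0 < p)%R ->
  'N[mu]_p%:E[EFin \o \1_A] = mu A `^ p^-1.
Proof.
move=> mA p0; rewrite unlock; congr (_ `^ _).
rewrite -[RHS](_ : \int[mu]_x (\1_A x)%:E = _); last by rewrite integral_indic// setIT.
apply: eq_integral => x _; rewrite /= indicE.
by case: (x \in A); rewrite ?normr1 ?normr0 ?powR1// powR0// gt_eqF.
Qed.

(** Hoelder's inequality against the indicator of [A]; at [p = 1] the conjugate exponent is
    infinite, and monotonicity of the integral replaces it. *)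
Lemma integral_le_Lnorm (A : set T) (f : T -> R) (p : R) : measurable A ->
  measurable_fun setT f -> (1 <= p)%R ->
  \int[mu]_(x in A) `|(f x)%:E| <= 'N[mu]_p%:E[EFin \o f] * mu A `^ (1 - p^-1).
Proof.
move=> mA mf; rewrite le_eqVlt => /predU1P[<-|p1].
  rewrite invr1 subrr poweRe0 mule1 Lnorm1; apply: ge0_subset_integral => //.
  exact/measurableT_comp/measurable_EFinP.
have p0 : (0 < p)%R by apply: lt_trans p1.
have q0 : (0 < 1 - p^-1)%R by rewrite subr_gt0 invf_lt1.
have := hoelder mu mf (measurable_indic mA) p0 (_ : (0 < (1 - p^-1)^-1)%R) _.
rewrite invr_gt0 invrK q0 subrKC => /(_ isT erefl).
rewrite Lnorm_indic ?invr_gt0// invrK; apply: le_trans.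
rewrite Lnorm1 integral_mkcond le_eqVlt; apply/orP; left; apply/eqP.
apply: eq_integral => x _; rewrite /patch /= indicE.
by case: (x \in A); rewrite ?mulr1 ?mulr0 ?normr0.
Qed.

Lemma qball_avg_le_hl_max (g : T -> \bar R) z r x : (0 < r)%R -> ball z r x ->
  (mu (ball z r))^-1 * \int[mu]_(y in ball z r) g y <= hlmax g x.
Proof.
move=> r0 zx; apply: ereal_sup_ubound; exists (ball z r) => //.
by split => //; exists z, r.
Qed.

(** Here [A] stands for the average of |f| over a ball of radius [r], [N] for the L^p norm, and the
    last hypothesis is Hoelder's inequality. It is applied only to the factor A^(1 - p/q) of [A]:
    since 1 - p/q = p beta/Q, it yields vol(r)^(-beta/Q), which absorbs r^beta. Each ball is treated
    by itself and no radius is optimized. *)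
Lemma hedberg_real (beta p q r A N : R) : (0 < beta)%R -> (1 <= p)%R ->
  (0 < q)%R -> (q^-1 = p^-1 - beta / Q)%R -> (0 < r)%R -> (0 <= A)%R -> (0 <= N)%R ->
  (A <= vol r `^ (- p^-1) * N)%R ->
  (r `^ beta * A <= c1 `^ (- (beta / Q)) * N `^ (1 - p / q) * A `^ (p / q))%R.
Proof.
move=> beta0 p1 q0 pq r0 A0 N0 AN.
have p0 : (0 < p)%R by apply: lt_le_trans p1.
have Q0 := hdim_gt0 hR; have cc1 := vol_const_gt0 hR.
have v0 : (0 < vol r)%R by exact: (vol_gt0 hR).
have [->|An0] := eqVneq A 0%R.
  by rewrite mulr0 !mulr_ge0 ?powR_ge0.
have Ap : (0 < A)%R by rewrite lt_def An0.
have e0 : (1 - p / q = p * (beta / Q))%R by rewrite pq; field; rewrite !gt_eqF.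
have e1 : (0 < 1 - p / q)%R by rewrite e0 mulr_gt0// divr_gt0.
have h1 : (A `^ (1 - p / q) <= (vol r `^ (- p^-1) * N) `^ (1 - p / q))%R.
  by apply: ge0_ler_powR; rewrite ?nnegrE ?mulr_ge0 ?powR_ge0// ltW.
rewrite powRM ?powR_ge0// -powRrM in h1.
have e2 : (- p^-1 * (1 - p / q) = - (beta / Q))%R by rewrite e0; field; rewrite !gt_eqF.
rewrite e2 in h1.
have h2 : (r `^ beta * vol r `^ (- (beta / Q)) <= c1 `^ (- (beta / Q)))%R.
  rewrite !powRN ler_pdivrMr ?powR_gt0// mulrC ler_pdivlMr ?powR_gt0//.
  have -> : (r `^ beta = (r `^ Q) `^ (beta / Q))%R.
    by rewrite -powRrM; congr powR; field; rewrite gt_eqF.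
  rewrite -powRM ?powR_ge0 ?(ltW cc1)//.
  have bQ : (0 <= beta / Q)%R by rewrite divr_ge0// ltW.
  apply: ge0_ler_powR; rewrite ?bQ ?nnegrE ?(ltW v0)//.
    by rewrite mulr_ge0 ?powR_ge0// ltW.
  by rewrite mulrC; exact: (vol_lb hR).
have -> : (r `^ beta * A = A `^ (p / q) * (r `^ beta * A `^ (1 - p / q)))%R.
  rewrite mulrCA -powRD ?subrKC ?powRr1//; last by rewrite oner_eq0.
rewrite [leRHS]mulrC; apply: ler_wpM2l; first exact: powR_ge0.
apply: (@le_trans _ _ (r `^ beta * (vol r `^ (- (beta / Q)) * N `^ (1 - p / q)))%R).
  by apply: ler_wpM2l => //; exact: powR_ge0.
by rewrite mulrA; apply: ler_wpM2r => //; exact: powR_ge0.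
Qed.
End hedberg.

(** * Bounds of the commutator with a Lipschitz symbol *)

Section commutator_bounds.
Context d (T : measurableType d) (R : realType).
Context (mu : {measure set T -> \bar R}) (dist : T -> T -> R) (Q K c1 c2 : R).
Context (vol : R -> R) (zs : nat -> T).
Hypothesis hR : ahlfors_regular mu dist Q K c1 c2 vol zs.
Local Notation ball := (qball dist).
Local Notation mball := (measurable_qball hR).
Local Open Scope ereal_scope.
Local Notation D := (doubling_const Q K c1 c2).
Local Notation hlmax := (hl_max mu dist).
Variables (b : T -> R) (mb : measurable_fun setT b).

Definition comm_op (f : T -> R) : T -> \bar R :=
  max_op mu dist (fun x y => (`|b x - b y| * `|f y|)%:E).

Lemma measurable_comm_kernel (f : T -> R) : measurable_fun setT f ->
  measurable_fun setT (fun xy : T * T => (`|b xy.1 - b xy.2| * `|f xy.2|)%:E).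
Proof.
move=> mf; apply/measurable_EFinP; apply: measurable_funM.
  apply/measurableT_comp => //; apply: measurable_funB.
    exact: (@measurableT_comp _ _ _ _ _ _ _ _ fst mb).
  exact: (@measurableT_comp _ _ _ _ _ _ _ _ snd mb).
apply/measurableT_comp => //.
exact: (@measurableT_comp _ _ _ _ _ _ _ _ snd mf).
Qed.

Lemma measurable_comm_op (f : T -> R) : measurable_fun setT f ->
  measurable_fun setT (comm_op f).
Proof.
move=> mf; apply: (measurable_max_op hR); first exact: measurable_comm_kernel.
by move=> x y; rewrite lee_fin mulr_ge0.
Qed.

Lemma comm_op_ge0 f x : 0 <= comm_op f x.
Proof.
apply: (@le_trans _ _ ((mu (ball x 1))^-1 *
    \int[mu]_(y in ball x 1) (`|b x - b y| * `|f y|)%:E)).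
  apply: mule_ge0; first by rewrite inve_ge0.
  by apply: integral_ge0 => y _; rewrite lee_fin mulr_ge0.
apply: ereal_sup_ubound; exists (ball x 1) => //; split; first by exists x, 1%R.
exact: (qball_center hR).
Qed.

Lemma measurable_comm_slice (f : T -> R) x : measurable_fun setT f ->
  measurable_fun setT (fun y => (`|b x - b y| * `|f y|)%:E).
Proof.
move=> mf; apply/measurable_EFinP; apply: measurable_funM; last exact: measurableT_comp.
by apply/measurableT_comp => //; apply: measurable_funB.
Qed.

Section lipschitz_symbol.
Variables (beta C : R) (b' : T -> R).
Hypotheses (beta0 : (0 < beta)%R) (C0 : (0 < C)%R).
Hypothesis bb' : {ae mu, forall x, b x = b' x}.
Hypothesis b'lip : forall x y, (`|b' x - b' y| <= C * dist x y `^ beta)%R.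

(** Two points of a ball are at distance at most [K * 2] times its radius; the power of [c1] comes
    from the lower volume bound in [hedberg_real]. *)
Definition comm_const := (C * (K * 2) `^ beta * c1 `^ (- (beta / Q)))%R.

Lemma comm_const_gt0 : (0 < comm_const)%R.
Proof.
have K1 := quasi_const_ge1 hR.
have h1 : (0 < (K * 2) `^ beta)%R by rewrite powR_gt0 ?mulr_gt0//; lra.
have h2 : (0 < c1 `^ (- (beta / Q)))%R by rewrite powR_gt0 ?(vol_const_gt0 hR).
by rewrite /comm_const !mulr_gt0.
Qed.

(** The inequality holds at the points [x] where [b] agrees with [b']; inside the integral the
    points of disagreement are negligible. The case [p = 1] is included for the weak-type bound. *)
Lemma comm_op_le_hl_max (p q N : R) (f : T -> R) :
  measurable_fun setT f -> (1 <= p)%R -> (0 < q)%R ->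
  (q^-1 = p^-1 - beta / Q)%R -> 'N[mu]_p%:E[EFin \o f] = N%:E ->
  {ae mu, forall x, comm_op f x <= (comm_const * N `^ (1 - p / q))%:E *
      hlmax (fun y => `|f y|%:E) x `^ (p / q)}.
Proof.
move=> mf p1 q0 pq fN.
have N0 : (0 <= N)%R by rewrite -lee_fin -fN Lnorm_ge0.
have p0 : (0 < p)%R by apply: lt_le_trans p1.
have K1 := quasi_const_ge1 hR.
have mabs : measurable_fun setT (fun y => `|f y|%:E).
  by apply/measurable_EFinP; exact: measurableT_comp.
apply: filterS (bb') => x bx.
apply: ge_ereal_sup => _ [_ [[z [r [r0 ->]]] zx] <-].
have v0 : (0 < vol r)%R by exact: (vol_gt0 hR).
set I := \int[mu]_(y in ball z r) `|f y|%:E.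
have I0 : 0 <= I by apply: integral_ge0 => y _; rewrite lee_fin.
have Ile : I <= (N * vol r `^ (1 - p^-1))%:E.
  rewrite EFinM -poweR_EFin -(qball_measure hR z) -fN.
  exact: (integral_le_Lnorm _ (mball _ _) mf p1).
have Ifin : I \is a fin_num by rewrite ge0_fin_numE// (le_lt_trans Ile) ?ltry.
pose A := ((vol r)^-1 * fine I)%R.
have AE : A%:E = (mu (ball z r))^-1 * I.
  by rewrite (inve_qball hR)// /A EFinM fineK.
have A0 : (0 <= A)%R by rewrite mulr_ge0 ?fine_ge0// invr_ge0 ltW.
have AN : (A <= vol r `^ (- p^-1) * N)%R.
  rewrite /A ler_pdivrMl// -lee_fin fineK// (le_trans Ile)// lee_fin.
  rewrite powRD; last by rewrite (gt_eqF v0) implybT.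
  by rewrite powRr1 ?(ltW v0)// mulrCA (mulrC N).
have hed := hedberg_real hR beta0 p1 q0 pq r0 A0 N0 AN.
apply: (@le_trans _ _ ((C * (K * 2 * r) `^ beta)%:E * A%:E)).
  rewrite AE (inve_qball hR)// muleCA; apply: lee_wpmul2l.
    by rewrite lee_fin invr_ge0 ltW.
  rewrite -ge0_integralZl_EFin//; [|exact: mball|exact: measurable_funTS
    |by rewrite mulr_ge0 ?powR_ge0// ltW].
  apply: ae_ge0_le_integral => //.
  - exact: mball.
  - by apply: measurable_funTS; exact: measurable_comm_slice.
  - by move=> y _; rewrite mule_ge0// lee_fin mulr_ge0 ?powR_ge0// ltW.
  - by apply: measurable_funeM; exact: measurable_funTS.
  - apply: filterS (bb') => y by_ zy; rewrite -EFinM lee_fin ler_wpM2r//.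
    rewrite bx by_; apply: (le_trans (b'lip x y)).
    apply: ler_wpM2l; first exact: ltW.
    apply: ge0_ler_powR; rewrite ?nnegrE ?(quasi_dist_ge0 hR) ?(ltW beta0)//.
      by rewrite mulr_ge0 ?(ltW r0)// mulr_ge0//; lra.
    apply: (le_trans (quasi_dist_triangle hR x z y)).
    rewrite -mulrA; apply: ler_wpM2l; first by lra.
    rewrite (quasi_dist_sym hR z y); rewrite /qball/= in zx zy.
    by lra.
rewrite -EFinM powRM ?(ltW r0) ?mulr_ge0//; last 1 first.
  by lra.
have -> : (C * ((K * 2) `^ beta * r `^ beta) * A = C * (K * 2) `^ beta * (r `^ beta * A))%R by ring.
apply: (@le_trans _ _ ((comm_const * N `^ (1 - p / q))%:E * A%:E `^ (p / q))).
  rewrite poweR_EFin -EFinM lee_fin /comm_const -!mulrA.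
  apply: ler_wpM2l; first exact: ltW.
  by apply: ler_wpM2l; [exact: powR_ge0|rewrite mulrA].
apply: lee_wpmul2l.
  by rewrite lee_fin mulr_ge0 ?powR_ge0// ltW// comm_const_gt0.
have pq0 : (0 <= p / q)%R by rewrite divr_ge0// ltW.
have AM : A%:E <= hlmax (fun y => `|f y|%:E) x.
  by rewrite AE; exact: qball_avg_le_hl_max.
apply: gt0_ler_poweR => //; rewrite in_itv/= leey andbT ?lee_fin//.
by apply: le_trans AM; rewrite lee_fin.
Qed.

(** Raised to the power [q], the pointwise bound is a multiple of the [p]-th power of the maximal
    function, whose integral is controlled. The exponents of the norm of [f] add up to (1 - p/q) +
    p/q = 1. *)
Lemma comm_op_Lp_Lq (p q : R) : (1 < p)%R -> (0 < q)%R ->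
  (q^-1 = p^-1 - beta / Q)%R ->
  exists2 C', (0 < C')%R & forall f : T -> R, measurable_fun setT f ->
    'N[mu]_p%:E[EFin \o f] < +oo ->
    'N[mu]_q%:E[comm_op f] <= C'%:E * 'N[mu]_p%:E[EFin \o f].
Proof.
move=> p1 q0 pq.
have p0 : (0 < p)%R by apply: lt_trans p1.
have S0 := strong_const_gt0 hR p1.
have cc0 := comm_const_gt0.
exists (comm_const * strong_const Q K c1 c2 p `^ q^-1)%R.
  by rewrite mulr_gt0// powR_gt0.
move=> f mf fy.
have fN : 'N[mu]_p%:E[EFin \o f] \is a fin_num by rewrite ge0_fin_numE ?Lnorm_ge0.
set N := fine ('N[mu]_p%:E[EFin \o f]).
have NE : 'N[mu]_p%:E[EFin \o f] = N%:E by rewrite fineK.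
have N0 : (0 <= N)%R by rewrite fine_ge0 ?Lnorm_ge0.
set g := fun y => `|f y|%R.
have mg : measurable_fun setT g by exact: measurableT_comp.
have mEg : measurable_fun setT (EFin \o g) by exact/measurable_EFinP.
have g0 y : (0 <= g y)%R by rewrite /g.
have Eg0 y : 0 <= (EFin \o g) y by rewrite /= lee_fin.
have h0 x : 0 <= hlmax (EFin \o g) x by exact: (hl_max_ge0 hR).
have mh := measurable_hl_max hR mEg Eg0.
set c := (comm_const * N `^ (1 - p / q))%R.
have c0 : (0 <= c)%R by rewrite mulr_ge0 ?powR_ge0 ?ltW.
have ints : \int[mu]_x (`|comm_op f x| `^ q) <=
    (c `^ q * (strong_const Q K c1 c2 p * N `^ p))%:E.
  apply: (@le_trans _ _ (\int[mu]_x ((c `^ q)%:E * hlmax (EFin \o g) x `^ p))).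
    apply: ae_ge0_le_integral => //.
    - by move=> x _; exact: poweR_ge0.
    - apply: (measurableT_comp (measurable_poweR q)); apply: measurableT_comp => //.
      exact: measurable_comm_op.
    - by move=> x _; rewrite mule_ge0 ?poweR_ge0 ?lee_fin ?powR_ge0.
    - by apply: measurable_funeM; exact: (measurableT_comp (measurable_poweR p)).
    apply: filterS (comm_op_le_hl_max mf (ltW p1) q0 pq NE) => x hx _.
    rewrite gee0_abs ?comm_op_ge0//.
    have -> : (c `^ q)%:E * hlmax (EFin \o g) x `^ p =
        (c%:E * hlmax (EFin \o g) x `^ (p / q)) `^ q.
      rewrite poweRM ?poweR_ge0 ?lee_fin// poweR_EFin -poweRrM.
      by rewrite divfK// gt_eqF.
    apply: gt0_ler_poweR => //; rewrite ?in_itv/= ?leey ?comm_op_ge0 ?(ltW q0)//.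
    by rewrite mule_ge0 ?poweR_ge0 ?lee_fin.
  rewrite ge0_integralZl_EFin ?powR_ge0//; [|by move=> x _; exact: poweR_ge0
    |exact: (measurableT_comp (measurable_poweR p))].
  rewrite EFinM; apply: lee_wpmul2l; first by rewrite lee_fin powR_ge0.
  apply: (le_trans (hl_max_strong hR mg g0 p1)).
  rewrite (EFinM (strong_const _ _ _ _ p)); apply: lee_wpmul2l; first by rewrite lee_fin ltW.
  by rewrite -poweR_EFin -NE powR_Lnorm// gt_eqF.
rewrite NE; apply: (@le_trans _ _ ((\int[mu]_x (`|comm_op f x| `^ q)) `^ q^-1)); first by rewrite unlock.
have q10 : (0 <= q^-1)%R by rewrite invr_ge0 ltW.
apply: (@le_trans _ _ ((c `^ q * (strong_const Q K c1 c2 p * N `^ p))%:E `^ q^-1)).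
  apply: gt0_ler_poweR => //; rewrite ?in_itv/= ?leey ?andbT//.
    by apply: integral_ge0 => x _; exact: poweR_ge0.
  by rewrite lee_fin; apply: mulr_ge0; rewrite ?powR_ge0//; apply: mulr_ge0; rewrite ?powR_ge0// ltW.
rewrite poweR_EFin -EFinM lee_fin.
rewrite (powRM _ (powR_ge0 _ _) (mulr_ge0 (ltW S0) (powR_ge0 _ _))).
rewrite (powRM _ (ltW S0) (powR_ge0 _ _)) -!powRrM divff ?gt_eqF// powRr1//.
set s := (strong_const _ _ _ _ _ `^ _)%R; rewrite /c.
have -> : (comm_const * N `^ (1 - p / q) * (s * N `^ (p / q)) =
  comm_const * s * (N `^ (1 - p / q) * N `^ (p / q)))%R by ring.
by rewrite -powRD ?subrK ?powRr1// oner_eq0.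
Qed.

Lemma comm_op_weak_type : (beta < Q)%R ->
  exists2 C', (0 < C')%R & forall (l : R) (f : T -> R), (0 < l)%R ->
    measurable_fun setT f -> 'N[mu]_1[EFin \o f] < +oo ->
    mu [set x | comm_op f x > l%:E] <=
      C'%:E * ((l^-1)%:E * 'N[mu]_1[EFin \o f]) `^ (Q / (Q - beta)).
Proof.
move=> bQ.
have Q0 := hdim_gt0 hR.
have Qb : (0 < Q - beta)%R by rewrite subr_gt0.
set q := (Q / (Q - beta))%R.
have q0 : (0 < q)%R by rewrite divr_gt0.
have pq : (q^-1 = 1^-1 - beta / Q)%R by rewrite /q; field; rewrite !gt_eqF.
have cc0 := comm_const_gt0.
have D0 := doubling_const_gt0 hR.
exists (D * comm_const `^ q)%R; first by rewrite mulr_gt0// powR_gt0.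
move=> l f l0 mf fy.
have fN : 'N[mu]_1[EFin \o f] \is a fin_num by rewrite ge0_fin_numE ?Lnorm_ge0.
set N := fine ('N[mu]_1[EFin \o f]).
have NE : 'N[mu]_1[EFin \o f] = N%:E by rewrite fineK.
have N0 : (0 <= N)%R by rewrite fine_ge0 ?Lnorm_ge0.
set g := fun y => `|f y|%:E.
have mg : measurable_fun setT g by apply/measurable_EFinP; exact: measurableT_comp.
have g0 y : 0 <= g y by rewrite /g lee_fin.
set c := (comm_const * N `^ (1 - 1 / q))%R.
have c0 : (0 <= c)%R by rewrite mulr_ge0 ?powR_ge0 ?ltW.
have [Z [mZ Z0 ZP]] := comm_op_le_hl_max mf (lexx 1%R) q0 pq NE.
have mlt (h : T -> \bar R) s : measurable_fun setT h -> measurable [set x | s%:E < h x].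
  move=> mh; rewrite (_ : [set x | _] = h @^-1` `]s%:E, +oo[%classic); last first.
    by apply/seteqP; split => y /=; rewrite in_itv/= andbT.
  by rewrite -[X in measurable X]setTI; apply: mh => //; exact: emeasurable_itv.
have mE : measurable [set x | l%:E < comm_op f x] by apply/mlt/measurable_comm_op.
rewrite NE -(EFinM l^-1) poweR_EFin -EFinM.
have rhs0 : (0 <= D * comm_const `^ q * (l^-1 * N) `^ q)%R.
  by apply: mulr_ge0; rewrite ?powR_ge0//; apply: mulr_ge0; rewrite ?powR_ge0// ltW.
(* If [c = 0], the pointwise bound makes the commutator vanish off the null set [Z]. *)
move: c0; rewrite le_eqVlt => /predU1P[c0|c0].
  rewrite (@subset_measure0 _ _ _ mu _ Z)// => x lx; apply: ZP => /= xle.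
  by move: lx; rewrite /= ltNge; apply/negP; rewrite negbK (le_trans xle)// -/c -c0 mul0e lee_fin ltW.
(* Chosen so that c t^(1/q) = l: outside [Z], a commutator above [l] forces the maximal function
   above [t]. *)
pose t := ((l / c) `^ q)%R.
have t0 : (0 < t)%R by rewrite powR_gt0// divr_gt0.
have mH : measurable [set x | t%:E < hlmax g x] by apply/mlt/(measurable_hl_max hR).
apply: (@le_trans _ _ (mu (Z `|` [set x | t%:E < hlmax g x]))).
  apply: le_measure; rewrite ?inE//; first exact: measurableU.
  move=> x /= lx; have [xZ|xZ] := pselect (Z x); [by left|right].
  have xle : comm_op f x <= c%:E * hlmax g x `^ (1 / q).
    by apply: contrapT => h; apply: xZ; exact: ZP.
  rewrite ltNge; apply/negP => hle.
  have : l%:E < c%:E * t%:E `^ (1 / q).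
    apply: (lt_le_trans lx); apply: (le_trans xle); apply: lee_wpmul2l.
      by rewrite lee_fin ltW.
    apply: gt0_ler_poweR => //; rewrite ?in_itv/= ?leey ?andbT ?lee_fin ?(ltW t0)//.
      by rewrite divr_ge0// ltW.
    exact: (hl_max_ge0 hR).
  rewrite poweR_EFin -EFinM lte_fin /t -powRrM div1r divff ?gt_eqF//.
  by rewrite powRr1 ?divr_ge0 ?(ltW l0) ?(ltW c0)// mulrC divfK ?ltxx// gt_eqF.
apply: (le_trans (measureU2 _ _ _)) => //.
rewrite [X in X + _](_ : _ = 0)// add0e.
apply: (le_trans (hl_max_weak11 hR mg g0 t0)).
have -> : \int[mu]_y g y = N%:E by rewrite -NE Lnorm1.
rewrite -EFinM lee_fin.
have eq0 : (1 - 1 / q = beta / Q)%R by rewrite div1r pq invr1; ring.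
have Np : (0 < N)%R.
  rewrite lt_def N0 andbT; apply/eqP => N00; move: c0.
  by rewrite /c N00 eq0 powR0 ?mulr0 ?ltxx// gt_eqF// divr_gt0.
rewrite /t -(mulrA D) -(mulrA D); apply: ler_wpM2l; first exact: ltW.
rewrite -powRN.
have eq1 : ((1 - 1 / q) * q = q - 1)%R by field; rewrite gt_eqF.
have li0 : (0 <= l^-1)%R by rewrite invr_ge0 ltW.
have -> : ((l / c) `^ (- q) = (l^-1 * c) `^ q)%R.
  rewrite (_ : (l^-1 * c = (l / c)^-1)%R); last by rewrite invf_div mulrC.
  rewrite -[in RHS]powR_inv1; last by apply: divr_ge0; exact: ltW.
  by rewrite -powRrM mulN1r.
have -> : (l^-1 * c = comm_const * (l^-1 * N `^ (1 - 1 / q)))%R by rewrite /c; ring.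
rewrite (powRM _ (ltW cc0) (mulr_ge0 li0 (powR_ge0 _ _))) (powRM _ li0 (powR_ge0 _ _)).
rewrite (powRM _ li0 N0) -powRrM eq1 powRB; last by rewrite (gt_eqF Np) implybT.
rewrite powRr1// le_eqVlt; apply/orP; left; apply/eqP; field.
by rewrite gt_eqF.
Qed.
End lipschitz_symbol.
End commutator_bounds.

(** * Mean oscillation and Lipschitz functions *)

Section oscillation.
Context d (T : measurableType d) (R : realType).
Context (mu : {measure set T -> \bar R}) (dist : T -> T -> R) (Q K c1 c2 : R).
Context (vol : R -> R) (zs : nat -> T).
Hypothesis hR : ahlfors_regular mu dist Q K c1 c2 vol zs.
Local Notation ball := (qball dist).
Local Notation mball := (measurable_qball hR).
Local Open Scope ereal_scope.
Variables (b : T -> R) (mb : measurable_fun setT b).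

Lemma osc_of_comm_op z r l : (0 < r)%R ->
  ~ (forall x, ball z r x -> l%:E < comm_op mu dist b \1_(ball z r) x) ->
  exists c : R, \int[mu]_(y in ball z r) `|b y - c|%:E <= (l * vol r)%:E.
Proof.
move=> r0 /existsNP[x /not_implyP[zx /negP]]; rewrite -leNgt => Mx.
exists (b x).
have : (mu (ball z r))^-1 * \int[mu]_(y in ball z r) (`|b x - b y| * `|\1_(ball z r) y|)%:E
    <= l%:E.
  apply: le_trans Mx; apply: ereal_sup_ubound; exists (ball z r) => //.
  by split => //; exists z, r.
rewrite (inve_qball hR)// lee_pdivrMl ?(vol_gt0 hR)// -EFinM mulrC.
apply: le_trans; rewrite le_eqVlt; apply/orP; left; apply/eqP.
apply: eq_integral => y zy; rewrite indicE zy normr1 mulr1 distrC//.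
Qed.

Lemma osc_of_Lp_Lq (beta p q C : R) : (0 < beta)%R -> (1 < p)%R -> (0 < q)%R ->
  (q^-1 = p^-1 - beta / Q)%R -> (0 < C)%R ->
  (forall f : T -> R, measurable_fun setT f -> 'N[mu]_p%:E[EFin \o f] < +oo ->
    'N[mu]_q%:E[comm_op mu dist b f] <= C%:E * 'N[mu]_p%:E[EFin \o f]) ->
  forall z r, (0 < r)%R ->
  exists c : R, \int[mu]_(y in ball z r) `|b y - c|%:E <=
    (2 * C * vol r `^ (beta / Q) * vol r)%:E.
Proof.
move=> beta0 p1 q0 pq C0 H z r r0; apply: osc_of_comm_op => // Hl.
set l := (2 * C * _)%R in Hl.
have p0 : (0 < p)%R by apply: lt_trans p1.
have v0 := vol_gt0 hR r0.
have mB := mball z r.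
have l0 : (0 < l)%R by rewrite /l !mulr_gt0// powR_gt0.
have := H \1_(ball z r) (measurable_indic mB).
rewrite Lnorm_indic// (qball_measure hR) poweR_EFin ltry => /(_ isT).
apply/negP; rewrite -ltNge.
(* The factor 2 in [l] gives strictness: by the relation between [p] and [q], this quantity is twice
   the assumed upper bound C vol(r)^(1/p). *)
apply: (@lt_le_trans _ _ (l * vol r `^ q^-1)%:E).
  rewrite -EFinM lte_fin pq powRB; last by rewrite (gt_eqF v0) implybT.
  have -> : (l * (vol r `^ p^-1 / vol r `^ (beta / Q)) = 2 * (C * vol r `^ p^-1))%R.
    by rewrite /l; field; rewrite gt_eqF ?powR_gt0.
  have : (0 < C * vol r `^ p^-1)%R by rewrite mulr_gt0// powR_gt0.
  lra.
apply: (@le_trans _ _ ((\int[mu]_x (`|comm_op mu dist b \1_(ball z r) x| `^ q)) `^ q^-1)); last by rewrite unlock.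
have -> : (l * vol r `^ q^-1)%:E = ((l `^ q)%:E * mu (ball z r)) `^ q^-1.
  rewrite (qball_measure hR) -EFinM poweR_EFin powRM ?powR_ge0 ?(ltW v0)//.
  by rewrite -powRrM divff ?gt_eqF// powRr1// ltW.
apply: gt0_ler_poweR; rewrite ?in_itv/= ?leey ?andbT ?invr_ge0 ?(ltW q0)//.
- by rewrite mule_ge0// lee_fin powR_ge0.
- by apply: integral_ge0 => x _; exact: poweR_ge0.
have mM : measurable_fun setT (fun x => `|comm_op mu dist b \1_(ball z r) x| `^ q).
  apply: (measurableT_comp (measurable_poweR q)); apply: measurableT_comp => //.
  exact: (measurable_comm_op hR mb (measurable_indic mB)).
rewrite -integral_cst//.
apply: (@le_trans _ _ (\int[mu]_(x in ball z r) (`|comm_op mu dist b \1_(ball z r) x| `^ q))).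
  apply: ge0_le_integral => //.
  - by move=> x _; rewrite lee_fin powR_ge0.
  - exact: measurable_funTS.
  - move=> x zx; rewrite gee0_abs ?(comm_op_ge0 hR)// -poweR_EFin.
    apply: gt0_ler_poweR; rewrite ?in_itv/= ?leey ?andbT ?lee_fin ?(ltW q0) ?(ltW l0)//.
      exact: (comm_op_ge0 hR).
    exact/ltW/Hl.
by apply: ge0_subset_integral => // x _; exact: poweR_ge0.
Qed.

Lemma osc_of_weak_type (beta C : R) : (0 < beta)%R -> (beta < Q)%R -> (0 < C)%R ->
  (forall (l : R) (f : T -> R), (0 < l)%R ->
    measurable_fun setT f -> 'N[mu]_1[EFin \o f] < +oo ->
    mu [set x | comm_op mu dist b f x > l%:E] <=
      C%:E * ((l^-1)%:E * 'N[mu]_1[EFin \o f]) `^ (Q / (Q - beta))) ->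
  forall z r, (0 < r)%R ->
  exists c : R, \int[mu]_(y in ball z r) `|b y - c|%:E <=
    (2 * C `^ (1 - beta / Q) * vol r `^ (beta / Q) * vol r)%:E.
Proof.
move=> beta0 bQ C0 H z r r0; apply: osc_of_comm_op => // Hl.
set l := (2 * _ * _)%R in Hl.
have Q0 := hdim_gt0 hR.
have Qb : (0 < Q - beta)%R by rewrite subr_gt0.
set q := (Q / (Q - beta))%R in H.
have q0 : (0 < q)%R by rewrite divr_gt0.
have v0 := vol_gt0 hR r0.
have mB := mball z r.
have l0 : (0 < l)%R by rewrite /l mulr_gt0 ?powR_gt0// mulr_gt0 ?powR_gt0.
have := H l \1_(ball z r) l0 (measurable_indic mB).
rewrite Lnorm_indic// (qball_measure hR) invr1 poweRe1 ?lee_fin ?(ltW v0)//.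
rewrite ltry => /(_ isT).
apply/negP; rewrite -ltNge -(EFinM l^-1) poweR_EFin -EFinM.
apply: (@lt_le_trans _ _ (mu (ball z r))); last first.
  apply: le_measure; rewrite ?inE//.
  rewrite (_ : [set x | _] = comm_op mu dist b \1_(ball z r) @^-1` `]l%:E, +oo[%classic); last first.
    by apply/seteqP; split => y /=; rewrite in_itv/= andbT.
  rewrite -[X in measurable X]setTI.
  apply: (measurable_comm_op hR mb (measurable_indic mB)) => //.
  exact: emeasurable_itv.
rewrite (qball_measure hR) lte_fin.
(* With this relation and the choice of [l], the weak-type bound collapses to 2^(-q) vol(r),
   strictly less than the measure of the ball. *)
have eq1 : ((1 - beta / Q) * q = 1)%R by rewrite /q; field; rewrite !gt_eqF.
have -> : (l^-1 * vol r = 2^-1 * C `^ (- (1 - beta / Q)) * vol r `^ (1 - beta / Q))%R.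
  rewrite /l !powRN (@powRB _ (vol r)); last by rewrite (gt_eqF v0) implybT.
  by rewrite powRr1 ?(ltW v0)//; field; rewrite !gt_eqF ?powR_gt0.
rewrite powRM ?powR_ge0 ?mulr_ge0 ?powR_ge0// powRM ?powR_ge0//.
rewrite -!powRrM mulNr eq1 powRr1 ?(ltW v0)// powR_inv1 ?(ltW C0)//.
rewrite mulrA mulrCA divff ?gt_eqF// mulr1 gtr_pMl//.
have := @gt0_ltr_powR _ _ q0 (2^-1)%R 1%R; rewrite powR1; apply.
- by rewrite nnegrE.
- by rewrite nnegrE.
- by rewrite invf_lt1// ltr1n.
Qed.
End oscillation.

(** * Construction of the Lipschitz version *)

Section lipschitz_version.
Context d (T : measurableType d) (R : realType).
Context (mu : {measure set T -> \bar R}) (dist : T -> T -> R) (Q K c1 c2 : R).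
Context (vol : R -> R) (zs : nat -> T).
Hypothesis hR : ahlfors_regular mu dist Q K c1 c2 vol zs.
Local Notation ball := (qball dist).
Local Notation mball := (measurable_qball hR).

(** Balls are assumed measurable, not open. A superlevel set is still the union of those among
    countably many balls, with centres in [zs] and rational radii, that it contains. *)
Lemma measurable_lipschitz (b : T -> R) (beta C : R) : 0 < beta -> 0 < C ->
  (forall x y, `|b x - b y| <= C * dist x y `^ beta) -> measurable_fun setT b.
Proof.
move=> beta0 C0 blip.
have K1 := quasi_const_ge1 hR.
apply: (measurability _ (RGenOInfty.measurableE R)) => // _ [_ [a ->] <-].
rewrite setTI.
rewrite [X in measurable X](_ : _ = \bigcup_(i : nat * rat)
  (if `[< rat_qball dist zs i `<=` [set x | a < b x] >] then rat_qball dist zs i else set0)).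
  apply: countable_bigcupT_measurable; first exact: countableP.
  by move=> i; case: ifP => // _; exact: mball.
apply/seteqP; split => x /=; last first.
  by move=> [i _]; rewrite in_itv/= andbT; case: ifPn => // /asboolP; apply.
rewrite in_itv/= andbT => ax.
(* Within distance [e] of [x] the Lipschitz bound keeps [b] above [a]; moving the centre to a point
   of [zs] costs the factor [K * 2]. *)
pose e := ((b x - a) / C) `^ beta^-1.
have ba0 : 0 < (b x - a) / C by rewrite divr_gt0// subr_gt0.
have e0 : 0 < e by rewrite powR_gt0.
have eK : 0 < e / (K * 2) by rewrite divr_gt0// mulr_gt0//; lra.
have [q] := rat_in_itvoo eK.
rewrite in_itv/= => /andP[q0 qe].
have [phi phiP] := quasi_dist_separable hR x.
have phix := phiP x; rewrite ((quasi_dist_eq0 hR x x).2 erefl) in phix.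
have [N _ HN] := cvgr_lt _ phix _ q0.
have xN := HN N (leqnn N).
exists (phi N, q) => //; rewrite ifT//; apply/asboolP => u uN.
have ux : dist x u < e.
  apply: (le_lt_trans (quasi_dist_triangle hR _ (zs (phi N)) _)).
  rewrite ltr_pdivlMr ?mulr_gt0 in qe; try lra.
  rewrite /rat_qball/qball/= in uN; rewrite (quasi_dist_sym hR u) in uN.
  have : dist x (zs (phi N)) + dist (zs (phi N)) u < ratr q * 2 by rewrite mulr_natr mulr2n ltrD.
  by rewrite -(ltr_pM2l (_ : 0 < K)); lra.
have := blip x u.
have : C * dist x u `^ beta < C * ((b x - a) / C).
  rewrite ltr_pM2l//.
  have -> : (b x - a) / C = e `^ beta.
    by rewrite /e -powRrM mulVf ?gt_eqF// powRr1// ltW.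
  by apply: gt0_ltr_powR => //; rewrite nnegrE ?(quasi_dist_ge0 hR)// ltW.
rewrite (_ : C * ((b x - a) / C) = b x - a); last by field; rewrite gt_eqF.
move=> h1 h2.
by have := ler_norm (b x - b u); rewrite /=; lra.
Qed.

Section campanato.
Variables (b : T -> R) (mb : measurable_fun setT b).
Variables (beta H : R) (beta0 : 0 < beta) (H0 : 0 < H).
Variable c : T -> R -> R.
Hypothesis osc : forall z r, 0 < r ->
  (\int[mu]_(y in ball z r) `|b y - c z r|%:E <= (H * r `^ beta * vol r)%:E)%E.

Definition campanato_const := H * (1 + c2 / c1 * (K * 2) `^ Q).

Lemma campanato_const_gt0 : 0 < campanato_const.
Proof.
have h1 := vol_const_gt0 hR; have h2 := vol_const2_gt0 hR.
rewrite /campanato_const mulr_gt0// ltr_pwDl// mulr_ge0 ?powR_ge0//.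
by rewrite divr_ge0// ltW.
Qed.

Lemma measurable_abs_sub (a : R) : measurable_fun setT (fun y => `|b y - a|%:E).
Proof.
apply/measurable_EFinP; apply: measurableT_comp => //.
exact: measurable_funB.
Qed.

(** The difference of the two constants is averaged over the smaller ball, where both are close to
    [b] in mean. The comparability of [r] and [s] bounds the ratio of volumes, which is the second
    term of [campanato_const]. *)
Lemma osc_center_close z z' s r : 0 < s -> s <= r -> r <= K * 2 * s ->
  ball z s `<=` ball z' r -> `|c z s - c z' r| <= campanato_const * r `^ beta.
Proof.
move=> s0 sr rs zz'.
have r0 : 0 < r by exact: lt_le_trans sr.
have v0 := vol_gt0 hR s0.
have h1 := vol_const_gt0 hR; have h2 := vol_const2_gt0 hR.
have K1 := quasi_const_ge1 hR.
have vr : vol r <= c2 / c1 * (K * 2) `^ Q * vol s.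
  apply: (le_trans (vol_ub hR r0)).
  have -> : c2 / c1 * (K * 2) `^ Q * vol s = c2 * ((K * 2) `^ Q * (vol s / c1)) by ring.
  rewrite ler_pM2l//.
  have : r `^ Q <= (K * 2 * s) `^ Q.
    apply: ge0_ler_powR => //; rewrite ?nnegrE ?(ltW (hdim_gt0 hR)) ?(ltW r0)//.
    by rewrite (le_trans _ rs)// ltW.
  move/le_trans; apply; rewrite powRM ?(ltW s0)//; last by lra.
  apply: ler_wpM2l; first exact: powR_ge0.
  by rewrite ler_pdivlMr// mulrC; exact: (vol_lb hR).
have int_le : ((`|c z s - c z' r| * vol s)%:E <=
    (H * s `^ beta * vol s + H * r `^ beta * vol r)%:E)%E.
  rewrite EFinM -(qball_measure hR z) -integral_cst; last exact: mball.
  apply: (@le_trans _ _ (\int[mu]_(y in ball z s) (`|b y - c z s|%:E + `|b y - c z' r|%:E))%E).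
    apply: ge0_le_integral => //; first exact: mball.
    - by move=> y _; rewrite lee_fin.
    - by apply: measurable_funTS; apply: emeasurable_funD; exact: measurable_abs_sub.
    - move=> y _; rewrite -EFinD lee_fin.
      have -> : c z s - c z' r = (b y - c z' r) - (b y - c z s) by ring.
      by rewrite /= [leRHS]addrC; exact: ler_normB.
  rewrite ge0_integralD//; [|exact: mball|by apply: measurable_funTS; exact: measurable_abs_sub
    |by apply: measurable_funTS; exact: measurable_abs_sub].
  rewrite EFinD; apply: leeD; first exact: osc.
  apply: le_trans (osc z' r0); apply: ge0_subset_integral => //.
  - exact: mball.
  - exact: mball.
  - by apply: measurable_funTS; exact: measurable_abs_sub.
rewrite lee_fin in int_le; rewrite -(ler_pM2r v0); apply: (le_trans int_le).
have sb : s `^ beta <= r `^ beta.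
  by apply: ge0_ler_powR; rewrite ?nnegrE// ltW.
have rb0 : 0 <= r `^ beta := powR_ge0 _ _.
have -> : campanato_const * r `^ beta * vol s = H * r `^ beta * vol s +
   H * r `^ beta * (c2 / c1 * (K * 2) `^ Q * vol s) by rewrite /campanato_const; ring.
apply: lerD.
  by apply: ler_wpM2r; [exact: ltW|apply: ler_wpM2l => //; exact: ltW].
by apply: ler_wpM2l => //; rewrite mulr_ge0// ltW.
Qed.

Definition lip_const := geom_const beta * campanato_const.

Lemma lip_const_gt0 : 0 < lip_const.
Proof.
have G0 : 0 < geom_const beta by rewrite invr_gt0 geom_ratio_gt0.
exact: mulr_gt0 G0 campanato_const_gt0.
Qed.

(** Telescoping over halved radii gives a geometric series of ratio 2^(-beta), whence the factor
    [geom_const beta] in [lip_const]. The induction is on the number of doublings that lead from [s]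
    past [r]. *)
Lemma osc_center_cauchy z s r : 0 < s -> s <= r ->
  `|c z s - c z r| <= lip_const * r `^ beta.
Proof.
have h := geom_ratio_gt0 beta0.
have K1 := quasi_const_ge1 hR.
have G1 : geom_const beta * 2 `^ (- beta) + 1 = geom_const beta.
  by rewrite /geom_const; field; exact: lt0r_neq0.
have M0 := campanato_const_gt0.
have G0 : 0 < geom_const beta by rewrite invr_gt0.
have Gge1 : 1 <= geom_const beta.
  by rewrite -G1 lerDr mulr_ge0 ?powR_ge0// ltW.
move=> s0; have [n] : exists n, r <= s * 2 ^+ n.
  exists (Num.truncn (r / s)).+1; rewrite mulrC -ler_pdivrMr//.
  apply: (le_trans (ltW (truncnS_gt _))).
  by rewrite -natrX ler_nat ltnW// ltn_expl.
have close2 t u : s <= t -> t <= u -> u <= 2 * t ->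
    `|c z t - c z u| <= campanato_const * u `^ beta.
  move=> st tu ut; have t0 : 0 < t by exact: lt_le_trans st.
  apply: osc_center_close => //; last exact: subset_qball.
  by apply: (le_trans ut); rewrite ler_pM2r//; lra.
elim: n r => [|n IH] r rs sr.
  rewrite expr0 mulr1 in rs; have -> : r = s by apply/eqP; rewrite eq_le rs.
  by rewrite subrr normr0 mulr_ge0 ?powR_ge0// ltW// lip_const_gt0.
have r0 : 0 < r by exact: lt_le_trans sr.
have rb0 : 0 <= r `^ beta := powR_ge0 _ _.
(* Up to twice [s], halving could lead below [s], so the two radii are compared directly. *)
have [r2|r2] := leP r (2 * s).
  apply: (le_trans (close2 s r (lexx _) sr r2)).
  by apply: ler_wpM2r => //; rewrite /lip_const ler_peMl// ltW.
have -> : c z s - c z r = (c z s - c z (r / 2)) + (c z (r / 2) - c z r) by ring.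
apply: (le_trans (ler_normD _ _)).
have IHr : `|c z s - c z (r / 2)| <= lip_const * (r / 2) `^ beta.
  apply: IH; first by rewrite ler_pdivrMr// -mulrA -exprSr.
  by rewrite ler_pdivlMr// mulrC ltW.
have cl : `|c z (r / 2) - c z r| <= campanato_const * r `^ beta.
  by apply: close2; lra.
apply: (le_trans (lerD IHr cl)).
rewrite powRM ?(ltW r0)// -powR_inv1// -powRrM mulN1r.
by rewrite /lip_const -[X in _ <= X * _ * _]G1 le_eqVlt; apply/orP; left; apply/eqP; ring.
Qed.

(* The limit of c z r as r tends to 0, as a supremum of lower bounds. *)
Definition lip_version z := sup [set c z r - lip_const * r `^ beta | r in [set r | 0 < r]].

(** By the Cauchy estimate each c(z, t) + L t^beta is above every c(z, s) - L s^beta, with L =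
    [lip_const], whichever radius is larger; hence the supremum is also below all the upper
    bounds. *)
Lemma lip_version_close z r : 0 < r ->
  `|lip_version z - c z r| <= lip_const * r `^ beta.
Proof.
move=> r0.
have M0 := lip_const_gt0.
have ub t : 0 < t -> ubound [set c z r - lip_const * r `^ beta | r in [set r | 0 < r]]
   (c z t + lip_const * t `^ beta).
  move=> t0 _ [s /= s0 <-].
  have tb0 : 0 <= lip_const * t `^ beta by rewrite mulr_ge0 ?powR_ge0// ltW.
  have sb0 : 0 <= lip_const * s `^ beta by rewrite mulr_ge0 ?powR_ge0// ltW.
  have [st|ts] := leP s t.
    have := osc_center_cauchy z s0 st.
    by rewrite ler_norml => /andP[]; lra.
  have := osc_center_cauchy z t0 (ltW ts).
  by rewrite ler_norml => /andP[]; lra.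
have hs : has_sup [set c z r - lip_const * r `^ beta | r in [set r | 0 < r]].
  split; first by exists (c z r - lip_const * r `^ beta); exists r.
  by exists (c z r + lip_const * r `^ beta); exact: ub.
rewrite ler_distl; apply/andP; split.
  by apply: sup_upper_bound => //; exists r.
by apply: ge_sup; [case: hs|exact: ub].
Qed.

(** Points [x], [y] at distance r are joined through [c x (K * 2 * r)] and [c y r]: two passages
    between version and constant, and one between constants, since the ball of radius [K * 2 * r] at
    [x] contains that of radius r at [y]. *)
Definition lip_seminorm := (lip_const * 2 + campanato_const) * (K * 2) `^ beta.

Lemma lip_version_lip x y :
  `|lip_version x - lip_version y| <= lip_seminorm * dist x y `^ beta.
Proof.
have K1 := quasi_const_ge1 hR.
have M0 := lip_const_gt0; have C0 := campanato_const_gt0.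
have := quasi_dist_ge0 hR x y; rewrite le_eqVlt => /predU1P[/esym/(quasi_dist_eq0 hR)->|r0].
  by rewrite subrr normr0 mulr_ge0 ?powR_ge0// mulr_ge0 ?powR_ge0//; lra.
set r := dist x y in r0 *.
have r20 : 0 < K * 2 * r by rewrite mulr_gt0//; lra.
have r2 : r <= K * 2 * r by rewrite ler_peMl ?(ltW r0)//; lra.
have cl : `|c y r - c x (K * 2 * r)| <= campanato_const * (K * 2 * r) `^ beta.
  apply: osc_center_close => // u; rewrite /qball/= => uy.
  apply: (le_lt_trans (quasi_dist_triangle hR u y x)).
  rewrite (quasi_dist_sym hR y x) -/r -mulrA ltr_pM2l; lra.
have hx := lip_version_close x r20; have hy := lip_version_close y r0.
have rb : r `^ beta <= (K * 2 * r) `^ beta.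
  by apply: ge0_ler_powR; rewrite ?nnegrE// ltW.
have -> : lip_version x - lip_version y = (lip_version x - c x (K * 2 * r)) +
  (- (c y r - c x (K * 2 * r))) + (- (lip_version y - c y r)) by ring.
have n1 := ler_normD ((lip_version x - c x (K * 2 * r)) +
  (- (c y r - c x (K * 2 * r)))) (- (lip_version y - c y r)).
have n2 := ler_normD (lip_version x - c x (K * 2 * r))
  (- (c y r - c x (K * 2 * r))).
rewrite !normrN in n1 n2.
have rb' : lip_const * r `^ beta <= lip_const * (K * 2 * r) `^ beta.
  by rewrite ler_pM2l.
apply: (@le_trans _ _ ((lip_const * 2 + campanato_const) * (K * 2 * r) `^ beta)).
  by lra.
by rewrite /lip_seminorm powRM ?(ltW r0) ?mulrA//; lra.
Qed.

Lemma lip_seminorm_gt0 : 0 < lip_seminorm.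
Proof.
have K1 := quasi_const_ge1 hR.
have M0 := lip_const_gt0; have C0 := campanato_const_gt0.
by rewrite /lip_seminorm mulr_gt0 ?powR_gt0 ?mulr_gt0//; lra.
Qed.

Lemma measurable_lip_version : measurable_fun setT lip_version.
Proof.
exact: (measurable_lipschitz beta0 lip_seminorm_gt0 lip_version_lip).
Qed.

Definition lip_defect y := `|b y - lip_version y|%:E.

Lemma measurable_lip_defect : measurable_fun setT lip_defect.
Proof.
apply/measurable_EFinP; apply: measurableT_comp => //.
exact: measurable_funB mb measurable_lip_version.
Qed.

Definition defect_const := H + lip_const + lip_seminorm.

(** The value [b y] is compared with [c z r], then with the version at [z] and at [y]. The factor
    r^beta beyond the volume is what will force the defect to vanish. *)
Lemma integral_lip_defect z r : 0 < r ->
  (\int[mu]_(y in ball z r) lip_defect y <= (defect_const * r `^ beta * vol r)%:E)%E.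
Proof.
move=> r0.
have M0 := lip_const_gt0; have C0 := lip_seminorm_gt0.
have rb0 : 0 <= r `^ beta := powR_ge0 _ _.
apply: (@le_trans _ _ (\int[mu]_(y in ball z r)
   (`|b y - c z r|%:E + cst ((lip_const + lip_seminorm) * r `^ beta)%:E y))%E).
  apply: ge0_le_integral => //; first exact: mball.
  - by move=> y _; rewrite lee_fin.
  - by apply: measurable_funTS; exact: measurable_lip_defect.
  - by apply: measurable_funTS; apply: emeasurable_funD; [exact: measurable_abs_sub|exact: measurable_cst].
  - move=> y zy; rewrite -EFinD lee_fin.
    have -> : b y - lip_version y = (b y - c z r) + (- (lip_version z - c z r)) + (lip_version z - lip_version y) by ring.
    have h1 := lip_version_close z r0; have h2 := lip_version_lip z y.
    have n1 := ler_normD ((b y - c z r) + (- (lip_version z - c z r))) (lip_version z - lip_version y).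
    have n2 := ler_normD (b y - c z r) (- (lip_version z - c z r)).
    rewrite normrN in n2.
    have h3 : lip_seminorm * dist z y `^ beta <= lip_seminorm * r `^ beta.
      rewrite ler_pM2l//; apply: ge0_ler_powR; rewrite ?nnegrE ?(quasi_dist_ge0 hR) ?(ltW beta0) ?(ltW r0)//.
      by rewrite (quasi_dist_sym hR) ltW.
    by lra.
rewrite ge0_integralD//; [|exact: mball|by apply: measurable_funTS; exact: measurable_abs_sub
  |by move=> y _; rewrite lee_fin mulr_ge0// ltW// addr_gt0].
rewrite integral_cst; last exact: mball.
rewrite (qball_measure hR) -EFinM.
have -> : defect_const * r `^ beta * vol r = H * r `^ beta * vol r + (lip_const + lip_seminorm) * r `^ beta * vol r.
  by rewrite /defect_const; ring.
by rewrite EFinD; apply: leeD => //; exact: osc.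
Qed.

End campanato.
End lipschitz_version.

(** * Almost everywhere agreement with the Lipschitz version *)

Section campanato_theorem.
Context d (T : measurableType d) (R : realType).
Context (mu : {measure set T -> \bar R}) (dist : T -> T -> R) (Q K c1 c2 : R).
Context (vol : R -> R) (zs : nat -> T).
Hypothesis hR : ahlfors_regular mu dist Q K c1 c2 vol zs.
Local Notation ball := (qball dist).
Local Notation mball := (measurable_qball hR).
Local Notation L := (vitali_const K).
Local Notation D := (doubling_const Q K c1 c2).
Local Open Scope ereal_scope.

Lemma integral_bigsetU_le (h : T -> \bar R) (I : Type) (s : seq I) (F : I -> set T) :
  (forall i, measurable (F i)) -> measurable_fun setT h -> (forall x, 0 <= h x) ->
  \int[mu]_(x in \big[setU/set0]_(i <- s) F i) h x <=
  \sum_(i <- s) \int[mu]_(x in F i) h x.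
Proof.
move=> mF mh h0; elim: s => [|i s IH]; first by rewrite !big_nil integral_set0.
rewrite !big_cons.
have mU : measurable (\big[setU/set0]_(j <- s) F j) by exact: bigsetU_measurable.
rewrite -(setDUK (@subsetUl _ (F i) _)) setDUl setDv set0U.
rewrite ge0_integral_setU//.
- apply: leeD => //; apply: le_trans IH; apply: ge0_subset_integral => //.
  + exact: measurableD.
  + exact: measurable_funTS.
- exact: measurableD.
- exact: measurable_funTS.
- by apply/disj_setPS => x [? []].
Qed.

Lemma integral_bigcup_le (F : (set T)^nat) (h : T -> \bar R) (M : \bar R) :
  (forall i, measurable (F i)) -> measurable_fun setT h -> (forall x, 0 <= h x) ->
  (forall n, \int[mu]_(x in \big[setU/set0]_(i < n) F i) h x <= M) ->
  \int[mu]_(x in \bigcup_i F i) h x <= M.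
Proof.
move=> mF mh h0 FM; rewrite leNgt; apply/negP.
rewrite -(bigcup_bigsetU_bigcup F) => Mlt.
have [||n] := integral_bigcup_gt _ _ mh h0 Mlt.
- by move=> n m nm; apply/subsetPset; exact: subset_bigsetU.
- by move=> i; apply: bigsetU_measurable.
by rewrite ltNge FM.
Qed.

Section vanishing.
Variables (h : T -> \bar R) (beta M : R).
Hypotheses (beta0 : (0 < beta)%R) (M0 : (0 < M)%R).
Hypotheses (mh : measurable_fun setT h) (h0 : forall x, 0 <= h x).
Hypothesis hB : forall z r, (0 < r)%R ->
  \int[mu]_(y in ball z r) h y <= (M * r `^ beta * vol r)%:E.

(** Balls of radius [r] centred in [zs] that hit [ball o S] cover it. The selected ones have total
    volume at most that of one larger ball independent of [r], while the integral over each dilate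
    carries the small factor r^beta. *)
Lemma integral_qball_small o S r : (0 < S)%R -> (0 < r)%R -> (r <= 1)%R ->
  \int[mu]_(y in ball o S) h y <=
  (M * L `^ beta * D * vol (K * (K * 2 + S)) * r `^ beta)%:E.
Proof.
move=> S0 r0 r1.
have K1 := quasi_const_ge1 hR.
have L0 := vitali_const_gt0 hR.
have Lr0 : (0 < L * r)%R by rewrite mulr_gt0.
pose hit n := ball (zs n) r `&` ball o S !=set0.
pose F n := if `[< hit n >] then ball (zs n) r else set0.
have mF n : measurable (F n) by rewrite /F; case: ifP => // _; exact: mball.
apply: (@le_trans _ _ (\int[mu]_(y in \bigcup_n F n) h y)).
  apply: ge0_subset_integral => //.
  - exact: mball.
  - exact: bigcupT_measurable.
  - exact: measurable_funTS.
  - move=> y yo; have [phi phiP] := quasi_dist_separable hR y.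
    have phiy := phiP y; rewrite ((quasi_dist_eq0 hR y y).2 erefl) in phiy.
    have [N _ HN] := cvgr_lt _ phiy _ r0.
    have yN := HN N (leqnn N).
    exists (phi N) => //; rewrite /F ifT//; apply/asboolP.
    by exists y.
apply: integral_bigcup_le => // n.
pose s : seq (T * R) := [seq (zs k, r) | k <- iota 0 n & `[< hit k >]].
have sP p : p \in s -> exists2 k, hit k & p = (zs k, r).
  by move=> /mapP[k]; rewrite mem_filter => /andP[/asboolP hk _] ->; exists k.
(* For the constant 1 the selection is a packing bound: the measures of the selected balls sum to at
   most that of the union. *)
have [|s' [s's cov le_s']] := vitali_select hR (measurable_cst (1 : \bar R)) (fun=> lee01) (s := s).
  by move=> p /sP[k _ ->].
have s'P p : p \in s' -> p.2 = r by move=> /s's/sP[k _ ->].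
apply: (@le_trans _ _ (\int[mu]_(y in \big[setU/set0]_(p <- s') ball p.1 (L * p.2)) h y)).
  apply: ge0_subset_integral => //.
  - exact: bigsetU_measurable.
  - by apply: bigsetU_measurable => i _; exact: mball.
  - exact: measurable_funTS.
  - rewrite -bigcup_mkord -bigcup_seq => y [k /= kn]; rewrite /F.
    case: asboolP => // hk yk.
    have ks : (zs k, r) \in s.
      by apply: map_f; rewrite mem_filter mem_iota/= kn andbT; exact/asboolP.
    have [q qs' kq] := cov _ ks.
    by exists q => //; exact: kq.
apply: (le_trans (integral_bigsetU_le _ _ mh h0)); first by move=> i; exact: mball.
apply: (@le_trans _ _ ((M * (L * r) `^ beta * D)%:E *
    \sum_(p <- s') \int[mu]_(y in ball p.1 p.2) (cst 1 y))).
  rewrite ge0_sume_distrr; last by move=> i _; exact: integral_ge0.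
  rewrite big_seq [leRHS]big_seq; apply: lee_sum => p /s'P pr.
  rewrite pr integral_cst; last exact: mball.
  rewrite mul1e; apply: (le_trans (hB p.1 Lr0)).
  rewrite (EFinM (M * _)) (EFinM (M * _)) -muleA; apply: lee_wpmul2l.
    by rewrite lee_fin mulr_ge0 ?powR_ge0// ltW.
  by rewrite -(qball_measure hR p.1); exact: (measure_dilated_qball hR).
have D0 := doubling_const_gt0 hR.
apply: (@le_trans _ _ ((M * (L * r) `^ beta * D)%:E * (vol (K * (K * 2 + S)))%:E)); last first.
  rewrite -EFinM lee_fin powRM ?(ltW r0) ?(ltW L0)// le_eqVlt.
  by apply/orP; left; apply/eqP; ring.
apply: lee_wpmul2l.
  by rewrite lee_fin; apply: mulr_ge0; [rewrite mulr_ge0 ?powR_ge0//|]; exact: ltW.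
apply: (le_trans le_s'); rewrite integral_cst; last first.
  by apply: bigsetU_measurable => i _; exact: mball.
(* A point of a ball hitting [ball o S] is within [K * 2 * r], hence [K * 2], of a point of
   [ball o S]; this is the origin of the radius [K * (K * 2 + S)]. *)
rewrite mul1e -(qball_measure hR o); apply: le_measure; rewrite ?inE.
- by apply: bigsetU_measurable => i _; exact: mball.
- exact: mball.
- rewrite -bigcup_seq => u [p /= /sP[k [y [yk yo]] ->]].
  rewrite /qball/= in yk yo * => uk.
  apply: (le_lt_trans (quasi_dist_triangle hR u y o)).
  rewrite ltr_pM2l; last by lra.
  have h1 := quasi_dist_triangle hR u (zs k) y.
  rewrite (quasi_dist_sym hR (zs k)) in h1.
  have h2 : (K * (dist u (zs k) + dist y (zs k)) <= K * 2)%R.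
    by rewrite ler_pM2l; lra.
  lra.
Qed.

Lemma vanishing_ae : {ae mu, forall x, h x = 0}.
Proof.
have zero o S : (0 < S)%R -> \int[mu]_(y in ball o S) h y = 0.
  move=> S0; apply/eqP; rewrite eq_le integral_ge0// andbT.
  have D0 := doubling_const_gt0 hR; have L0 := vitali_const_gt0 hR.
  have K1 := quasi_const_ge1 hR.
  set W := (M * L `^ beta * D * vol (K * (K * 2 + S)))%R.
  have W0 : (0 < W)%R.
    rewrite /W; apply: mulr_gt0; last by apply: (vol_gt0 hR); rewrite mulr_gt0//; nra.
    by apply: mulr_gt0 => //; rewrite mulr_gt0// powR_gt0.
  apply/lee_addgt0Pr => e e0; rewrite add0e.
  pose r := Num.min 1%R ((e / W) `^ beta^-1)%R.
  have eW : (0 < e / W)%R by rewrite divr_gt0.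
  have r0 : (0 < r)%R by rewrite lt_min ltr01 powR_gt0.
  have r1 : (r <= 1)%R by rewrite ge_min lexx.
  apply: (le_trans (integral_qball_small o S0 r0 r1)).
  rewrite lee_fin -/W -ler_pdivlMl// mulrC.
  have -> : (e / W = ((e / W) `^ beta^-1) `^ beta)%R.
    by rewrite -powRrM mulVf ?gt_eqF// powRr1// ltW.
  apply: ge0_ler_powR; rewrite ?nnegrE ?(ltW beta0) ?(ltW r0) ?powR_ge0//.
  by rewrite ge_min lexx orbT.
have int0 : \int[mu]_y `|h y| = 0.
  under eq_integral do rewrite gee0_abs//.
  apply/eqP; rewrite eq_le integral_ge0// andbT.
  have [F TF mF] := ahlfors_sigma_finite hR.
  rewrite (_ : setT = \bigcup_n ball point n.+1%:R); last first.
    apply/esym/seteqP; split => // y _; exists (Num.truncn (dist y point)) => //.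
    by rewrite /qball/= truncnS_gt.
  apply: integral_bigcup_le => //; first by move=> n; exact: mball.
  move=> n; apply: (le_trans (integral_bigsetU_le _ _ mh h0)); first by move=> i; exact: mball.
  by rewrite big1// => i _; exact: zero.
have /ae_eq_integral_abs := int0; move=> /(_ measurableT mh).
by apply: filterS => x /(_ I).
Qed.
End vanishing.

Lemma lipschitz_of_osc (b : T -> R) (beta H : R) : measurable_fun setT b ->
  (0 < beta)%R -> (0 < H)%R ->
  (forall z r, (0 < r)%R -> exists c : R,
    \int[mu]_(y in ball z r) `|b y - c|%:E <= (H * vol r `^ (beta / Q) * vol r)%:E) ->
  exists2 b' : T -> R, {ae mu, forall x, b x = b' x} &
    exists2 C : R, (0 < C)%R &
      forall x y, (`|b' x - b' y| <= C * dist x y `^ beta)%R.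
Proof.
move=> mb beta0 H0 osc.
have Q0 := hdim_gt0 hR; have cc2 := vol_const2_gt0 hR.
(* The upper volume bound turns vol(r)^(beta/Q) into r^beta at the cost of this power of [c2]. *)
pose H' := (H * c2 `^ (beta / Q))%R.
have H'0 : (0 < H')%R by rewrite mulr_gt0// powR_gt0.
have /choice[c cP] : forall zr : T * R, exists c : R, (0 < zr.2)%R ->
    \int[mu]_(y in ball zr.1 zr.2) `|b y - c|%:E <= (H' * zr.2 `^ beta * vol zr.2)%:E.
  move=> [z r]/=; have [r0|r0] := leP r 0%R; first by exists 0%R.
  have [c cP] := osc z r r0; exists c => _; apply: (le_trans cP).
  have v0 := vol_gt0 hR r0.
  rewrite lee_fin ler_pM2r// /H' -mulrA ler_pM2l//.
  have -> : (r `^ beta = (r `^ Q) `^ (beta / Q))%R.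
    by rewrite -powRrM; congr powR; field; rewrite gt_eqF.
  rewrite -powRM ?powR_ge0 ?(ltW cc2)//; apply: ge0_ler_powR.
  - by rewrite divr_ge0// ltW.
  - by rewrite nnegrE ltW.
  - by rewrite nnegrE mulr_ge0 ?powR_ge0// ltW.
  - exact: (vol_ub hR).
pose cc z r := c (z, r).
have ccP z r : (0 < r)%R ->
    \int[mu]_(y in ball z r) `|b y - cc z r|%:E <= (H' * r `^ beta * vol r)%:E.
  exact: (cP (z, r)).
exists (lip_version Q K c1 c2 beta H' cc).
  have M0 : (0 < defect_const Q K c1 c2 beta H')%R.
    have h1 := lip_const_gt0 hR beta0 H'0; have h2 := lip_seminorm_gt0 hR beta0 H'0.
    by rewrite /defect_const; lra.
  apply: filterS (vanishing_ae beta0 M0 (measurable_lip_defect hR mb beta0 H'0 ccP) _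
     (integral_lip_defect hR mb beta0 H'0 ccP)) => [x|x].
    by move=> [/eqP]; rewrite normr_eq0 subr_eq0 => /eqP.
  by rewrite lee_fin.
exists (lip_seminorm Q K c1 c2 beta H'); first exact: (lip_seminorm_gt0 hR beta0 H'0).
exact: (lip_version_lip hR mb beta0 H'0 ccP).
Qed.
End campanato_theorem.

(** * Baker-Campbell-Hausdorff product and dilations *)

Lemma cvg_bigsum {K : numFieldType} {W : pseudoMetricNormedZmodType K} (X : Type)
    (F : set_system X) {FF : Filter F} (I : Type) (s : seq I) (f : I -> X -> W) (l : I -> W) :
  (forall i, f i x @[x --> F] --> l i) ->
  \sum_(i <- s) f i x @[x --> F] --> \sum_(i <- s) l i.
Proof.
move=> fl; elim: s => [|i s IH].
  by rewrite big_nil; under eq_fun do rewrite big_nil; exact: cvg_cst.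
by rewrite big_cons; under eq_fun do rewrite big_cons; exact: cvgD.
Qed.

Section lie_algebra.
Context {R : realType} {n : nat}.
Local Notation V := 'rV[R]_n.
Variable br : {bilinear V -> V -> V}.

Lemma cvg_bilinear (X : Type) (F : set_system X) {FF : Filter F} (f g : X -> V) (u v : V) :
  f x @[x --> F] --> u -> g x @[x --> F] --> v -> br (f x) (g x) @[x --> F] --> br u v.
Proof.
have E (a b : V) : br a b = \sum_i \sum_j (a 0 i * b 0 j) *: br 'e_i 'e_j.
  rewrite [in LHS](row_sum_delta a) [in LHS](row_sum_delta b).
  rewrite linear_sumlz; apply: eq_bigr => i _.
  rewrite linear_sumr; apply: eq_bigr => j _.
  by rewrite linearZl_LR linearZr_LR/= scalerA.
move=> fu gv; rewrite E; under eq_fun do rewrite E.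
apply: cvg_bigsum => i; apply: cvg_bigsum => j; apply: cvgZr_tmp.
apply: cvgM.
  exact: (continuous_cvg _ (@coord_continuous _ _ _ 0 i u) fu).
exact: (continuous_cvg _ (@coord_continuous _ _ _ 0 j v) gv).
Qed.

(** Each letter pairs a function with its limit, so that the word of functions and the word of
    limits are images of one list. *)
Lemma cvg_rnested_bracket (X : Type) (F : set_system X) {FF : Filter F}
  (w : seq ((X -> V) * V)) :
  (forall p, p \in w -> p.1 x @[x --> F] --> p.2) ->
  rnested_bracket br [seq p.1 x | p <- w] @[x --> F] -->
  rnested_bracket br [seq p.2 | p <- w].
Proof.
elim: w => [|p [|q w] IH] wP /=.
- exact: cvg_cst.
- by apply: wP; rewrite mem_head.
- apply: cvg_bilinear; first by apply: wP; rewrite mem_head.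
  by apply: IH => r rw; apply: wP; rewrite inE rw orbT.
Qed.

Lemma cvg_bch (X : Type) (F : set_system X) {FF : Filter F} m (f g : X -> V) (u v : V) :
  f x @[x --> F] --> u -> g x @[x --> F] --> v ->
  bch br m (f x) (g x) @[x --> F] --> bch br m u v.
Proof.
move=> fu gv; rewrite /bch; apply: cvg_bigsum => k.
under eq_fun do rewrite big_mkcond.
rewrite big_mkcond; apply: cvg_bigsum => d; case: ifP => _; last exact: cvg_cst.
apply: cvgZ; first exact: cvg_cst.
pose w := flatten [seq nseq (d i).1 (f, u) ++ nseq (d i).2 (g, v) | i <- enum 'I_k.+1].
have wE T (h : (X -> V) * V -> T) : [seq h p | p <- w] =
    flatten [seq nseq (d i).1 (h (f, u)) ++ nseq (d i).2 (h (g, v)) | i <- enum 'I_k.+1].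
  rewrite /w map_flatten -map_comp; congr flatten; apply: eq_map => i /=.
  by rewrite map_cat !map_nseq.
rewrite -(wE _ snd); under eq_fun do rewrite -(wE _ (fun p => p.1 _)).
apply: cvg_rnested_bracket => p /flattenP[s /mapP[i _ ->]].
by rewrite mem_cat !mem_nseq => /orP[/andP[_ /eqP->]|/andP[_ /eqP->]].
Qed.

Lemma rnested_bracket_hom (h : {linear V -> V}) :
  (forall x y, br (h x) (h y) = h (br x y)) ->
  forall w, rnested_bracket br (map h w) = h (rnested_bracket br w).
Proof.
move=> hbr; elim => [|x [|y w] IH]//=; first by rewrite linear0.
by rewrite -hbr; congr (br _ _); exact: IH.
Qed.

(** The series is made of brackets, sums and scalars only, and an endomorphism of the Lie algebra
    passes through all of them. It is applied to dilations and to the zero map. *)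
Lemma bch_hom (h : {linear V -> V}) m : (forall x y, br (h x) (h y) = h (br x y)) ->
  forall x y, bch br m (h x) (h y) = h (bch br m x y).
Proof.
move=> hbr x y; rewrite /bch linear_sum; apply: eq_bigr => k _.
rewrite linear_sum; apply: eq_bigr => d _; rewrite linearZ/=; congr (_ *: _).
rewrite -rnested_bracket_hom// map_flatten; congr (rnested_bracket br (flatten _)).
rewrite -[RHS]map_comp.
by apply: eq_map => i /=; rewrite map_cat !map_nseq.
Qed.

Lemma bch00 m : bch br m 0 0 = 0.
Proof.
have := @bch_hom (\0 : {linear V -> V}) m _ 0 0; apply => x y /=.
exact: linear0r.
Qed.

End lie_algebra.

(** * The grading and dilations as automorphisms *)

Section stratification.
Context {R : realType} {n : nat}.
Local Notation V := 'rV[R]_n.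
Variables (br : {bilinear V -> V -> V}) (m : nat) (S : nat -> {vspace V}).
Hypotheses (brP : is_lie_bracket br) (SP : is_stratification br m S).
Local Notation sumS := (\sum_(j < m) S j.+1)%VS.
Local Notation proj := (sumv_pi sumS).

Lemma lie_anticomm x y : br x y = - br y x.
Proof.
have := brP.1 (x + y); rewrite linearDr /= !linearDl/= !brP.1 add0r addr0.
by move/eqP; rewrite addr_eq0 => /eqP ->; rewrite opprK.
Qed.

Lemma bracketvP (U W : {vspace V}) u w : u \in U -> w \in W -> br u w \in bracketv br U W.
Proof.
move=> uU wW; rewrite (coord_vbasis uU) (coord_vbasis wW).
rewrite linear_sumlz; apply: memv_suml => i _.
rewrite linear_sumr; apply: memv_suml => j _.
rewrite linearZl_LR linearZr_LR/= scalerA memvZ//.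
apply: memv_span; apply/allpairsP; exists ((vbasis U)`_i, (vbasis W)`_j).
by split => //=; apply: mem_nth; rewrite size_tuple.
Qed.

(* S k is meaningless beyond the step m. *)
Definition stratum k := if (1 <= k <= m)%N then S k else 0%VS.

Lemma bracket_stratum1 j x y : (1 <= j)%N -> x \in stratum 1 -> y \in stratum j ->
  br x y \in stratum j.+1.
Proof.
have [_ _ Sj Sm] := SP.
move=> j1; rewrite /stratum j1/= => xS yS.
have [m0|m1] := leqP m 0.
  by move: xS; rewrite ltnNge m0/= memv0 => /eqP ->; rewrite linear0l mem0v.
have [jm|mj] := leqP j m; last first.
  by move: yS; rewrite leqNgt mj/= memv0 => /eqP ->; rewrite linear0r mem0v.
rewrite m1 jm in xS yS; have xy := bracketvP xS yS.
have [jltm|mlej] := ltnP j m; first by rewrite -Sj ?j1.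
have jE : j = m by apply/eqP; rewrite eqn_leq jm.
by rewrite jE Sm in xy.
Qed.

(** A stratification gives this for [i = 1] only. An element of V_(i+1) is a combination of brackets
    [u, w] with u in V_1 and w in V_i, and the Jacobi identity [[u, w], y] = [u, [w, y]] + [w,
    [y, u]] allows induction on [i]. *)
Lemma bracket_stratum i j x y : (1 <= i)%N -> (1 <= j)%N ->
  x \in stratum i -> y \in stratum j -> br x y \in stratum (i + j).
Proof.
elim: i j x y => // -[_|i IH] j x y _ j1 xi yj; first exact: bracket_stratum1.
have [im|im] := leqP i.+2 m; last first.
  move: xi; rewrite /stratum (leqNgt i.+2) im/= memv0 => /eqP ->.
  by rewrite linear0l mem0v.
have [_ _ Sj _] := SP.
have {}xi : x \in bracketv br (S 1%N) (S i.+1).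
  by rewrite Sj//; move: xi; rewrite /stratum im.
have m1 : (1 <= m)%N by apply: leq_trans im.
rewrite /bracketv in xi; rewrite (coord_span (X := in_tuple _) xi).
rewrite linear_sumlz; apply: memv_suml => k _.
rewrite linearZl_LR memvZ//.
have /allpairsP[[u w] [/= /vbasis_mem uS /vbasis_mem wS ->]] :
    (in_tuple [seq br u w | u <- vbasis (S 1%N), w <- vbasis (S i.+1)])`_k
    \in [seq br u w | u <- vbasis (S 1%N), w <- vbasis (S i.+1)].
  by apply: mem_nth.
have uS' : u \in stratum 1 by rewrite /stratum m1.
have wS' : w \in stratum i.+1 by rewrite /stratum (ltnW im).
have jac := brP.2 u w y.
have -> : br (br u w) y = br u (br w y) + br w (br y u).
  rewrite (lie_anticomm (br u w)); apply/eqP.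
  by rewrite eq_sym -subr_eq0 opprK jac.
rewrite addSn; apply: memvD.
  by apply: bracket_stratum1 => //; apply: IH.
rewrite (lie_anticomm y) linearNr memvN -addnS.
by apply: IH => //; apply: bracket_stratum1.
Qed.

Lemma proj_sum x : \sum_(j < m) proj j x = x.
Proof. by apply: sumv_pi_sum; have [_ -> _ _] := SP; rewrite memvf. Qed.

Lemma proj_stratum (j : 'I_m) x : proj j x \in S j.+1.
Proof. exact: memv_sum_pi. Qed.

Lemma proj_unique (f : 'I_m -> V) : (forall j, f j \in S j.+1) ->
  forall i, proj i (\sum_j f j) = f i.
Proof.
move=> fS i; have [dS _ _ _] := SP.
have /directv_sum_unique/(_ (fun j => proj j (\sum_j f j)) f) := dS.
rewrite proj_sum eqxx => /(_ (fun j _ => proj_stratum j _) (fun j _ => fS j)).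
by move=> /esym/forallP/(_ i)/eqP.
Qed.

Lemma dilation_is_linear r : linear (dilation m S r).
Proof.
move=> a x y; rewrite /dilation scaler_sumr -big_split/=; apply: eq_bigr => j _.
by rewrite linearP scalerDr !scalerA mulrC.
Qed.

Lemma proj_dilation r x (i : 'I_m) : proj i (dilation m S r x) = r ^+ i.+1 *: proj i x.
Proof.
rewrite /dilation (proj_unique (f := fun j => r ^+ j.+1 *: proj j x))// => j.
by rewrite memvZ// proj_stratum.
Qed.

(** As [stratum k] is zero outside the range from 1 to [m], this also covers degrees beyond the
    step, which occur for brackets. *)
Lemma dilation_stratum r k x : x \in stratum k -> dilation m S r x = r ^+ k *: x.
Proof.
rewrite /stratum; case: ifPn => [/andP[k0 km] xS|_]; last first.
  by rewrite memv0 => /eqP ->; rewrite scaler0 /dilation big1// => j _; rewrite linear0 scaler0.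
have km' : (k.-1 < m)%N by rewrite prednK.
pose i := Ordinal km'.
have xE : x = \sum_(j < m) (if j == i then x else 0).
  by rewrite -big_mkcond/= big_pred1_eq.
have pE j : proj j x = if j == i then x else 0.
  rewrite [in LHS]xE (proj_unique (f := fun j => if j == i then x else 0))//.
  by move=> l; case: eqP => [->/=|_]; rewrite ?mem0v// prednK.
rewrite /dilation (bigD1 i)//= pE eqxx big1 ?addr0 ?prednK// => j /negbTE ji.
by rewrite pE ji scaler0.
Qed.

Lemma dilation_bracket r x y :
  br (dilation m S r x) (dilation m S r y) = dilation m S r (br x y).
Proof.
have linD := dilation_is_linear r.
pose dl : {linear V -> V} := HB.pack (dilation m S r)
  (GRing.isLinear.Build _ _ _ _ (dilation m S r) linD).
rewrite -[dilation m S r (br x y)]/(dl (br x y)).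
rewrite -[in RHS](proj_sum x) -[in RHS](proj_sum y).
rewrite [in LHS]/dilation !linear_sumlz linear_sum; apply: eq_bigr => i _.
rewrite !linear_sumr linear_sum; apply: eq_bigr => j _ /=.
rewrite linearZl_LR linearZr_LR/= scalerA -exprD.
rewrite (dilation_stratum r (k := i.+1 + j.+1))//.
apply: bracket_stratum => //; rewrite /stratum ltn_ord; exact: proj_stratum.
Qed.

Lemma dilation_bch r x y :
  bch br m (dilation m S r x) (dilation m S r y) = dilation m S r (bch br m x y).
Proof.
have linD := dilation_is_linear r.
pose dl : {linear V -> V} := HB.pack (dilation m S r)
  (GRing.isLinear.Build _ _ _ _ (dilation m S r) linD).
exact: (@bch_hom _ _ br dl m (dilation_bracket r) x y).
Qed.

End stratification.

(** * Adapted coordinates and homogeneous norms *)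

Lemma continuous_rV_linear {R : realType} {n : nat} (f : {linear 'rV[R]_n -> R^o}) :
  continuous (f : 'rV[R]_n -> R).
Proof.
pose g : 'rV[R]_n -> R := f.
have gE (x : 'rV[R]_n) : g x = \sum_i (x 0 i * g 'e_i : R).
  rewrite /g {1}(row_sum_delta x) linear_sum; apply: eq_bigr => i _.
  by rewrite linearZ.
have -> : (f : 'rV[R]_n -> R) = (fun x => \sum_i (x 0 i * g 'e_i : R)).
  by apply/funext => x; rewrite -gE.
move=> x; apply: (@cvg_bigsum _ _ _ (nbhs x)) => i; apply: cvgM; last exact: cvg_cst.
exact: (@coord_continuous _ _ _ 0 i x).
Qed.

Section adapted_coordinates.
Context {R : realType} {n : nat}.
Local Notation V := 'rV[R]_n.
Variables (br : {bilinear V -> V -> V}) (m : nat) (S : nat -> {vspace V}).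
Hypotheses (SP : is_stratification br m S).
Local Notation sumS := (\sum_(j < m) S j.+1)%VS.
Local Notation proj := (sumv_pi sumS).

Definition cidx := {j : 'I_m & 'I_(\dim (S j.+1))}.
Definition wt (p : cidx) : nat := (tag p).+1.
Definition scoord (p : cidx) (x : V) : R :=
  coord (vbasis (S (tag p).+1)) (tagged p) (proj (tag p) x).
Definition sbasis (p : cidx) : V := (vbasis (S (tag p).+1))`_(tagged p).

Lemma scoord_is_linear p : linear (scoord p : V -> R^o).
Proof. by move=> a x y; rewrite /scoord linearP linearP. Qed.

HB.instance Definition _ p := GRing.isLinear.Build R V R^o _ (scoord p : V -> R^o)
  (scoord_is_linear p).

Lemma scoord_continuous p : continuous (scoord p).
Proof. exact: (@continuous_rV_linear _ _ (scoord p : {linear V -> R^o})). Qed.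

Lemma scoordD p x y : scoord p (x + y) = scoord p x + scoord p y.
Proof. exact: (linearD (scoord p : {linear V -> R^o})). Qed.

Lemma scoordZ p a x : scoord p (a *: x) = a * scoord p x.
Proof. by rewrite /scoord linearZ linearZ. Qed.

Lemma scoord0 p : scoord p 0 = 0.
Proof. exact: (linear0 (scoord p : {linear V -> R^o})). Qed.

Lemma scoord_sum x : x = \sum_p scoord p x *: sbasis p.
Proof.
rewrite -[LHS](proj_sum SP x).
rewrite (eq_bigr (fun j : 'I_m => \sum_(i < \dim (S j.+1))
   coord (vbasis (S j.+1)) i (proj j x) *: (vbasis (S j.+1))`_i)); last first.
  by move=> j _; rewrite -coord_vbasis//; exact: memv_sum_pi.
by rewrite sig_big_dep.
Qed.

Lemma scoord_basis p q : scoord p (sbasis q) = (p == q)%:R.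
Proof.
case: p q => [j i] [k l].
have qS : sbasis (Tagged _ l : cidx) \in S k.+1.
  by apply: vbasis_mem; apply: mem_nth; rewrite size_tuple.
have pE : proj j (sbasis (Tagged _ l : cidx)) = if j == k then sbasis (Tagged _ l : cidx) else 0.
  have {1}-> : sbasis (Tagged _ l : cidx) =
     \sum_(j < m) (if j == k then sbasis (Tagged _ l : cidx) else 0).
    by rewrite -big_mkcond/= big_pred1_eq.
  rewrite (proj_unique SP (f := fun j => if j == k then _ else 0))// => h.
  by case: eqP => [->|_]; rewrite ?mem0v.
rewrite /scoord/= pE; case: eqP => [jk|jk]; last first.
  rewrite linear0; case: eqP => // -[jk']; by case: jk.
subst k; rewrite /sbasis/= coord_free; last exact: (basis_free (vbasisP _)).
by rewrite -tag_eqE /tag_eq/= eqxx/= tagged_asE eq_sym.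
Qed.

Lemma scoord_dilation p r x : scoord p (dilation m S r x) = r ^+ wt p * scoord p x.
Proof. by rewrite /scoord (proj_dilation SP) linearZ. Qed.

Lemma scoord_inj x y : (forall p, scoord p x = scoord p y) -> x = y.
Proof.
by move=> xy; rewrite (scoord_sum x) (scoord_sum y); apply: eq_bigr => p _; rewrite xy.
Qed.

Lemma norm_le_scoord x : `|x| <= \sum_p `|scoord p x| * `|sbasis p|.
Proof.
rewrite {1}(scoord_sum x); apply: (le_trans (ler_norm_sum _ _ _)).
by apply: ler_sum => p _; rewrite normrZ.
Qed.

Lemma sum_wt : (\sum_(p : cidx) wt p = \sum_(j < m) j.+1 * \dim (S j.+1))%N.
Proof.
transitivity (\sum_(j < m) \sum_(i < \dim (S j.+1)) j.+1)%N.
  by rewrite sig_big_dep.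
by apply: eq_bigr => j _; rewrite sum_nat_const card_ord mulnC.
Qed.

Lemma wt_le p : (0 < wt p <= m)%N. Proof. by rewrite /wt/=. Qed.

(* Every weight divides m`!, so this is homogeneous of degree m`! without
   fractional powers. *)
Definition gauge (x : V) : R := \sum_(p : cidx) `|scoord p x| ^+ (m`! %/ wt p).

Lemma gauge_exp_gt0 p : (0 < m`! %/ wt p)%N.
Proof.
have /andP[w0 wm] := wt_le p.
by rewrite divn_gt0// dvdn_leq ?fact_gt0// dvdn_fact// w0.
Qed.

Lemma gauge_dilation r x : 0 < r -> gauge (dilation m S r x) = r ^+ m`! * gauge x.
Proof.
move=> r0; rewrite /gauge mulr_sumr; apply: eq_bigr => p _.
rewrite scoord_dilation normrM normrX (gtr0_norm r0) exprMn -exprM; congr (_ ^+ _ * _).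
by rewrite mulnC divnK// dvdn_fact// wt_le.
Qed.

Lemma gauge_continuous : continuous gauge.
Proof.
move=> x; apply: (@cvg_bigsum _ _ _ (nbhs x)) => p.
apply: (@continuous_cvg _ _ _ (nbhs x) _ _ (fun a : R => a ^+ (m`! %/ wt p))); first exact: exprn_continuous.
by apply: cvg_norm; exact: scoord_continuous.
Qed.

Lemma scoord_le_gauge p x : `|scoord p x| ^+ (m`! %/ wt p) <= gauge x.
Proof.
by rewrite /gauge (bigD1 p)//= lerDl sumr_ge0// => q _; rewrite exprn_ge0.
Qed.

Lemma scoord_le p x M : 1 <= M -> gauge x <= M -> `|scoord p x| <= M.
Proof.
move=> M1 gM; have [l1|l1] := leP `|scoord p x| 1; first exact: le_trans M1.
apply: le_trans gM; apply: le_trans (scoord_le_gauge p x).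
by rewrite -[leLHS]expr1 ler_weXn2l ?ltW// gauge_exp_gt0.
Qed.

Lemma gauge_ge0 x : 0 <= gauge x.
Proof. by apply: sumr_ge0 => p _; rewrite exprn_ge0. Qed.

Lemma bounded_scoord (A : set V) M : (forall x, A x -> forall p, `|scoord p x| <= M) ->
  bounded_set A.
Proof.
move=> AM; exists (M * \sum_p `|sbasis p|); split; first exact: num_real.
move=> N MN x Ax /=; apply: (le_trans (norm_le_scoord x)).
apply/ltW; apply: le_lt_trans MN; rewrite mulr_sumr; apply: ler_sum => p _.
by rewrite ler_wpM2r// AM.
Qed.

Lemma compact_gauge_sphere : compact [set x | gauge x = 1].
Proof.
apply: bounded_closed_compact.
  by apply: (@bounded_scoord _ 1) => x /= gx p; apply: scoord_le => //; rewrite gx.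
apply: (@closed_comp _ _ gauge [set 1]); last exact: closed_eq.
by move=> x _; exact: gauge_continuous.
Qed.

End adapted_coordinates.

(** * Compactness and the quasi-triangle inequality *)

Section homogeneous_norm.
Context {R : realType} {n : nat}.
Local Notation V := 'rV[R]_n.
Variables (br : {bilinear V -> V -> V}) (m : nat) (S : nat -> {vspace V}).
Hypotheses (brP : is_lie_bracket br) (SP : is_stratification br m S).
Variable rho : V -> R.
Hypotheses (rho_cont : continuous rho) (rho_ge0 : forall x, 0 <= rho x).
Hypothesis rho_dil : forall t x, 0 < t -> rho (dilation m S t x) = t * rho x.
Hypothesis rho_eq0 : forall x, rho x = 0 <-> x = 0.

Lemma hnorm_sphere_lb : exists2 a : R, 0 < a & forall x, gauge m S x = 1 -> a <= rho x.
Proof.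
have [A0|/set0P A0] := eqVneq [set x | gauge m S x = 1] set0.
  exists 1 => // x gx; have : [set x | gauge m S x = 1] x by [].
  by rewrite A0.
have [c] := compact_EVT_min A0 (compact_gauge_sphere SP)
  (continuous_subspaceT rho_cont).
rewrite inE/= => gc cmin; exists (rho c).
  rewrite lt_def rho_ge0 andbT; apply/eqP => /rho_eq0 c0.
  move: gc; rewrite c0 /gauge big1 => [/esym/eqP|p _]; first by rewrite oner_eq0.
  by rewrite scoord0 normr0 expr0n gtn_eqF// gauge_exp_gt0.
by move=> x gx; apply: cmin; rewrite inE.
Qed.

(** The dilation by t = gauge(x)^(-1/m!) carries a nonzero [x] to the gauge sphere, where the norm
    is at least [a]. Hence a <= t rho(x) <= t, which bounds the gauge by a^(-m!), and with it the
    coordinates. *)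
Lemma hnorm_scoord_bounded : exists2 M : R, 0 < M &
  forall x, rho x <= 1 -> forall p : cidx m S, `|scoord p x| <= M.
Proof.
have [a a0 aP] := hnorm_sphere_lb.
have aD0 : 0 < a ^- m`! by rewrite invr_gt0 exprn_gt0.
exists (1 + a ^- m`!); first by rewrite addr_gt0.
move=> x rx p; apply: scoord_le; first by rewrite lerDl ltW.
have [g0|g0] := eqVneq (gauge m S x) 0; first by rewrite g0 addr_ge0// ltW.
have gp : 0 < gauge m S x by rewrite lt_def g0 gauge_ge0.
pose t := gauge m S x `^ (- (m`!%:R)^-1).
have t0 : 0 < t by rewrite powR_gt0.
have tD : t ^+ m`! = (gauge m S x)^-1.
  rewrite -powR_mulrn ?(ltW t0)// /t -powRrM mulNr mulVf.
    by rewrite powR_inv1// ltW.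
  by rewrite pnatr_eq0 -lt0n fact_gt0.
have : a <= t.
  have := aP (dilation m S t x); rewrite (gauge_dilation SP)// tD mulVf// => /(_ erefl).
  rewrite rho_dil// => h; apply: (le_trans h).
  by rewrite -[leRHS]mulr1 ler_pM2l.
move=> at_; have : a ^+ m`! <= t ^+ m`! by apply: lerXn2r; rewrite ?nnegrE// ltW.
rewrite tD => h; have : gauge m S x <= a ^- m`!.
  by rewrite -[leLHS]invrK lef_pV2 ?posrE ?invr_gt0 ?exprn_gt0.
by move/le_trans; apply; rewrite lerDr.
Qed.

Lemma compact_hnorm_ball : compact [set x | rho x <= 1].
Proof.
have [M M0 MP] := hnorm_scoord_bounded.
apply: bounded_closed_compact.
  by apply: (@bounded_scoord _ _ _ _ _ SP _ M) => x /= rx p; exact: MP.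
apply: (@closed_comp _ _ rho [set y | y <= 1]); last exact: closed_le.
by move=> x _; exact: rho_cont.
Qed.

Lemma bch_continuous : continuous (fun p : V * V => bch br m p.1 p.2).
Proof. by move=> p; apply: cvg_bch; [exact: cvg_fst|exact: cvg_snd]. Qed.

(** Dilating by the inverse of [rho x + rho y] brings both arguments into the compact unit ball,
    where the norm of the product has a maximum [C]; dilations are automorphisms, so homogeneity
    scales back. The constant [1 + C] is at least 1. *)
Lemma hnorm_quasi_triangle : exists2 K : R, 1 <= K &
  forall x y, rho (bch br m x y) <= K * (rho x + rho y).
Proof.
pose A := [set x | rho x <= 1].
have rho0 : rho 0 = 0 by apply/rho_eq0.
have A0 : A `*` A !=set0 by exists (0, 0); split; rewrite /A/= rho0.
have fc : continuous (fun p : V * V => rho (bch br m p.1 p.2)).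
  move=> p; apply: (@continuous_comp _ _ _ (fun p : V * V => bch br m p.1 p.2) rho).
    exact: bch_continuous.
  exact: rho_cont.
have [c _ cmax] := compact_EVT_max A0 (compact_setX compact_hnorm_ball compact_hnorm_ball)
  (continuous_subspaceT fc).
pose C := rho (bch br m c.1 c.2).
exists (1 + C); first by rewrite lerDl rho_ge0.
move=> x y; have [t0|tn0] := eqVneq (rho x + rho y) 0.
  have /rho_eq0 -> : rho x = 0 by have := rho_ge0 x; have := rho_ge0 y; lra.
  have /rho_eq0 -> : rho y = 0 by have := rho_ge0 x; have := rho_ge0 y; lra.
  by rewrite bch00 rho0 addr0 mulr0.
set t := rho x + rho y in tn0 *.
have tp : 0 < t by rewrite lt_def tn0 addr_ge0.
have ti : 0 < t^-1 by rewrite invr_gt0.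
have xA : rho (dilation m S t^-1 x) <= 1.
  by rewrite rho_dil// mulrC ler_pdivrMr// mul1r lerDl.
have yA : rho (dilation m S t^-1 y) <= 1.
  by rewrite rho_dil// mulrC ler_pdivrMr// mul1r lerDr.
have := cmax (dilation m S t^-1 x, dilation m S t^-1 y); rewrite inE => /(_ (conj xA yA)) /=.
rewrite (dilation_bch brP SP) rho_dil// mulrC ler_pdivrMr// -/C => h.
by apply: (le_trans h); rewrite ler_pM2r// lerDr.
Qed.

End homogeneous_norm.

(** * Haar measure in exponential coordinates *)

Section borel.
Context {T : ptopologicalType} {R : realType}.

Lemma measurable_open (U : set T) : open U -> measurable (U : set (borel T)).
Proof. exact: sub_sigma_algebra. Qed.

Lemma measurable_closed (U : set T) : closed U -> measurable (U : set (borel T)).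
Proof.
by move=> cU; rewrite -[U]setCK; apply: measurableC; apply: measurable_open; exact: closed_openC.
Qed.

Lemma continuous_measurable_borel (f : T -> R) : continuous f ->
  measurable_fun setT (f : borel T -> R).
Proof.
move=> cf; apply: (measurability _ (RGenOInfty.measurableE R)) => // _ [_ [a ->] <-].
rewrite setTI; apply: measurable_open; rewrite set_itvoy; apply: open_comp; last exact: open_gt.
by move=> x _; exact: cf.
Qed.

Lemma continuous_measurable_map (f : T -> T) : continuous f ->
  measurable_fun setT (f : borel T -> borel T).
Proof.
move=> cf; apply: (@measurability _ _ (borel T) (borel T) setT f (@open T)) => // _ [U oU <-].
rewrite setTI; apply: measurable_open; apply: open_comp => // x _; exact: cf.
Qed.
End borel.

Section haar_log.
Context {R : realType} (G : stratifiedLieGroup R).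
Local Notation n := (slg_dim G).
Local Notation V := 'rV[R]_n.
Local Notation exp := (@slg_exp R G).
Local Notation log := (@slg_log R G).
Local Notation m := (slg_step G).
Local Notation S := (slg_stratum G).
Variable mu : {measure set (borel G) -> \bar R}.
Hypothesis muP : is_haar mu.

Lemma norm_entry (x : V) i : `|x 0 i| <= `|x|.
Proof. by rewrite [leRHS]mx_normrE; exact: (le_bigmax _ _ (0, i)). Qed.

Definition box (a b : V) : set V := [set x | forall i, a 0 i <= x 0 i <= b 0 i].

Lemma image_expE (A : set V) : exp @` A = log @^-1` A.
Proof.
apply/seteqP; split => [_ [x Ax <-]|g Ag /=]; first by rewrite /preimage/= slg_expK.
by exists (log g) => //; rewrite slg_logK.
Qed.

Lemma closed_box a b : closed (box a b).
Proof.
rewrite (_ : box a b = \bigcap_(i : 'I_n) ((fun x : V => x 0 i) @^-1` `[a 0 i, b 0 i])).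
  apply: closed_bigI => i _; apply: closed_comp; last exact: interval_closed.
  by move=> x _; exact: coord_continuous.
apply/seteqP; split => x /=; first by move=> xab i _ /=; rewrite in_itv/=; exact: xab.
by move=> xab i; have := xab i I; rewrite /preimage/= in_itv.
Qed.

Lemma measurable_exp_closed (A : set V) : closed A -> measurable (exp @` A : set (borel G)).
Proof.
move=> oA; rewrite image_expE; apply: measurable_closed; apply: closed_comp => // x _.
exact: slg_log_continuous.
Qed.

Definition exp_boxes : set (set G) := [set A | exists a b, A = exp @` box a b].

Lemma setI_exp_boxes : setI_closed exp_boxes.
Proof.
move=> _ _ [a [b ->]] [a' [b' ->]].
exists (\row_i Num.max (a 0 i) (a' 0 i)), (\row_i Num.min (b 0 i) (b' 0 i)).
rewrite !image_expE -preimage_setI; congr (_ @^-1` _).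
apply/seteqP; split => x /=.
  move=> [xab xab'] i; rewrite !mxE ge_max le_min.
  by have /andP[-> ->] := xab i; have /andP[-> ->] := xab' i.
move=> xab; split => i; have := xab i; rewrite !mxE ge_max le_min.
  by move=> /andP[/andP[-> _] /andP[-> _]].
by move=> /andP[/andP[_ ->] /andP[_ ->]].
Qed.

(** Boxes are where [is_haar] prescribes the measure, so uniqueness of measures requires them to
    generate the Borel sets. An open set is the union of the boxes with rational centre and
    half-side that it contains. *)
Lemma sigma_exp_boxes : @measurable _ (borel G) = <<s exp_boxes >>.
Proof.
apply/seteqP; split.
  apply: smallest_sub; first exact: smallest_sigma_algebra.
  move=> U oU.
  pose F (qe : 'rV[rat]_n * rat) := let c := map_mx ratr qe.1 : V in
    let e := const_mx (ratr qe.2) : V in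
    if `[< exp @` box (c - e) (c + e) `<=` U >] then exp @` box (c - e) (c + e) else set0.
  rewrite (_ : U = \bigcup_qe F qe); last first.
    apply/seteqP; split => g; last first.
      by move=> [qe _]; rewrite /F; case: asboolP => // h /h.
    move=> Ug.
    have : nbhs (log g) (exp @^-1` U).
      apply: slg_exp_continuous; rewrite slg_logK; exact: open_nbhs_nbhs.
    move=> /nbhs_ballP[e /= e0 eU].
    have e20 : 0 < e / 2 by rewrite divr_gt0.
    (* With half-side [q] below [e / 2] and centre within [q] of [log g], the box contains [log g]
       and stays in the ball of radius [e]. *)
    have [q] := rat_in_itvoo e20; rewrite in_itv/= => /andP[q0 qe].
    have /choice[c cP] : forall i : 'I_n, exists c : rat, log g 0 i - ratr q < ratr c < log g 0 i + ratr q.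
      move=> i; have : log g 0 i - ratr q < log g 0 i + ratr q by lra.
      by move=> /rat_in_itvoo[c]; rewrite in_itv/= => cP; exists c.
    exists (\row_i c i, q) => //; rewrite /F/=.
    case: asboolP => [_|]; last first.
      move=> H; exfalso; apply: H => _ [x xb <-]; apply: eU; split => // i j.
      rewrite ord1; have := xb j; rewrite !mxE => /andP[x1 x2].
      have /andP[c1 c2] := cP j.
      by rewrite /ball/= ltr_norml; apply/andP; split; lra.
    exists (log g); last exact: slg_logK.
    by move=> i; rewrite !mxE; have /andP[c1 c2] := cP i; apply/andP; split; lra.
  have [_ _ bc] := @smallest_sigma_algebra _ setT exp_boxes.
  have F0 qe : <<s exp_boxes >> (F qe).
    rewrite /F; case: ifP => _; last first.
      by have [+ _ _] := @smallest_sigma_algebra _ setT exp_boxes.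
    by apply: sub_sigma_algebra; eexists; eexists.
  pose F' k := if (unpickle k : option ('rV[rat]_n * rat)) is Some qe then F qe else set0.
  rewrite (_ : \bigcup_qe F qe = \bigcup_k F' k).
    apply: bc => k; rewrite /F'; case: unpickle => //.
    by have [+ _ _] := @smallest_sigma_algebra _ setT exp_boxes.
  apply/seteqP; split => g [i _ gi]; first by exists (pickle i) => //; rewrite /F' pickleK.
  by move: gi; rewrite /F'; case: unpickle => // qe gqe; exists qe.
apply: smallest_sub; first exact: sigma_algebra_measurable.
move=> _ [a [b ->]]; by apply: measurable_exp_closed; exact: closed_box.
Qed.

(** Addition in the Lie algebra, not multiplication in the group. *)
Definition translate (v : V) (g : G) : G := exp (log g + v).

Lemma continuous_translate v : continuous (translate v).
Proof.
move=> g; rewrite /translate.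
apply: (@continuous_comp _ _ _ (fun g => log g + v) exp); last exact: slg_exp_continuous.
apply: cvgD; last exact: cvg_cst.
exact: slg_log_continuous.
Qed.

Lemma exp_box_measure (a b : V) : (forall i, a 0 i <= b 0 i) ->
  mu (exp @` box a b) = (\prod_i (b 0 i - a 0 i))%:E.
Proof. exact: (haar_lebesgue muP). Qed.

(** The pushforward and [mu] agree on boxes, a generating family stable under intersection that
    exhausts the group by sets of finite measure. *)
Lemma translate_measure v (A : set (borel G)) : measurable A ->
  mu (translate v @^-1` A) = mu A.
Proof.
move=> mA.
have mt : measurable_fun setT (translate v : borel G -> borel G).
  by apply: continuous_measurable_map; exact: continuous_translate.
pose m2 : {measure set (borel G) -> \bar R} :=
  measure_function_pushforward__canonical__measure_function_Measure mu mt.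
(* The Lebesgue formula does not cover boxes with a reversed side; these are empty. *)
have box0 (a b : V) (i : 'I_n) : b 0 i < a 0 i -> exp @` box a b = set0.
  move=> ba; apply/seteqP; split => // g [x /(_ i) + _] => /andP[x1 x2].
  by have := le_trans x1 x2; rewrite leNgt ba.
have eqb B : exp_boxes B -> m2 B = mu B.
  move=> [a [b ->]].
  have -> : m2 (exp @` box a b) = mu (exp @` box (a - v) (b - v)).
    rewrite /m2 /pushforward/= !image_expE; congr (mu _).
    apply/seteqP; split => g /=; rewrite /translate slg_expK => gab i; have := gab i;
      rewrite !mxE => /andP[h1 h2]; apply/andP; split; lra.
  have [ab|] := pselect (forall i, a 0 i <= b 0 i).
    rewrite !exp_box_measure//; last by move=> i; rewrite !mxE lerB.
    congr (_%:E); apply: eq_bigr => i _; rewrite !mxE; ring.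
  move=> /existsNP[i /negP]; rewrite -ltNge => ba.
  rewrite (box0 _ _ i ba) (box0 _ _ i)//.
  by rewrite !mxE ltrD2r.
apply: (@measure_unique _ R (borel G) exp_boxes
  (fun k => exp @` box (const_mx (- k%:R)) (const_mx k%:R)) sigma_exp_boxes
  setI_exp_boxes _ _ m2 mu eqb) => //.
- by move=> k; eexists; eexists.
- apply/seteqP; split => // g _.
  exists (Num.truncn `|log g|).+1 => //; rewrite image_expE => i /=; rewrite !mxE.
  rewrite -ler_norml; apply/ltW; apply: le_lt_trans (truncnS_gt _).
  exact: norm_entry.
- move=> k; rewrite eqb; last by eexists; eexists.
  rewrite exp_box_measure ?ltry// => i; rewrite !mxE.
  by rewrite lerNl (le_trans _ (ler0n _ _))// oppr_le0.
Qed.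

Local Notation cidx := (cidx m S).
Let SP := @slg_stratumP R G.

(** Half-open sides, so that two adjacent copies tile a doubled parallelepiped without overlap. *)
Definition pbox (lo len : cidx -> R) : set V :=
  [set x | forall p, lo p <= scoord p x < lo p + len p].

Lemma measurable_pbox lo len : measurable (exp @` pbox lo len : set (borel G)).
Proof.
rewrite image_expE (_ : _ @^-1` _ = \bigcap_p ((fun g => scoord p (log g)) @^-1`
    [set` `[lo p, lo p + len p[%R])); last first.
  apply/seteqP; split => g /= H p; first by move=> _ /=; rewrite in_itv/=; exact: H.
  by have := H p I; rewrite /= in_itv.
apply: fin_bigcap_measurable => [|p _]; first exact: finite_finset.
have mf : measurable_fun setT ((fun g => scoord p (log g)) : borel G -> R).
  apply: continuous_measurable_borel => g.
  apply: (@continuous_comp _ _ _ log (scoord p)); first exact: slg_log_continuous.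
  exact: scoord_continuous.
by rewrite -[X in measurable X]setTI; apply: mf.
Qed.

Lemma pbox_translate lo len :
  mu (exp @` pbox lo len) = mu (exp @` pbox (fun=> 0) len).
Proof.
pose v : V := \sum_p lo p *: sbasis p.
have vE p : scoord p v = lo p.
  rewrite /v; have -> : scoord p (\sum_q lo q *: sbasis q) = \sum_q lo q * scoord p (sbasis q).
    elim: (index_enum _) => [|q s IH]; first by rewrite !big_nil scoord0.
    by rewrite !big_cons scoordD scoordZ IH.
  under eq_bigr do rewrite (scoord_basis SP).
  rewrite (bigD1 p)//= eqxx mulr1 big1 ?addr0// => q /negbTE qp.
  by rewrite eq_sym qp mulr0.
rewrite -[LHS](translate_measure v); last exact: measurable_pbox.
congr (mu _); rewrite !image_expE; apply/seteqP; split => g /= H p; have := H p;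
  rewrite /translate slg_expK scoordD vE => /andP[h1 h2]; apply/andP; split; lra.
Qed.

Definition pvol (len : cidx -> R) : \bar R := mu (exp @` pbox (fun=> 0) len).

Lemma pvol_double (len : cidx -> R) q : (forall p, 0 < len p) ->
  pvol (fun p => if p == q then 2 * len p else len p) = (2%:E * pvol len)%E.
Proof.
move=> l0; pose lo p := if p == q then len p else 0.
rewrite (_ : 2%:E * pvol len = mu (exp @` pbox (fun=> 0%R) len) + mu (exp @` pbox lo len))%E.
  rewrite -measureU; [|exact: measurable_pbox|exact: measurable_pbox|].
    rewrite /pvol -image_setU; congr (mu (_ @` _)).
    apply/seteqP; split => x /=.
      move=> H; have [xq|xq] := ltP (scoord q x) (len q); [left|right] => p.
        have := H p; case: eqP => [->|_]//.
        by move=> /andP[-> _]; rewrite add0r.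
      rewrite /lo; have := H p; case: eqP => [->|_]//.
      by move=> /andP[_ h]; rewrite xq/=; lra.
    move=> [H|H] p; have := H p; rewrite /lo; have lp := l0 p; case: eqP => [_|_]//.
      by move=> /andP[-> h]/=; lra.
    by move=> /andP[h1 h2]; apply/andP; split; lra.
  rewrite !image_expE; apply/seteqP; split => // g /= [/(_ q) + /(_ q)].
  by rewrite /lo eqxx add0r => /andP[_ h] /andP[h' _]; move: h; rewrite ltNge h'.
by rewrite (pbox_translate lo) -mule2n mule_natl.
Qed.

Lemma pvol_double_iter (len : cidx -> R) q k : (forall p, 0 < len p) ->
  pvol (fun p => if p == q then 2 ^+ k * len p else len p) = ((2 ^+ k)%:E * pvol len)%E.
Proof.
move=> l0; elim: k => [|k IH].
  rewrite expr0 mul1e; congr pvol; apply/funext => p.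
  by rewrite mul1r if_same.
rewrite exprS EFinM -muleA -IH -(pvol_double q).
  by congr pvol; apply/funext => p; case: eqP => // _; rewrite mulrA.
by move=> p; case: ifP => // _; rewrite mulr_gt0 ?exprn_gt0.
Qed.

(** The side of index p is doubled [wt p] times, one index after another; the weights sum to the
    homogeneous dimension. *)
Lemma pvol_dilation2 (len : cidx -> R) : (forall p, 0 < len p) ->
  pvol (fun p => 2 ^+ wt p * len p) = ((2 ^+ hom_dim G)%:E * pvol len)%E.
Proof.
move=> l0.
have H (s : seq cidx) : uniq s ->
    pvol (fun p => if p \in s then 2 ^+ wt p * len p else len p) =
    ((2 ^+ (\sum_(p <- s) wt p))%:E * pvol len)%E.
  elim: s => [_|q s IH /= /andP[qs us]]; first by rewrite big_nil expr0 mul1e.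
  rewrite big_cons exprD EFinM -muleA -IH// -(pvol_double_iter q).
    congr pvol; apply/funext => p; rewrite inE.
    by case: eqP => [->|_]//=; rewrite (negbTE qs).
  by move=> p; case: ifP => // _; rewrite mulr_gt0 ?exprn_gt0.
have := H (enum {: cidx}) (enum_uniq _).
rewrite big_enum/= sum_wt => <-; congr pvol; apply/funext => p.
by rewrite mem_enum.
Qed.

End haar_log.

(** Meant for the scales at which volumes scale exactly: every radius is within a factor 2 of one of
    them. *)
Lemma dyadic_induction {R : realType} (P : R -> Prop) :
  P 1 -> (forall s, 0 < s -> P s -> P (2 * s)) -> (forall s, 0 < s -> P s -> P (s / 2)) ->
  forall r, 0 < r -> exists s, [/\ 0 < s, P s, s <= r & r <= 2 * s].
Proof.
move=> P1 P2 Ph.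
have two_gt (r : R) : exists n, r <= 2 ^+ n.
  exists (Num.truncn `|r|).+1; apply: (le_trans (ler_norm r)).
  apply: (le_trans (ltW (truncnS_gt _))).
  by rewrite -natrX ler_nat ltnW// ltn_expl.
have up n : forall r, 1 <= r -> r <= 2 ^+ n -> exists s, [/\ 0 < s, P s, s <= r & r <= 2 * s].
  elim: n => [|n IH] r r1 rn.
    by exists 1; split => //; move: rn; rewrite expr0; lra.
  have [r2|r2] := leP r 2; first by exists 1; split => //; lra.
  have [||s [s0 Ps sr rs]] := IH (r / 2); first by lra.
    by rewrite ler_pdivrMr// mulrC -exprS.
  by exists (2 * s); split; [lra|exact: P2|lra|lra].
have dn n : forall r, 0 < r -> r <= 1 -> 1 <= r * 2 ^+ n ->
    exists s, [/\ 0 < s, P s, s <= r & r <= 2 * s].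
  elim: n => [|n IH] r r0 r1 rn.
    by exists 1; split => //; move: rn; rewrite expr0; lra.
  have [r2|r2] := leP 1 (2 * r).
    by exists (1 / 2); split; [lra|exact: Ph|lra|lra].
  have [|||s [s0 Ps sr rs]] := IH (2 * r); [lra|lra| |].
    by move: rn; rewrite exprS mulrCA mulrA.
  by exists (s / 2); split; [lra|exact: Ph|lra|lra].
move=> r r0; have [r1|r1] := leP 1 r.
  by have [n rn] := two_gt r; exact: (up n).
have [n rn] := two_gt r^-1.
apply: (dn n) => //; first exact: ltW.
by rewrite -(ler_pM2l r0) mulfV ?gt_eqF// in rn.
Qed.

(** * The group as a quasi-metric space *)

Section stratified_group_ahlfors.
Context {R : realType} (G : stratifiedLieGroup R).
Local Notation n := (slg_dim G).
Local Notation V := 'rV[R]_n.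
Local Notation exp := (@slg_exp R G).
Local Notation log := (@slg_log R G).
Local Notation m := (slg_step G).
Local Notation S := (slg_stratum G).
Local Notation cidx := (cidx m S).
Variable rho : G -> R.
Hypothesis rhoP : is_homogeneous_norm rho.
Variable mu : {measure set (borel G) -> \bar R}.
Hypothesis muP : is_haar mu.
Let brP := @slg_bracketP R G.
Let SP := @slg_stratumP R G.

Definition log_norm (x : V) := rho (exp x).

Lemma slg_exp0 : exp 0 = 1%g :> G.
Proof.
have h : (exp 0 * exp 0 = exp 0 * 1 :> G)%g by rewrite slg_expM bch00 mulg1.
exact: (mulgI _ _ _ h).
Qed.

Lemma log_norm_continuous : continuous log_norm.
Proof.
move=> x; apply: (@continuous_comp _ _ _ exp rho); first exact: slg_exp_continuous.
exact: (hnorm_continuous rhoP).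
Qed.

Lemma log_norm_ge0 x : 0 <= log_norm x. Proof. exact: (hnorm_ge0 rhoP). Qed.

Lemma log_norm_dilation t x : 0 < t -> log_norm (dilation m S t x) = t * log_norm x.
Proof.
move=> t0; rewrite /log_norm -(hnorm_dilation rhoP _ t0) /gdilation.
by rewrite slg_expK.
Qed.

Lemma log_norm_eq0 x : log_norm x = 0 <-> x = 0.
Proof.
rewrite /log_norm (hnorm_eq0 rhoP) -slg_exp0; split => [|->//].
exact: (can_inj (@slg_expK R G)).
Qed.

(** The structure [ptopGroupType] does not relate product and topology; continuity comes from the
    Baker-Campbell-Hausdorff formula. *)
Lemma mulg_left_continuous (a : G) : continuous (fun g : G => (a * g)%g).
Proof.
have -> : (fun g : G => (a * g)%g) = (fun g => exp (bch (slg_bracket G) m (log a) (log g))).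
  by apply/funext => g; rewrite -slg_expM !slg_logK.
move=> g; apply: (@continuous_comp _ _ _
  (fun g => bch (slg_bracket G) m (log a) (log g)) exp); last exact: slg_exp_continuous.
apply: cvg_bch; [exact: cvg_cst|exact: slg_log_continuous].
Qed.

(** With this order of the arguments, [qball hdist] is convertible to [gball], and [comm_op] to
    [maximal_commutator]. *)
Definition hdist (x y : G) : R := rho (x^-1 * y)%g.

Lemma hdist_continuous x : continuous (hdist x).
Proof.
move=> y; apply: (@continuous_comp _ _ _ (fun y : G => (x^-1 * y)%g) rho).
  exact: mulg_left_continuous.
exact: (hnorm_continuous rhoP).
Qed.

Lemma hdist_sym x y : hdist x y = hdist y x.
Proof. by rewrite /hdist -(hnormV rhoP) invgM invgK. Qed.

Lemma hdist_eq0 x y : hdist x y = 0 <-> x = y.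
Proof.
rewrite /hdist (hnorm_eq0 rhoP); split => [h|->]; last exact: mulVg.
by apply: (mulgI x^-1%g); rewrite h mulVg.
Qed.

Lemma hdist_quasi_triangle : exists2 K : R, 1 <= K &
  forall x y z, hdist x z <= K * (hdist x y + hdist y z).
Proof.
have [K K1 KP] := hnorm_quasi_triangle brP SP log_norm_continuous log_norm_ge0
  log_norm_dilation log_norm_eq0.
exists K => // x y z; rewrite /hdist.
have -> : (x^-1 * z = (x^-1 * y) * (y^-1 * z))%g by rewrite -mulgA mulVKg.
rewrite -[(x^-1 * y)%g]slg_logK -[(y^-1 * z)%g]slg_logK slg_expM.
exact: KP.
Qed.

Lemma qball_hdistE z r : qball hdist z r = [set y | hdist z y < r].
Proof. by apply/seteqP; split => y; rewrite /qball/= hdist_sym. Qed.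

Lemma open_qball z r : open (qball hdist z r).
Proof.
rewrite qball_hdistE; apply: (@open_comp _ _ (hdist z) [set y | y < r]); last exact: open_lt.
by move=> y _; exact: hdist_continuous.
Qed.

Lemma qball_translate z r : qball hdist z r = [set (z * y)%g | y in qball hdist 1%g r].
Proof.
rewrite !qball_hdistE; apply/seteqP; split => [y /= yr|_ [y /= yr <-]].
  exists (z^-1 * y)%g; last by rewrite mulVKg.
  by move: yr; rewrite /hdist invg1 mul1g.
by move: yr; rewrite /hdist invg1 mul1g mulKg.
Qed.

Lemma qball_measure_translate z r : mu (qball hdist z r) = mu (qball hdist 1%g r).
Proof.
rewrite qball_translate; apply: (haar_left_invariant muP).
exact: measurable_open (open_qball _ _).
Qed.

Lemma qball1E r : qball hdist 1%g r = exp @` [set x | log_norm x < r].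
Proof.
rewrite qball_hdistE image_expE; apply/seteqP; split => y /=;
  by rewrite /hdist /log_norm slg_logK invg1 mul1g.
Qed.

(** The points are exponentials of rational vectors, with the vector 0 for integers that code none;
    continuity of [hdist y] gives the convergence. *)
Lemma hdist_separable : exists zs : nat -> G, forall z, exists phi : nat -> nat,
  forall y, hdist y (zs (phi k)) @[k --> \oo] --> hdist y z.
Proof.
exists (fun k => exp (if (unpickle k : option 'rV[rat]_n) is Some c then map_mx ratr c else 0)) => z.
have /choice[c cP] : forall k : nat, exists c : 'rV[rat]_n,
    forall i, `|log z 0 i - ratr (c 0 i)| < k.+1%:R^-1.
  move=> k; have /choice[c cP] : forall i : 'I_n, exists c : rat, `|log z 0 i - ratr c| < k.+1%:R^-1.
    have : 0 < k.+1%:R^-1 :> R by [].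
    move: (k.+1%:R^-1) => e e0 i; have : log z 0 i - e < log z 0 i + e by lra.
    move=> /rat_in_itvoo[c]; rewrite in_itv/= => /andP[c1 c2]; exists c.
    by rewrite ltr_norml; apply/andP; split; lra.
  by exists (\row_i c i) => i; rewrite mxE.
exists (fun k => pickle (c k)) => y.
under eq_fun do rewrite pickleK.
have cz : map_mx ratr (c k) @[k --> \oo] --> log z.
  apply/cvg_ballP => e e0; near=> k; split => // i j; rewrite ord1 mxE /ball/=.
  apply: (lt_trans (cP k j)).
  by near: k; apply: (near_infty_natSinv_lt (PosNum e0)).
have := continuous_cvg _ (@hdist_continuous y z) _ => /(_ nat \oo _ (fun k => exp (map_mx ratr (c k)))).
apply; rewrite -[z in _ --> z]slg_logK.
apply: (@continuous_cvg _ _ _ _ _ _ exp) => //.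
exact: slg_exp_continuous.
Unshelve. all: by end_near.
Qed.

End stratified_group_ahlfors.

(** * Volume of balls *)

Section ball_volume.
Context {R : realType} (G : stratifiedLieGroup R).
Local Notation n := (slg_dim G).
Local Notation V := 'rV[R]_n.
Local Notation exp := (@slg_exp R G).
Local Notation m := (slg_step G).
Local Notation S := (slg_stratum G).
Local Notation cidx := (cidx m S).
Variable rho : G -> R.
Hypothesis rhoP : is_homogeneous_norm rho.
Variable mu : {measure set (borel G) -> \bar R}.
Hypothesis muP : is_haar mu.
Let SP := @slg_stratumP R G.
Local Notation lnorm := (log_norm rho).
Local Notation Q := (hom_dim G).

(** All weights are at least 1, so [Q = 0] would leave no adapted coordinate and make the algebra
    trivial. *)
Lemma hom_dim_gt0 : (0 < Q)%N.
Proof.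
rewrite lt0n; apply/eqP => Q0.
have no (p : cidx) : False.
  have : (\sum_(q : cidx) wt q = 0)%N by rewrite sum_wt.
  by move=> /eqP; rewrite sum_nat_eq0 => /forallP/(_ p).
pose i0 := Ordinal (slg_dim_gt0 G).
have : ('e_i0 : V) = 0 by apply: (scoord_inj SP) => p; case: (no p).
move=> /matrixP/(_ 0 i0); rewrite !mxE !eqxx => /eqP.
by rewrite oner_eq0.
Qed.

Lemma pvol_fin_num (a : R) : 0 < a -> pvol mu (fun=> a) \is a fin_num.
Proof.
move=> a0; rewrite ge0_fin_numE//.
pose c : R := a * \sum_(p : cidx) `|sbasis p|.
have c0 : 0 <= c by rewrite mulr_ge0 ?sumr_ge0// ltW.
apply: (@le_lt_trans _ _ (mu (exp @` box (const_mx (- c)) (const_mx c)))); last first.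
  by rewrite (exp_box_measure muP) ?ltry// => i; rewrite !mxE; lra.
apply: le_measure; rewrite ?inE.
- exact: measurable_pbox.
- by apply: measurable_exp_closed; exact: closed_box.
- apply: image_subset => x xa i; rewrite !mxE -ler_norml.
  apply: (le_trans (norm_entry _ _)); apply: (le_trans (norm_le_scoord SP x)).
  rewrite /c mulr_sumr; apply: ler_sum => p _; apply: ler_wpM2r => //.
  by have /andP[h1 h2] := xa p; rewrite ger0_norm// -[a]add0r ltW.
Qed.

Lemma pvol_gt0 (a : R) : 0 < a -> (0 < pvol mu (fun=> a))%E.
Proof.
move=> a0.
(* [W] bounds the adapted coordinates of the standard basis, so on the box of half-side [d] they are
   at most [a / 4], inside the centred parallelepiped of side [a]. *)
pose W : R := 1 + \sum_(p : cidx) \sum_i `|scoord p ('e_i : V)|.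
have W0 : 0 < W by rewrite ltr_pwDl// !sumr_ge0// => p _; rewrite sumr_ge0.
pose d := a / 4 / W.
have d0 : 0 < d by rewrite !divr_gt0.
rewrite /pvol -(pbox_translate muP (fun=> - (a / 2))).
apply: (@lt_le_trans _ _ (mu (exp @` box (const_mx (- d)) (const_mx d)))).
  rewrite (exp_box_measure muP); last by move=> i; rewrite !mxE; lra.
  by rewrite lte_fin; apply: prodr_gt0 => i _; rewrite !mxE; lra.
apply: le_measure; rewrite ?inE.
- by apply: measurable_exp_closed; exact: closed_box.
- exact: measurable_pbox.
- apply: image_subset => x xd p.
  have xp : `|scoord p x| <= a / 4.
    have -> : scoord p x = \sum_i x 0 i * scoord p ('e_i : V).
      rewrite {1}(row_sum_delta x).
      elim: (index_enum _) => [|i s IH]; first by rewrite !big_nil scoord0.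
      by rewrite !big_cons scoordD scoordZ IH.
    apply: (le_trans (ler_norm_sum _ _ _)).
    apply: (@le_trans _ _ (\sum_i d * `|scoord p ('e_i : V)|)).
      apply: ler_sum => i _; rewrite normrM; apply: ler_wpM2r => //.
      by rewrite ler_norml; have := xd i; rewrite !mxE.
    rewrite -mulr_sumr /d mulrAC ler_pdivrMr// ler_pM2l; last by rewrite divr_gt0.
    rewrite /W (bigD1 p)//= addrCA lerDl addr_ge0// sumr_ge0// => q _.
    by rewrite sumr_ge0.
  by move: xp; rewrite ler_norml => /andP[h1 h2]; apply/andP; split; lra.
Qed.

(** All side lengths are allowed, so that the law can be composed with the one for the factor 2. *)
Definition good_scale (s : R) := forall len : cidx -> R, (forall p, 0 < len p) ->
  pvol mu (fun p => s ^+ wt p * len p) = ((s ^+ Q)%:E * pvol mu len)%E.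

Lemma good_scale1 : good_scale 1.
Proof.
move=> len l0; rewrite expr1n mul1e; congr pvol; apply/funext => p.
by rewrite expr1n mul1r.
Qed.

Lemma good_scale_double s : 0 < s -> good_scale s -> good_scale (2 * s).
Proof.
move=> s0 gs len l0.
have -> : (fun p => (2 * s) ^+ wt p * len p) = (fun p => 2 ^+ wt p * (s ^+ wt p * len p)).
  by apply/funext => p; rewrite exprMn mulrA.
rewrite (pvol_dilation2 muP) ?gs//; last by move=> p; rewrite mulr_gt0 ?exprn_gt0.
by rewrite muleA -EFinM -exprMn.
Qed.

Lemma good_scale_half s : 0 < s -> good_scale s -> good_scale (s / 2).
Proof.
move=> s0 gs len l0.
have l'0 p : 0 < (s / 2) ^+ wt p * len p by rewrite mulr_gt0// exprn_gt0// divr_gt0.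
have h := pvol_dilation2 muP l'0.
have E : (fun p => 2 ^+ wt p * ((s / 2) ^+ wt p * len p)) = (fun p => s ^+ wt p * len p).
  have e2 : 2 * (s / 2) = s by lra.
  by apply/funext => p; rewrite mulrA -exprMn e2.
rewrite E gs// in h.
have two : (2 ^- Q * 2 ^+ Q = 1 :> R) by rewrite mulVf// expf_neq0.
set u := pvol mu (fun p => (s / 2) ^+ wt p * len p) in h *.
transitivity ((2 ^- Q)%:E * ((2 ^+ Q)%:E * u))%E.
  by rewrite muleA -EFinM two mul1e.
by rewrite -h muleA -EFinM mulrC -expr_div_n.
Qed.

(** The ball lies between two dilated parallelepipeds centred at the origin, whose volumes scale
    exactly. The inner one comes from continuity of the norm at 0, the outer one from the bound on
    coordinates in the unit ball. *)
Lemma sublevel_measure : exists a A : R, [/\ 0 < a, 0 < A &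
  forall s, 0 < s -> good_scale s ->
  ((a * s ^+ Q)%:E <= mu (qball (hdist rho) 1%g s) <= (A * s ^+ Q)%:E)%E].
Proof.
have [M M0 MP] := hnorm_scoord_bounded SP (log_norm_continuous rhoP)
  (log_norm_ge0 rhoP) (log_norm_dilation rhoP) (log_norm_eq0 rhoP).
have : nbhs (0 : V) [set x | lnorm x < 1].
  apply: (@log_norm_continuous _ _ _ rhoP 0 [set y | y < 1]).
  apply: open_nbhs_nbhs; split; first exact: open_lt.
  by rewrite /= ((log_norm_eq0 rhoP 0).2 erefl).
move=> /nbhs_ballP[e /= e0]; rewrite -ball_normE => eP.
pose E : R := 1 + \sum_(p : cidx) `|sbasis p|.
have E0 : 0 < E by rewrite ltr_pwDl// sumr_ge0.
pose d := e / 2 / E.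
have d0 : 0 < d by rewrite !divr_gt0.
have dP x : (forall p : cidx, `|scoord p x| <= d) -> lnorm x < 1.
  move=> xd; apply: eP; rewrite /ball_/= sub0r normrN.
  apply: (le_lt_trans (norm_le_scoord SP x)).
  apply: (@le_lt_trans _ _ (\sum_p d * `|sbasis p : V|)).
    by apply: ler_sum => p _; apply: ler_wpM2r.
  rewrite -mulr_sumr /d mulrAC ltr_pdivrMr//.
  have SE : \sum_(p : cidx) `|sbasis p| <= E by rewrite /E lerDr.
  apply: (@le_lt_trans _ _ (e / 2 * E)); first by rewrite ler_pM2l// divr_gt0.
  by rewrite ltr_pM2r//; lra.
have f2 : pvol mu (fun=> d * 2) \is a fin_num by rewrite pvol_fin_num// mulr_gt0.
have f4 : pvol mu (fun=> M * 4) \is a fin_num by rewrite pvol_fin_num// mulr_gt0.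
exists (fine (pvol mu (fun=> d * 2))), (fine (pvol mu (fun=> M * 4))); split.
- by rewrite -lte_fin fineK// pvol_gt0// mulr_gt0.
- by rewrite -lte_fin fineK// pvol_gt0// mulr_gt0.
move=> s s0 gs; rewrite !(mulrC _ (s ^+ _)) !EFinM !fineK//.
rewrite -!gs; [|by move=> p; rewrite mulr_gt0..].
rewrite qball1E// /pvol -(pbox_translate muP (fun p => - (s ^+ wt p * d))).
(* The outer half-side uses [M * 2] instead of [M] because the parallelepiped excludes its upper
   faces. *)
rewrite -(pbox_translate muP (fun p => - (s ^+ wt p * (M * 2)))).
have si0 : 0 < s^-1 by rewrite invr_gt0.
have mU : measurable (exp @` [set x | lnorm x < s] : set (borel G)).
  by rewrite -(qball1E rhoP); apply: measurable_open; exact: open_qball.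
have sc p x : scoord (p : cidx) (dilation m S s^-1 x) = s ^- wt p * scoord p x.
  by rewrite (scoord_dilation SP) exprVn.
have ssc x : lnorm (dilation m S s^-1 x) = lnorm x / s.
  by rewrite (log_norm_dilation rhoP)// mulrC.
apply/andP; split; apply: le_measure; rewrite ?inE//; try exact: measurable_pbox.
- apply: image_subset => x xs /=.
  rewrite -(@ltr_pM2r _ s^-1)// mulfV ?gt_eqF// -ssc; apply: dP => p.
  have /andP[h1 h2] := xs p; have sp : 0 < s ^+ wt p by rewrite exprn_gt0.
  rewrite sc mulrC normrM [X in _ * X]gtr0_norm ?invr_gt0// ler_pdivrMr// mulrC.
  by rewrite ler_norml; apply/andP; split; lra.
- apply: image_subset => x /= xs p.
  have : lnorm (dilation m S s^-1 x) <= 1 by rewrite ssc ler_pdivrMr// mul1r ltW.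
  move=> /MP/(_ p); have sp : 0 < s ^+ wt p by rewrite exprn_gt0.
  rewrite sc mulrC normrM [X in _ * X]gtr0_norm ?invr_gt0// ler_pdivrMr// mulrC.
  have sM : 0 < s ^+ wt p * M by rewrite mulr_gt0.
  by rewrite ler_norml => /andP[h1 h2]; apply/andP; split; lra.
Qed.

(** A radius between a good scale and its double loses at most the factor [2 ^+ Q] in either bound,
    hence the constants. *)
Lemma stratified_group_ahlfors : exists K c1 c2 vol zs,
  @ahlfors_regular _ (borel G) R mu (hdist rho) Q%:R K c1 c2 vol zs.
Proof.
have [K K1 KP] := hdist_quasi_triangle rhoP.
have [a [A [a0 A0 aA]]] := sublevel_measure.
have [zs zsP] := hdist_separable rhoP.
have mB z r : measurable (qball (hdist rho) z r : set (borel G)).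
  by apply: measurable_open; exact: open_qball.
have bounds r : 0 < r ->
    ((a / 2 ^+ Q * r ^+ Q)%:E <= mu (qball (hdist rho) 1%g r) <= (A * 2 ^+ Q * r ^+ Q)%:E)%E.
  move=> r0.
  have [s [s0 gs sr rs]] := dyadic_induction good_scale1 good_scale_double good_scale_half r0.
  have /andP[h1 _] := aA s s0 gs.
  have s20 : 0 < 2 * s by rewrite mulr_gt0.
  have /andP[_ h2] := aA (2 * s) s20 (good_scale_double s0 gs).
  apply/andP; split.
    apply: (@le_trans _ _ (a * s ^+ Q)%:E).
      rewrite lee_fin -mulrA ler_pM2l// mulrC -expr_div_n.
      by apply: lerXn2r; rewrite ?nnegrE; lra.
    apply: (le_trans h1); apply: le_measure; rewrite ?inE//.
    exact: subset_qball.
  apply: (@le_trans _ _ (A * (2 * s) ^+ Q)%:E).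
    apply: le_trans h2; apply: le_measure; rewrite ?inE//.
    exact: subset_qball.
  rewrite lee_fin -mulrA ler_pM2l// exprMn ler_pM2l ?exprn_gt0//.
  by apply: lerXn2r; rewrite ?nnegrE; lra.
exists K, (a / 2 ^+ Q), (A * 2 ^+ Q), (fun r => fine (mu (qball (hdist rho) 1%g r))), zs.
have fin r : mu (qball (hdist rho) 1%g r) \is a fin_num.
  have [r0|r0] := ltP 0 r.
    by have /andP[_ h] := bounds r r0; rewrite ge0_fin_numE// (le_lt_trans h) ?ltry.
  rewrite (_ : qball _ _ _ = set0) ?measure0//.
  apply/seteqP; split => // y; rewrite /qball/= => yr.
  by have := hnorm_ge0 rhoP (y^-1 * 1)%g; rewrite leNgt (lt_le_trans yr r0).
split.
- by move=> x y; exact: (hnorm_ge0 rhoP).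
- by move=> x y; exact: (hdist_eq0 rhoP).
- by move=> x y; exact: (hdist_sym rhoP).
- exact: K1.
- exact: KP.
- exact: mB.
- by move=> x r; rewrite fineK; [exact: (qball_measure_translate rhoP muP)|exact: fin].
- by rewrite ltr0n hom_dim_gt0.
- by rewrite divr_gt0// exprn_gt0.
- move=> r r0; rewrite powR_mulrn ?(ltW r0)// -lee_fin fineK//.
  by have /andP[] := bounds r r0.
- move=> r r0; rewrite powR_mulrn ?(ltW r0)// -lee_fin fineK//.
  by have /andP[] := bounds r r0.
- exact: zsP.
Qed.
End ball_volume.

(** * The equivalence *)

Lemma LfunE_measurable d (T : measurableType d) (R : realType)
    (mu : {measure set T -> \bar R}) (p : \bar R) (f : T -> R) :
  f \in Lfun mu p <-> measurable_fun setT f /\ ('N[mu]_p[EFin \o f] < +oo)%E.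
Proof.
split=> [fL|[mf ff]].
  by split; [exact: (set_mem (sub_Lfun_mfun fL))|exact: (set_mem (sub_Lfun_finLfun fL))].
by apply/andP; rewrite !inE; split.
Qed.

Theorem theorem1p1 (R : realType) (G : stratifiedLieGroup R)
    (rho : G -> R) (rhoP : is_homogeneous_norm rho)
    (mu : {measure set (borel G) -> \bar R}) (muP : is_haar mu)
    (b : borel G -> R) (bP : loc_integrable mu b)
    (beta : R) (beta_range : 0 < beta < 1) :
  let Q : R := (hom_dim G)%:R in
  let Mb := maximal_commutator rho mu b in
  [<-> lipschitz_space rho mu beta b;
       forall p q : R, 1 < p < Q / beta -> q^-1 = p^-1 - beta / Q ->
         bounded_Lp_Lq mu p q Mb;
       exists p q : R, [/\ 1 < p < Q / beta, q^-1 = p^-1 - beta / Q &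
         bounded_Lp_Lq mu p q Mb];
       weak_type_1 mu (Q / (Q - beta)) Mb].
Proof.
move=> Q Mb.
have [K [c1 [c2 [vol [zs hR]]]]] := stratified_group_ahlfors rhoP muP.
have mb : measurable_fun setT b := bP.1.
have /andP[beta0 beta1] := beta_range.
have Q1 : 1 <= Q by rewrite /Q ler1n hom_dim_gt0.
have bQ : beta < Q by exact: lt_le_trans Q1.
have Q0 : 0 < Q by exact: lt_le_trans Q1.
have q_gt0 p q : 1 < p < Q / beta -> q^-1 = p^-1 - beta / Q -> 0 < q.
  move=> /andP[p1 pQ] qE; rewrite -invr_gt0 qE subr_gt0 -invf_div.
  by rewrite ltf_pV2 ?posrE ?divr_gt0// (lt_trans _ p1).
have lip_of_osc H : 0 < H ->
    (forall z r, 0 < r -> exists c : R, (\int[mu]_(y in qball (hdist rho) z r) `|b y - c|%:E <=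
      (H * vol r `^ (beta / Q) * vol r)%:E)%E) -> lipschitz_space rho mu beta b.
  move=> H0 osc; have [b' bb' [C C0 CP]] := lipschitz_of_osc hR mb beta0 H0 osc.
  exists b' => //; exists C => // x y.
  by have := CP x y; rewrite (hdist_sym rhoP).
have lip12 : lipschitz_space rho mu beta b -> forall p q : R, 1 < p < Q / beta ->
    q^-1 = p^-1 - beta / Q -> bounded_Lp_Lq mu p q Mb.
  move=> [b' bb' [C C0 CP]] p q pQ qE; have /andP[p1 _] := pQ.
  have CP' x y : `|b' x - b' y| <= C * hdist rho x y `^ beta.
    by rewrite (hdist_sym rhoP); exact: CP.
  have [C' C'0 C'P] := comm_op_Lp_Lq hR mb beta0 C0 bb' CP' p1 (q_gt0 _ _ pQ qE) qE.
  by exists C' => // f /LfunE_measurable[mf fy]; exact: C'P.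
have lip14 : lipschitz_space rho mu beta b -> weak_type_1 mu (Q / (Q - beta)) Mb.
  move=> [b' bb' [C C0 CP]].
  have CP' x y : `|b' x - b' y| <= C * hdist rho x y `^ beta.
    by rewrite (hdist_sym rhoP); exact: CP.
  have [C' C'0 C'P] := comm_op_weak_type hR mb beta0 C0 bb' CP' bQ.
  by exists C' => // l f l0 /LfunE_measurable[mf fy]; exact: C'P.
have lip31 : (exists p q : R, [/\ 1 < p < Q / beta, q^-1 = p^-1 - beta / Q &
    bounded_Lp_Lq mu p q Mb]) -> lipschitz_space rho mu beta b.
  move=> [p [q [pQ qE [C C0 CP]]]]; have /andP[p1 _] := pQ.
  apply: (@lip_of_osc (2 * C)); first by rewrite mulr_gt0.
  apply: (osc_of_Lp_Lq hR mb beta0 p1 (q_gt0 _ _ pQ qE) qE C0) => f mf fy.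
  by apply: CP; apply/LfunE_measurable.
have lip41 : weak_type_1 mu (Q / (Q - beta)) Mb -> lipschitz_space rho mu beta b.
  move=> [C C0 CP].
  apply: (@lip_of_osc (2 * C `^ (1 - beta / Q))); first by rewrite mulr_gt0// powR_gt0.
  apply: (osc_of_weak_type hR mb beta0 bQ C0) => l f l0 mf fy.
  by apply: CP => //; apply/LfunE_measurable.
(* The implications run in a cycle; the one from (3) to (4) passes through (1). *)
tfae => //.
(* The midpoint of the admissible interval, which is nonempty because [beta < Q]; [q] is then
   determined by the relation. *)
- move=> H; pose p := (1 + Q / beta) / 2.
  have Qb : 1 < Q / beta by rewrite ltr_pdivlMr// mul1r.
  have pQ : 1 < p < Q / beta by rewrite /p; apply/andP; split; lra.
  exists p, (p^-1 - beta / Q)^-1; split => //; first by rewrite invrK.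
  by apply: H => //; rewrite invrK.
- by move=> /lip31/lip14.
Qed.
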